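(* Let $q$ be a prime power, $m,n\ge 1$ integers, $R'_{2,2m}=\mathbb{F}_q[[T]]+T^m\mathbb{F}_{q^2}[[T]]$, $z:=q^{-1}$ and $t:=q^{-s}$. Then $$\begin{aligned}\widehat{\zeta}_{R'_{2,2m},n}(s)=(z;z)_n\sum_{\substack{r_1,\ldots,r_m\ge 0\\ s_1,\ldots,s_m\ge 0}}&\frac{t^{\sum_{i=1}^m(2r_i-s_i)}\,z^{\sum_{i=1}^m(r_i^2-r_is_i+s_i^2)}}{(z;z)_{n-r_m}(z;z)_{r_m-r_{m-1}}\cdots(z;z)_{r_2-r_1}(z;z)_{r_1}(t^2z^2;z^2)_{r_1}}\\ &\times\frac{(-z;z)_{r_1}}{(-z;z)_{s_1}}{r_m-s_{m-1}\brack r_m-s_m}_z{r_{m-1}-s_{m-2}\brack r_{m-1}-s_{m-1}}_z\cdots{r_2-s_1\brack r_2-s_2}_z{r_1\brack r_1-s_1}_z.\end{aligned}$$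
   Context: Pochhammer symbols: $(A;x)_N:=\prod_{j=0}^{N-1}(1-Ax^j)$, with $1/(x;x)_k:=0$ for $k<0$. The $q$-binomial coefficient ${N\brack M}_x$ is $\frac{(x;x)_N}{(x;x)_M(x;x)_{N-M}}$ if $0\le M\le N$, and $0$ otherwise. For $m=1$ the product of $q$-binomials is just ${r_1\brack r_1-s_1}_z$. For a commutative ring $R$, $\zeta_{R^n}^R(s):=\sum_L|R^n/L|^{-s}$ summed over all finite-index $R$-submodules $L\subseteq R^n$, and the finitized rank-$n$ Coh zeta function is $\widehat{\zeta}_{R,n}(s):=\zeta^R_{R^n}(s+n)$. For $R=R'_{2,2m}$ it is a formal power series in $t=q^{-s}$ (replacing $s$ by $s+n$ means replacing $t$ by $tq^{-n}$). The summation indices $s_1,\ldots,s_m$ are integers, unrelated to the variable $s$. *)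

(* Defs.v *)
From HB Require Import structures.
From mathcomp Require Import all_boot all_order all_algebra all_field.
From mathcomp Require Import finmap.
From mathcomp Require Import mathcomp_extra boolp classical_sets functions.
From mathcomp Require Import cardinality fsbigop.
From mathcomp Require Import zify.

Set Implicit Arguments.
Unset Strict Implicit.
Unset Printing Implicit Defensive.

Import GRing.Theory Num.Theory.

Local Open Scope classical_set_scope.
Local Open Scope ring_scope.

Record fps (R : Type) := FPS { coefs : nat -> R }.

Lemma fpsP (R : Type) (f g : fps R) : coefs f =1 coefs g <-> f = g.
Proof. by case: f g => f [g] /=; split=> [/funext->|[->]]. Qed.

HB.instance Definition _ (R : Type) := [isNew for @coefs R].
HB.instance Definition _ (R : choiceType) := [Choice of fps R by <:].

Section FpsZmod.
Variable R : zmodType.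
Implicit Types f g h : fps R.

Definition fps_zero : fps R := FPS (fun _ => 0).
Definition fps_opp f := FPS (fun k => - coefs f k).
Definition fps_add f g := FPS (fun k => coefs f k + coefs g k).

Fact fps_addA : associative fps_add.
Proof. by move=> f g h; apply/fpsP => k; exact: addrA. Qed.
Fact fps_addC : commutative fps_add.
Proof. by move=> f g; apply/fpsP => k; exact: addrC. Qed.
Fact fps_add0 : left_id fps_zero fps_add.
Proof. by move=> f; apply/fpsP => k; exact: add0r. Qed.
Fact fps_addN : left_inverse fps_zero fps_opp fps_add.
Proof. by move=> f; apply/fpsP => k; exact: addNr. Qed.

HB.instance Definition _ :=
  GRing.isZmodule.Build (fps R) fps_addA fps_addC fps_add0 fps_addN.

Lemma coefs0 k : coefs (0 : fps R) k = 0. Proof. by []. Qed.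
Lemma coefsN f k : coefs (- f) k = - coefs f k. Proof. by []. Qed.
Lemma coefsD f g k : coefs (f + g) k = coefs f k + coefs g k.
Proof. by []. Qed.
Lemma coefsB f g k : coefs (f - g) k = coefs f k - coefs g k.
Proof. by []. Qed.
End FpsZmod.

Section FpsRing.
Variable R : comNzRingType.
Implicit Types f g h : fps R.

Definition fpsC (c : R) : fps R := FPS (fun k => if k == 0%N then c else 0).
Definition fps_mul f g : fps R :=
  FPS (fun k => \sum_(i < k.+1) coefs f i * coefs g (k - i)).

Let tr n f : {poly R} := \poly_(i < n) coefs f i.

Let coef_trM n f g k : (k < n)%N ->
  (tr n f * tr n g)`_k = coefs (fps_mul f g) k.
Proof.
move=> lkn; rewrite coefM; apply: eq_bigr => i _.
have lik : (i < n)%N by have := ltn_ord i; lia.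
by rewrite !coef_poly lik (leq_ltn_trans (leq_subr _ _) lkn).
Qed.

Let coefM_le (p p' r r' : {poly R}) n :
    (forall i, (i <= n)%N -> p`_i = p'`_i) ->
    (forall i, (i <= n)%N -> r`_i = r'`_i) -> (p * r)`_n = (p' * r')`_n.
Proof.
move=> ep er; rewrite !coefM; apply: eq_bigr => i _.
by rewrite ep ?er ?leq_subr // -ltnS.
Qed.

Let coef_tr n f i : (i < n)%N -> (tr n f)`_i = coefs f i.
Proof. by move=> lin; rewrite coef_poly lin. Qed.

Fact fps_mulA : associative fps_mul.
Proof.
move=> f g h; apply/fpsP => k.
rewrite -!(@coef_trM k.+1) //.
transitivity (tr k.+1 f * (tr k.+1 g * tr k.+1 h))`_k.
  by apply: coefM_le => // i lik; rewrite coef_tr // coef_trM.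
rewrite mulrA; apply: coefM_le => // i lik.
by rewrite coef_tr // coef_trM.
Qed.

Fact fps_mulC : commutative fps_mul.
Proof.
by move=> f g; apply/fpsP => k; rewrite -!(@coef_trM k.+1) // mulrC.
Qed.

Fact fps_mul1 : left_id (fpsC 1) fps_mul.
Proof.
move=> f; apply/fpsP => k; rewrite /= big_ord_recl /= mul1r subn0.
by rewrite big1 ?addr0 // => i _; rewrite mul0r.
Qed.

Fact fps_mulDl : left_distributive fps_mul +%R.
Proof.
move=> f g h; apply/fpsP => k; rewrite /= -big_split /=.
by apply: eq_bigr => i _; rewrite mulrDl.
Qed.

Fact fps_one_neq0 : fpsC 1 != 0.
Proof.
by apply/eqP => /(congr1 (fun f => coefs f 0%N)) /=; apply/eqP/oner_neq0.
Qed.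

HB.instance Definition _ := GRing.Zmodule_isComNzRing.Build (fps R)
  fps_mulA fps_mulC fps_mul1 fps_mulDl fps_one_neq0.

Definition fpsX : fps R := FPS (fun k => (k == 1%N)%:R).

(* The substitution T := c T. *)
Definition fps_scale (c : R) f : fps R := FPS (fun k => c ^+ k * coefs f k).

Lemma coefs1 k : coefs (1 : fps R) k = (k == 0%N)%:R.
Proof. by rewrite /=; case: (k == 0%N). Qed.

Lemma coefsM f g k :
  coefs (f * g) k = \sum_(i < k.+1) coefs f i * coefs g (k - i).
Proof. by []. Qed.

Lemma coefsXnM j f k :
  coefs (fpsX ^+ j * f) k = if (k < j)%N then 0 else coefs f (k - j).
Proof.
elim: j f k => [|j IH] f k; first by rewrite expr0 mul1r subn0.
rewrite exprSr -mulrA IH; case: ltnP => [lkj|ljk].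
  by rewrite (ltn_trans lkj).
rewrite coefsM; case: ltnP => [lkj|ljk'].
  have -> : (k - j = 0)%N by lia.
  by rewrite big_ord1 /= mul0r.
rewrite (bigD1 (inord 1)) //= inordK ?mul1r; last by lia.
rewrite big1 ?addr0 => [|i]; first by congr coefs; lia.
rewrite -val_eqE /= inordK; last by lia.
by move=> /negPf->; rewrite mul0r.
Qed.

End FpsRing.

Arguments fpsX {R}.

Section FpsInv.
Variable R : comUnitRingType.
Implicit Types f g : fps R.

Fixpoint fps_inv_seq f k : seq R :=
  if k is k'.+1 then
    let s := fps_inv_seq f k' in
    rcons s ((coefs f 0)^-1 *
             ((k' == 0%N)%:R - \sum_(i < k') coefs f (k' - i) * s`_i))
  else [::].

Definition fps_unit : {pred fps R} := fun f => coefs f 0 \is a GRing.unit.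

Definition fps_inv f : fps R :=
  if coefs f 0 \is a GRing.unit then FPS (fun k => (fps_inv_seq f k.+1)`_k)
  else f.

Let size_inv f k : size (fps_inv_seq f k) = k.
Proof. by elim: k => //= k IH; rewrite size_rcons IH. Qed.

Let nth_inv f k i : (i < k)%N -> (fps_inv_seq f k)`_i = (fps_inv_seq f i.+1)`_i.
Proof.
elim: k => // k IH; rewrite ltnS leq_eqVlt => /predU1P[->//|lik].
by rewrite -IH // /= nth_rcons size_inv lik.
Qed.

Fact fps_mulVf : {in fps_unit, left_inverse 1 fps_inv *%R}.
Proof.
move=> f; rewrite unfold_in => fU; apply/fpsP => k.
rewrite /fps_inv fU coefs1 coefsM big_ord_recr /= subnn.
rewrite nth_rcons size_inv ltnn eqxx mulrC mulVKr //.
rewrite (eq_bigr (fun i : 'I_k => coefs f (k - i) * (fps_inv_seq f k)`_i)).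
  by rewrite addrC subrK.
by move=> i _; rewrite mulrC [in RHS]nth_inv.
Qed.

Fact fps_unitPl f g : g * f = 1 -> fps_unit f.
Proof.
move/(congr1 (fun h => coefs h 0)); rewrite coefsM big_ord1 coefs1 /= => gf1.
by apply/unitrPr; exists (coefs g 0); rewrite mulrC.
Qed.

Fact fps_inv_out : {in [predC fps_unit], fps_inv =1 id}.
Proof. by move=> f; rewrite inE /= unfold_in /fps_inv => /negPf->. Qed.

HB.instance Definition _ := GRing.ComNzRing_hasMulInverse.Build (fps R)
  fps_mulVf fps_unitPl fps_inv_out.

End FpsInv.

Definition map_fps (R S : Type) (h : R -> S) (f : fps R) : fps S :=
  FPS (fun k => h (coefs f k)).

(* For [L] quadratic over [F] this is the ring [R'_{2,2m}]. *)
Definition Rprime_pred (F : fieldType) (L : fieldExtType F) (m : nat) :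
    {pred fps L} :=
  fun f => `[< exists (a : fps F) (b : fps L),
                 f = map_fps (in_alg L) a + fpsX ^+ m * b >].
Arguments Rprime_pred {F} L m _.

Section Rprime.
Variables (F : fieldType) (L : fieldExtType F) (m : nat).

Lemma Rprime_predP (f : fps L) : reflect
  (forall i, (i < m)%N -> exists c : F, coefs f i = c%:A)
  (f \in Rprime_pred L m).
Proof.
rewrite unfold_in; apply: (iffP (asboolP _)) => [[a [b ->]] i lim|fF].
  by exists (coefs a i); rewrite coefsD coefsXnM lim addr0.
have /choice[a aP] i : exists c : F, (i < m)%N -> coefs f i = c%:A.
  case: (ltnP i m) => [/fF[c fc]|_]; last by exists 0.
  by exists c.
exists (FPS (fun i => if (i < m)%N then a i else 0)).
exists (FPS (fun i => coefs f (i + m))).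
apply/fpsP => i; rewrite coefsD coefsXnM /=; case: ltnP => [/aP->|lmi].
  by rewrite addr0.
by rewrite scale0r add0r subnK.
Qed.

Fact Rprime_subring : subring_closed (Rprime_pred L m).
Proof.
split=> [|f g /Rprime_predP fF /Rprime_predP gF|f g /Rprime_predP fF /Rprime_predP gF];
    apply/Rprime_predP => i lim.
- exists (i == 0%N)%:R; rewrite coefs1.
  by case: eqP; rewrite ?scale1r ?scale0r.
- have [[c fc] [d gd]] := (fF i lim, gF i lim).
  by exists (c - d); rewrite coefsB fc gd scalerBl.
- have cP (h : fps L) : (forall j, (j < m)%N -> exists c : F, coefs h j = c%:A) ->
      forall j : 'I_i.+1, exists c : F, coefs h j = c%:A.
    by move=> hF j; apply: hF; have := ltn_ord j; lia.
  have /choice[c fc] := cP _ fF.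
  have /choice[d gd] : forall j : 'I_i.+1, exists d : F, coefs g (i - j) = d%:A.
    by move=> j; apply: gF; lia.
  exists (\sum_j c j * d j); rewrite coefsM scaler_suml.
  apply: eq_bigr => j _; rewrite fc gd.
  by rewrite -scalerAl mul1r scalerA.
Qed.

HB.instance Definition _ :=
  GRing.isSubringClosed.Build (fps L) (Rprime_pred L m) Rprime_subring.

Record Rprime := MkRprime {
  Rprime_val :> fps L;
  _ : Rprime_val \in Rprime_pred L m }.

HB.instance Definition _ := [isSub for Rprime_val].
HB.instance Definition _ := [Choice of Rprime by <:].
HB.instance Definition _ := [SubChoice_isSubComNzRing of Rprime by <:].

Lemma Rprime_val_inj : injective Rprime_val. Proof. exact: val_inj. Qed.
Lemma Rprime_val0 : Rprime_val 0 = 0. Proof. by []. Qed.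
Lemma Rprime_val1 : Rprime_val 1 = 1. Proof. by []. Qed.
Lemma Rprime_valD (f g : Rprime) :
  Rprime_val (f + g) = Rprime_val f + Rprime_val g.
Proof. exact: (rmorphD (val : Rprime -> fps L)). Qed.
Lemma Rprime_valB (f g : Rprime) :
  Rprime_val (f - g) = Rprime_val f - Rprime_val g.
Proof. exact: (rmorphB (val : Rprime -> fps L)). Qed.
Lemma Rprime_valM (f g : Rprime) :
  Rprime_val (f * g) = Rprime_val f * Rprime_val g.
Proof. exact: (rmorphM (val : Rprime -> fps L)). Qed.
Lemma Rprime_valX (f : Rprime) k : Rprime_val (f ^+ k) = Rprime_val f ^+ k.
Proof. exact: (rmorphXn (val : Rprime -> fps L)). Qed.

End Rprime.

Section Zeta.
Variables (R : comNzRingType) (n : nat).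
Implicit Types M : set 'rV[R]_n.

(* The underlying set of the quotient [R^n / M]. *)
Definition cosets M : set (set 'rV[R]_n) :=
  range (fun x => [set y | M (y - x)]).

Definition quot_card M : nat := #|` fset_set (cosets M)|.

Definition submodules_of_index (N : nat) : set (set 'rV[R]_n) :=
  [set M : set 'rV[R]_n |
    [/\ submod_closed [in M], finite_set (cosets M) & quot_card M = N]].

(* [\sum_M |R^n/M|^(-s)] written as a power series in [t = q^(-s)]; it is
   meaningful when all finite indices are powers of [q] and each one occurs
   finitely often; for [Rprime] this is [quot_card_Rprime] and
   [finite_submodules_Rprime] below. *)
Definition zeta (q : nat) : fps rat :=
  FPS (fun k => #|` fset_set (submodules_of_index (q ^ k))|%:R).

(* Replacing [s] by [s + n] amounts to replacing [t] by [q^(-n) t]. *)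
Definition coh_zeta (q : nat) : fps rat := fps_scale (q%:R ^- n) (zeta q).

Lemma submod0 M : submod_closed [in M] -> M 0.
Proof. by case=> + _; rewrite !inE. Qed.

Lemma submodZD M a x y : submod_closed [in M] -> M x -> M y -> M (a *: x + y).
Proof.
by case=> _ lM Mx My; have := lM a x y; rewrite !inE; apply.
Qed.

Lemma submodZ M a x : submod_closed [in M] -> M x -> M (a *: x).
Proof. by move=> sM Mx; rewrite -[_ *: _]addr0; apply: submodZD (submod0 sM). Qed.

Lemma submodD M x y : submod_closed [in M] -> M x -> M y -> M (x + y).
Proof. by move=> sM Mx; rewrite -[x]scale1r; exact: submodZD. Qed.

Lemma submodN M x : submod_closed [in M] -> M x -> M (- x).
Proof. by rewrite -scaleN1r; exact: submodZ. Qed.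

Lemma coset_inj M x y : submod_closed [in M] ->
  [set z | M (z - x)] = [set z | M (z - y)] -> M (x - y).
Proof.
move=> sM /seteqP[/(_ x) + _]; rewrite /= subrr; apply; exact: submod0.
Qed.

Lemma coset_eq M x y : submod_closed [in M] -> M (x - y) ->
  [set z | M (z - x)] = [set z | M (z - y)].
Proof.
move=> sM Mxy; apply/seteqP; split=> z /= Mz.
  by rewrite -(subrK x z) -addrA; apply: submodD.
by rewrite -(subrK y z) -addrA; apply: submodD => //; rewrite -opprB; apply: submodN.
Qed.

Lemma exprM_submod M (a : R) : submod_closed [in M] -> finite_set (cosets M) ->
    (forall d, (0 < d)%N -> exists u : R, u * (1 - a ^+ d) = 1) ->
  forall x, M (a ^+ quot_card M *: x).
Proof.
move=> sM finM aU x; pose c j : set 'rV[R]_n := [set y | M (y - a ^+ j *: x)].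
have cM j : c j \in fset_set (cosets M).
  by rewrite in_fset_set //; apply/mem_set; exists (a ^+ j *: x).
pose f (j : 'I_(quot_card M).+1) : fset_set (cosets M) := [` cM j]%fset.
have /injectivePn[i0 [j0 ij0 fij0]] : ~~ injectiveb f.
  apply/negP => /injectiveP /leq_card; rewrite card_ord -cardfE.
  by rewrite ltnn.
have [i [j [lij ljN cij]]] :
    exists i j, [/\ (i < j)%N, (j <= quot_card M)%N & c i = c j].
  have cE : c i0 = c j0 := congr1 val fij0.
  move: ij0; rewrite -val_eqE /= neq_ltn => /orP[lt|lt].
    by exists i0, j0; split; [exact: lt|by have := ltn_ord j0|exact: cE].
  by exists j0, i0; split; [exact: lt|by have := ltn_ord i0|exact: esym cE].
have Mij := coset_inj sM cij.
have [|u uE] := aU (j - i)%N; first by rewrite subn_gt0.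
have -> : a ^+ quot_card M *: x =
    (a ^+ (quot_card M - i) * u) *: (a ^+ i *: x - a ^+ j *: x).
  have -> : a ^+ i *: x - a ^+ j *: x = ((1 - a ^+ (j - i)) * a ^+ i) *: x.
    by rewrite mulrBl mul1r -exprD subnK ?scalerBl // ltnW.
  rewrite scalerA -mulrA (mulrA u) uE mul1r -exprD subnK //.
  exact: leq_trans (ltnW lij) ljN.
exact: submodZ.
Qed.

End Zeta.
Arguments submodules_of_index : clear implicits.

Section RprimeZeta.
Variables (F : finFieldType) (L : fieldExtType F) (m n : nat).
Local Notation R := (Rprime L m).
Local Notation V := 'rV[R]_n.
Implicit Types (M : set V) (x y : V) (N : nat).

Fact fpsX_Rprime : fpsX \in Rprime_pred L m.
Proof.
apply/Rprime_predP => i _; exists (i == 1%N)%:R => /=.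
by case: eqP; rewrite ?scale1r ?scale0r.
Qed.

Let tau : R := MkRprime fpsX_Rprime.

Let tau_unit d : (0 < d)%N -> exists u : R, u * (1 - tau ^+ d) = 1.
Proof.
move=> d_gt0.
have uP : FPS (fun k => (d %| k)%:R) \in Rprime_pred L m.
  apply/Rprime_predP => i _; exists (d %| i)%:R => /=.
  by case: (d %| i)%N; rewrite ?scale1r ?scale0r.
exists (MkRprime uP); apply/Rprime_val_inj.
rewrite Rprime_valM Rprime_valB Rprime_val1 Rprime_valX /=.
rewrite mulrC mulrBl mul1r; apply/fpsP => k.
rewrite coefsB coefsXnM coefs1 /=; case: ltnP => [lkd|ldk].
  rewrite subr0; case: k lkd => [|k] lkd; first by rewrite dvdn0.
  by rewrite gtnNdvd.
rewrite dvdn_subl // subrr.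
by case: k ldk => // /(leq_trans d_gt0).
Qed.

Let W K := {ffun 'I_n * 'I_K -> L}.
Let tr K x : W K := [ffun ik : 'I_n * 'I_K => coefs (Rprime_val (x 0 ik.1)) ik.2].

Let tr_sub M x y : submod_closed [in M] -> finite_set (cosets M) ->
  tr (quot_card M + m) x = tr (quot_card M + m) y -> M (x - y).
Proof.
set N := quot_card M => sM finM trE.
pose g i := FPS (fun k => coefs (Rprime_val ((x - y) 0 i)) (k + N)).
have lo i k : (k < N + m)%N -> coefs (Rprime_val ((x - y) 0 i)) k = 0.
  move=> lk; have /ffunP/(_ (i, Ordinal lk)) := trE.
  rewrite !ffunE /= => e.
  by rewrite !mxE Rprime_valB coefsB e subrr.
have gP i : g i \in Rprime_pred L m.
  apply/Rprime_predP => k lkm; exists 0; rewrite /= lo ?scale0r //.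
  by rewrite addnC ltn_add2l.
suff -> : x - y = tau ^+ N *: (\row_i MkRprime (gP i)) by by apply: exprM_submod => //; exact: tau_unit.
apply/rowP => i; rewrite [RHS]mxE [X in _ * X]mxE; apply/Rprime_val_inj.
rewrite Rprime_valM Rprime_valX /=; apply/fpsP => k.
rewrite coefsXnM; case: ltnP => [lkN|lNk].
  by rewrite lo // ltn_addr.
by rewrite /= subnK.
Qed.

Lemma finite_submodules_Rprime N : finite_set (submodules_of_index R n N).
Proof.
pose fW : finType := {ffun 'I_n * 'I_(N + m) -> finvect_type L}.
pose phi M : {set fW} := 
    [set w : fW | `[< exists2 x, M x & (tr (N + m) x : fW) = w >]]%SET.
have phi_sub M M' : submodules_of_index R n N M ->
    submodules_of_index R n N M' -> phi M = phi M' -> M `<=` M'.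
  move=> [sM _ _] [sM' finM' NM'] /setP phiE x Mx.
  have := phiE (tr (N + m) x : fW); rewrite !inE.
  have -> : `[< exists2 x', M x' & tr (N + m) x' = tr (N + m) x >].
    by apply/asboolP; exists x.
  move=> /esym/asboolP[x' M'x' trE]; rewrite -(subrK x' x).
  apply: submodD => //; apply: tr_sub => //.
  by rewrite NM' -trE.
have [g gK] : exists g : {set fW} -> set V,
    forall M, submodules_of_index R n N M -> g (phi M) = M.
  have /choice[g gP] : forall A : {set fW}, exists M0 : set V,
      forall M, submodules_of_index R n N M -> phi M = A -> M0 = M.
    move=> A; case: (pselect (exists2 M, submodules_of_index R n N M & phi M = A)).
      move=> [M0 sM0 phiM0]; exists M0 => M sM phiM.
      by apply/seteqP; split; apply: phi_sub; rewrite ?phiM ?phiM0.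
    by move=> nex; exists set0 => M sM phiM; case: nex; exists M.
  by exists g => M sM; apply: gP.
apply: (@sub_finite_set _ _ (range g)); last exact: finite_image.
by move=> M sM; exists (phi M); rewrite ?gK.
Qed.

Let subspaceP K (P : W K -> Prop) : P 0 ->
    (forall (a : F) u v, P u -> P v -> P (a *: u + v)) ->
  exists U : {vspace W K}, forall w, P w <-> w \in U.
Proof.
move=> P0 Plin.
pose Q d := `[< exists2 U : {vspace W K}, \dim U = d & forall w, w \in U -> P w >].
have exQ : exists d, Q d.
  exists 0%N; apply/asboolP; exists 0%VS; first exact: dimv0.
  by move=> w; rewrite memv0 => /eqP->.
have leQ d : Q d -> (d <= \dim {: W K})%N.
  by move=> /asboolP[U <- _]; apply/dimvS/subvf.
case: (ex_maxnP exQ leQ) => d /asboolP[U dimU UP] maxd.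
exists U => w; split=> [Pw|]; last exact: UP.
apply: contraPT isT => wU; have := maxd (\dim (U + <[w]>)).
have -> : Q (\dim (U + <[w]>)).
  apply/asboolP; exists (U + <[w]>)%VS => // _ /memv_addP[u uU [_ /vlineP[a ->] ->]].
  by rewrite addrC; apply: Plin => //; exact: UP.
move=> /(_ isT); rewrite -dimU => dimle; case/negP: wU.
have /eqP -> : U == (U + <[w]>)%VS by rewrite eqEdim addvSl.
by apply: (subvP (addvSr _ _)); exact: memv_line.
Qed.

Let cst_Rprime (a : F) : fpsC a%:A \in Rprime_pred L m.
Proof.
apply/Rprime_predP => i _ /=; case: eqP => _; first by exists a.
by exists 0; rewrite scale0r.
Qed.

Let tr_lin K (a : F) x y :
  tr K (MkRprime (cst_Rprime a) *: x + y) = a *: tr K x + tr K y.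
Proof.
apply/ffunP => -[i k]; rewrite !ffunE /= !mxE /=; congr (_ + _).
rewrite big_ord_recl /= subn0 big1 ?addr0 => [|j _]; last by rewrite mul0r.
by rewrite -scalerAl mul1r.
Qed.

Lemma quot_card_Rprime M : submod_closed [in M] -> finite_set (cosets M) ->
  exists k, quot_card M = (#|F| ^ k)%N.
Proof.
move=> sM finM; pose K := (quot_card M + m)%N.
have tr0 : tr K 0 = 0 by apply/ffunP => ik; rewrite !ffunE mxE.
have [|a _ _ [x _ <-] [y _ <-]|U UP] := @subspaceP K (range (tr K)).
- by exists 0.
- by exists (MkRprime (cst_Rprime a) *: x + y); rewrite ?tr_lin.
have [|a _ _ [x Mx <-] [y My <-]|U' U'P] := @subspaceP K (tr K @` M).
- by exists 0; first exact: submod0.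
- by exists (MkRprime (cst_Rprime a) *: x + y); rewrite ?tr_lin //; exact: submodZD.
have trM x : tr K x \in U' -> M x.
  move=> /U'P[x' Mx' trE]; rewrite -(subrK x' x); apply: submodD => //.
  exact: tr_sub.
have sU : (U' <= U)%VS by apply/subvP => w /U'P[x _ <-]; apply/UP; exists x.
pose D := (U :\: U')%VS; exists (\dim D).
pose b (v : 'rV[F]_(\dim D)) : W K := \sum_i v 0 i *: (vbasis D)`_i.
have bD v : b v \in D.
  by apply: memv_suml => i _; apply/memvZ/vbasis_mem/mem_nth; rewrite size_tuple.
have /choice[l lP] v : exists x, tr K x = b v.
  have /UP[x _ <-] : b v \in U by apply: (subvP (diffvSl _ _)) (bD v).
  by exists x.
pose h v : set V := [set y | M (y - l v)].
have trB x y : tr K (x - y) = tr K x - tr K y.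
  by apply/ffunP => ik; rewrite !ffunE !mxE.
have h_inj : injective h.
  move=> v v' /(coset_inj sM) Mll; have bvv : b v - b v' \in (D :&: U')%VS.
    rewrite memv_cap rpredB //= -!lP -trB.
    by apply/U'P; exists (l v - l v').
  move: bvv; rewrite capv_diff memv0 subr_eq0 => /eqP bE.
  have /freeP fr := basis_free (vbasisP D).
  apply/rowP => i; apply/eqP; rewrite -subr_eq0; apply/eqP; move: i.
  apply: (fr (fun i => v 0 i - v' 0 i)).
  under eq_bigr do rewrite scalerBl.
  by rewrite sumrB -/(b v) bE subrr.
have -> : quot_card M = #|` fset_set (range h)|.
  congr #|` fset_set _|; apply/seteqP; split; last by move=> _ [v _ <-]; exists (l v).
  move=> _ [x _ <-].
  have : tr K x \in (D + U')%VS.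
    rewrite addv_diff (addv_idPl sU); apply/UP.
    by exists x.
  case/memv_addP => d dD [u' u'U' xE].
  exists (\row_i coord (vbasis D) i d) => //; apply: coset_eq => //.
  apply: trM; rewrite trB lP xE.
  have -> : b (\row_i coord (vbasis D) i d) = d.
    rewrite [RHS](coord_vbasis dD); apply: eq_bigr => i _.
    by rewrite mxE.
  by rewrite opprD addrA subrr add0r rpredN.
rewrite (fset_set_image h finite_finset) (card_imfset _ _ h_inj) /=.
have -> : fset_set [set: 'rV[F]_(\dim D)] = [fset x in predT]%fset.
  apply/fsetP => v; rewrite in_fset_set; last exact: finite_finset.
  by rewrite in_setT !inE.
by rewrite card_imfset //= -cardE card_mx mul1n.
Qed.

End RprimeZeta.

Section QSeries.
Variable A : comUnitRingType.
Implicit Types a x : A.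

Definition qpoch a x (N : nat) : A := \prod_(j < N) (1 - a * x ^+ j).

(* [1 / (x; x)_k], which is 0 for negative [k]. *)
Definition inv_qpoch x (k : int) : A :=
  if k is Posz k' then (qpoch x x k')^-1 else 0.

Definition qbinom x (N M : int) : A :=
  if (0 <= M <= N) then
    qpoch x x `|N|%N / (qpoch x x `|M|%N * qpoch x x `|N - M|%N)
  else 0.

End QSeries.

(* The 1-based entry [u_i] of [u = (u_1, ..., u_m)], with [u_0 = 0]. *)
Definition entry (m : nat) (u : m.-tuple nat) (i : nat) : nat :=
  nth 0%N (0%N :: u) i.

(* With [r_0 = s_0 = 0] the factors [1/(z;z)_(r_1)] and [r_1 brack r_1 - s_1]
   are the case [i = 1] of the products. The series [t] is not invertible, but
   its exponent is negative only if some [s_i > r_i], and then the [i]-th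
   binomial vanishes. *)
Definition summand (z t : fps rat) (n m : nat) (rr ss : m.-tuple nat) : fps rat :=
  let r := entry rr in
  let s := entry ss in
  t ^ (\sum_(1 <= i < m.+1) (2 * (r i)%:Z - (s i)%:Z))
  * z ^ (\sum_(1 <= i < m.+1) ((r i)%:Z ^+ 2 - (r i)%:Z * (s i)%:Z + (s i)%:Z ^+ 2))
  * inv_qpoch z (n%:Z - (r m)%:Z)
  * (\prod_(1 <= i < m.+1) inv_qpoch z ((r i)%:Z - (r i.-1)%:Z))
  * (qpoch (t ^+ 2 * z ^+ 2) (z ^+ 2) (r 1))^-1
  * (qpoch (- z) z (r 1) / qpoch (- z) z (s 1))
  * (\prod_(1 <= i < m.+1)
       qbinom z ((r i)%:Z - (s i.-1)%:Z) ((r i)%:Z - (s i)%:Z)).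

Lemma summand_neq0 (z t : fps rat) (n m : nat) (rr ss : m.-tuple nat) :
  summand z t n rr ss != 0 ->
  forall i, (0 < i <= m)%N -> (entry ss i <= entry rr i <= n)%N.
Proof.
rewrite /summand; set Q := qpoch _ _ _ / _ => nz0.
have prod0 (f : nat -> fps rat) i : (0 < i <= m)%N -> f i = 0 ->
    \prod_(1 <= j < m.+1) f j = 0.
  move=> im fi0; rewrite (bigD1_seq i) /=; last exact: iota_uniq.
    by rewrite fi0 mul0r.
  by rewrite mem_index_iota ltnS.
have inv0 (k : int) : k < 0 -> inv_qpoch z k = 0 by case: k.
have rn : (entry rr m <= n)%N.
  rewrite leqNgt; apply/negP => lnr; case/eqP: nz0.
  by rewrite inv0 ?mulr0 ?mul0r // subr_lt0 ltz_nat.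
have rS i : (0 < i <= m)%N -> (entry rr i.-1 <= entry rr i)%N.
  move=> im; rewrite leqNgt; apply/negP => lr; case/eqP: nz0.
  by rewrite (prod0 _ i im) ?mulr0 ?mul0r // inv0 // subr_lt0 ltz_nat.
have sr i : (0 < i <= m)%N -> (entry ss i <= entry rr i)%N.
  move=> im; rewrite leqNgt; apply/negP => lr; case/eqP: nz0.
  rewrite [X in _ * X](prod0 _ i im) ?mulr0 // /qbinom.
  by rewrite subr_ge0 lez_nat leqNgt lr.
have rle d i : (i + d = m)%N -> (entry rr i <= n)%N.
  elim: d i => [|d IH] i idm; first by rewrite -(addn0 i) idm.
  apply: leq_trans (IH i.+1 _); last by rewrite -idm addSnnS.
  by apply: (rS i.+1); lia.
by move=> i im; rewrite sr //= (rle (m - i)%N) //; lia.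
Qed.

Lemma finite_support_summand (z t : fps rat) (n m : nat) :
  finite_set [set rs : m.-tuple nat * m.-tuple nat |
              summand z t n rs.1 rs.2 != 0].
Proof.
pose g (uv : m.-tuple 'I_n.+1 * m.-tuple 'I_n.+1) :=
  (map_tuple val uv.1, map_tuple val uv.2).
apply: (@sub_finite_set _ _ (range g)); last exact: finite_image.
move=> [rr ss] /= /summand_neq0 le_n.
have valK (u : m.-tuple nat) : (forall i, (0 < i <= m)%N -> (entry u i <= n)%N) ->
    map_tuple val (map_tuple (@inord n) u) = u.
  move=> un; apply: eq_from_tnth => i; rewrite !tnth_map /= inordK // ltnS.
  by have := un i.+1; rewrite /entry /= (tnth_nth 0%N); apply; rewrite /= ltn_ord.
exists (map_tuple (@inord n) rr, map_tuple (@inord n) ss); first by [].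
by rewrite /g !valK // => i /le_n /andP[]// sr; exact: leq_trans.
Qed.

(* Main.v *)
Require Import Defs.
From HB Require Import structures.
From mathcomp Require Import all_boot all_order all_algebra all_field.
From mathcomp Require Import mxabelem.
From mathcomp Require Import boolp classical_sets functions cardinality fsbigop.
From mathcomp Require Import finmap zify ring.

Set Implicit Arguments.
Unset Strict Implicit.
Unset Printing Implicit Defensive.

Import GRing.Theory Num.Theory.
Local Open Scope classical_set_scope.
Local Open Scope ring_scope.

(** Write [k] and [l] for the fields with [q] and [q^2] elements, [O = l[[T]]] and
    [R_j = k[[T]] + T^j O], so that [R_0 = O] and [R_m] is the ring of the theorem.
    The ring [R_(j+1)] is local with residue field [k] and maximal ideal [T R_j].
    This reduces the count of submodules over [R_m] to a count over [R_(m-1)], and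
    so on down to the discrete valuation ring [O]; the indices [r_i] and [s_i] of
    the multiple sum record the ranks met on the way. For a module [M] over
    [R_(j+1)] put [a(M) = dim_k (R_j M / M)].

    First reduction, from [R_(j+1)^n] to sublattices of [R_j^r]. Let [M] be an
    [R_(j+1)]-submodule of finite colength in [R_(j+1)^n]. Coordinate by
    coordinate, either [M] is contained in the sublattice where that coordinate is
    in [T R_j], or [M] contains a vector [v] with that coordinate equal to [1].
    In the second case [M] is [R_(j+1) v + M1], where [M1] is the part of [M]
    with zero coordinate, there are [q] to the colength of [M1] choices of [v]
    modulo [M1], and [a(M) = a(M1) + 1] ([has_card_peel], [ext_codim_extend]).
    Iterating produces Gaussian binomials [n, r] with [r] the number of
    coordinates of the first kind ([mixgf_gauss]); what is left are
    [R_(j+1)]-submodules of [(T R_j)^r], that is, of [R_j^r] after division by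
    [T].

    Second reduction, from [R_(j+1)] to [R_j] in [R_j^r]. Sort the submodules [M]
    by [M' = R_j M]. Such an [M] contains [T M'], so it is a [k]-subspace of
    [M' / T M'], a space of dimension [2 r] on which [T^j om] acts, where [om]
    generates [l] over [k]. The condition [R_j M = M'] says that the subspace and
    its image under this endomorphism span the space ([has_card_fibre_moved]). For
    [j > 0] the endomorphism has square zero and rank [a(M')] ([rank_endo]), and
    the number of subspaces of codimension [c = a(M)] is
    [q^(c (2 r - a(M')))] times the Gaussian binomial [a(M'), c]. For [j = 0] it
    generates a copy of the field [l], and one counts [c]-tuples independent
    over [l] instead. The lattices over [O] themselves are counted by the same
    peeling of coordinates ([genfun_powbox]).

    With [c = r_i - s_i], the first reduction shows that
    [a(M') = r_i - s_(i-1)] when the next rank is [r_(i-1)], so the two kinds of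
    binomials are exactly the factors of the summand ([partial_sum_rec],
    [partial_sum0]); the series is normalized so that the powers of [q] combine
    into [z^(r_i^2 - r_i s_i + s_i^2)]. *)

(** * Cardinalities of sets *)

(** Cardinality as a relation with an explicit enumeration: it states finiteness
    and the count together, and sums over fibres become concatenations. *)
Definition has_card {T : choiceType} (A : set T) (N : nat) :=
  exists2 s : seq T, uniq s & size s = N /\ forall x, A x <-> x \in s.

Section HasCard.
Implicit Types T U : choiceType.

Lemma has_card_eq T (A B : set T) N : (forall x, A x <-> B x) ->
  has_card A N -> has_card B N.
Proof.
by move=> AB [s us [sN sA]]; exists s => //; split=> // x; rewrite -AB.
Qed.

Lemma has_card0 T (A : set T) : (forall x, ~ A x) -> has_card A 0.
Proof. by move=> A0; exists [::] => //; split=> // x; split=> // /A0. Qed.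

Lemma has_cardU T (A B C : set T) N M : (forall x, C x <-> A x \/ B x) ->
  (forall x, A x -> ~ B x) -> has_card A N -> has_card B M ->
  has_card C (N + M).
Proof.
move=> CAB AB [s us [sN sA]] [r ur [rM rB]]; exists (s ++ r).
  rewrite cat_uniq us ur andbT; apply/hasPn => x /rB Bx.
  by apply/negP => /sA /AB.
split=> [|x]; first by rewrite size_cat sN rM.
rewrite CAB mem_cat; split=> [[/sA->//|/rB->]|/orP[/sA|/rB]]; rewrite ?orbT//.
  by left.
by right.
Qed.

Lemma has_card_sum T (I : eqType) (r : seq I) (A : set T) (B : I -> set T)
    (w : I -> nat) : uniq r ->
  (forall i j x, B i x -> B j x -> i = j) ->
  (forall x, A x <-> exists2 i, i \in r & B i x) ->
  (forall i, i \in r -> has_card (B i) (w i)) ->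
  has_card A (\sum_(i <- r) w i).
Proof.
move=> ur Bij; elim: r A ur => [|i r IH] A /= => [_|/andP[ir ur]] AB Bw.
  by rewrite big_nil; apply: has_card0 => x /AB[].
rewrite big_cons.
apply: (@has_cardU _ (B i) [set x | exists2 j, j \in r & B j x]).
- move=> x; rewrite AB; split=> [[j]|[Bix|[j jr Bjx]]].
  + by rewrite in_cons => /predU1P[->|jr] Bjx; [left|right; exists j].
  + by exists i => //; rewrite mem_head.
  + by exists j => //; rewrite in_cons jr orbT.
- by move=> x Bix [j jr Bjx]; rewrite (Bij _ _ _ Bix Bjx) jr in ir.
- by apply: Bw; rewrite mem_head.
- by apply: IH => // j jr; apply: Bw; rewrite in_cons jr orbT.
Qed.

Lemma has_card_fibre T U (A : set T) (B : set U) (f : T -> U) N w :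
  has_card B N -> (forall x, A x -> B (f x)) ->
  (forall b, B b -> has_card [set x | A x /\ f x = b] w) ->
  has_card A (N * w).
Proof.
move=> [s us [sN sB]] AB fw.
have -> : (N * w = \sum_(b <- s) w)%N.
  by rewrite big_const_seq count_predT iter_addn_0 sN mulnC.
apply: (@has_card_sum _ _ _ _ (fun b => [set x | A x /\ f x = b])) => //.
- by move=> b c x [_ <-] [_ <-].
- move=> x; split=> [Ax|[b _ []//]]; exists (f x) => //.
  by apply/sB/AB.
- by move=> b /sB; exact: fw.
Qed.

Lemma has_card_bij T U (A : set T) (B : set U) (g : T -> U) N :
  has_card A N -> (forall x y, A x -> A y -> g x = g y -> x = y) ->
  (forall y, B y <-> exists2 x, A x & g x = y) -> has_card B N.
Proof.
move=> [s us [sN sA]] ginj BA; exists (map g s).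
  by rewrite map_inj_in_uniq // => x y /sA Ax /sA Ay; exact: ginj.
split=> [|y]; first by rewrite size_map.
rewrite BA; split=> [[x /sA xs <-]|/mapP[x /sA xs ->]].
  exact: map_f.
by exists x.
Qed.

Lemma has_card_fin (T : finType) (P : pred T) : has_card [set x | P x] #|P|.
Proof.
exists (enum P); first exact: enum_uniq.
by split=> [|x]; [rewrite cardE|rewrite mem_enum].
Qed.

Lemma has_card_uniq T (A : set T) N M : has_card A N -> has_card A M -> N = M.
Proof.
move=> [s us [<- sA]] [r ur [<- rA]]; apply/eqP.
rewrite eqn_leq; apply/andP; split; apply: uniq_leq_size => // x.
  by move/sA/rA.
by move/rA/sA.
Qed.

Lemma has_card_inh T (A : set T) N : has_card A N -> N = 0%N \/ exists x, A x.
Proof.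
move=> [[|x s] us [<- sA]]; first by left.
by right; exists x; apply/sA; exact: mem_head.
Qed.

Lemma has_card_fset T (A : set T) N :
  has_card A N -> finite_set A /\ #|` fset_set A|%fset = N.
Proof.
move=> [s us [sN sA]].
have AE : A = [set` s].
  by apply/seteqP; split=> x /sA.
have finA : finite_set A by rewrite AE; exact: finite_seq.
split=> //; rewrite -sN; apply: perm_size; apply: uniq_perm => // x.
by rewrite in_fset_set //; apply/idP/idP => [/set_mem/sA//|/sA/mem_set].
Qed.

End HasCard.

(** * Counting subspaces over a finite field *)

Section MatrixCounts.
Variable F : finFieldType.
Local Notation q := #|F|.

Lemma card_row_space m n (A : 'M[F]_(m, n)) :
  #|[pred u : 'rV[F]_n | (u <= A)%MS]| = (q ^ \rank A)%N.
Proof. by rewrite -card_rowg; apply: eq_card => u; rewrite !inE. Qed.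

Lemma rank_adds_row m n (u : 'rV[F]_n) (A : 'M[F]_(m, n)) :
  \rank (u + A)%MS = (~~ (u <= A)%MS + \rank A)%N.
Proof.
have [uA|uA] := boolP (u <= A)%MS; first by rewrite (addsmx_idPr uA).
have u0 : u != 0 by apply: contraNneq uA => ->; rewrite sub0mx.
have := mxrank_sum_cap u A; rewrite rank_rV u0 /=.
suff -> : \rank (u :&: A)%MS = 0%N by rewrite addn0.
apply/eqP; rewrite mxrank_eq0; apply: contraNT uA => c0.
have ru : \rank u = 1%N by rewrite rank_rV u0.
have /eqmxP e : (u :&: A == u)%MS.
  rewrite -(mxrank_leqif_eq (capmxSl u A)) ru eqn_leq lt0n mxrank_eq0 c0 andbT.
  by rewrite -[leqRHS]ru mxrankS ?capmxSl.
by rewrite -e capmxSr.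
Qed.

Lemma row_free_col_mx m n (u : 'rV[F]_n) (A : 'M[F]_(m, n)) :
  row_free (col_mx u A) = row_free A && ~~ (u <= A)%MS.
Proof.
rewrite /row_free -addsmxE rank_adds_row; have := rank_leq_row A.
by case: (u <= A)%MS => /=; lia.
Qed.

(** Rows are added one at a time: an admissible matrix with [c] rows has exactly
    [q ^ n - q ^ e c] admissible extensions by a row. *)
Lemma card_row_by_row n (P : forall c, pred 'M[F]_(c, n))
    (X : forall c, 'M[F]_(c, n) -> pred 'rV[F]_n) (e : nat -> nat) :
  (forall A, P 0%N A) ->
  (forall c (u : 'rV_n) (A : 'M_(c, n)),
     P (1 + c)%N (col_mx u A) = P c A && ~~ X c A u) ->
  (forall c A, P c A -> #|X c A| = (q ^ e c)%N) ->
  forall c, #|P c| = (\prod_(i < c) (q ^ n - q ^ e i))%N.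
Proof.
move=> P0 PS cX; elim=> [|c IH].
  rewrite big_ord0; transitivity #|{: 'M[F]_(0, n)}|.
    by apply: eq_card => A; rewrite [LHS]P0.
  by rewrite card_mx mul0n.
rewrite big_ord_recr -IH /=; apply: (@has_card_uniq _ [set x | P (1 + c)%N x]).
  exact: has_card_fin.
apply: (has_card_fibre (f := dsubmx) (has_card_fin (P c))) => [A|B /= PB].
  by rewrite /= -{1}[A](vsubmxK (m1 := 1)) PS => /andP[].
have <- : #|[predC (X c B)]| = (q ^ n - q ^ e c)%N.
  have := cardC (X c B); rewrite (cX c B PB) card_mx mul1n => <-.
  by rewrite addKn.
apply: (has_card_bij (g := fun u => col_mx u B) (has_card_fin _)).
  by move=> u v _ _ /eq_col_mx[].
move=> A; split=> [/= [+ AB]|[u /= nX <-]].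
  rewrite -{1}[A](vsubmxK (m1 := 1)) PS AB => /andP[_ nX].
  by exists (usubmx (m1 := 1) A) => //; rewrite -AB vsubmxK.
by rewrite PS PB nX /= col_mxKd.
Qed.

Lemma card_unitmx c :
  #|[pred g : 'M[F]_c | g \in unitmx]| = (\prod_(i < c) (q ^ c - q ^ i))%N.
Proof.
rewrite -(@card_row_by_row c (fun d A => row_free A) (fun d A u => (u <= A)%MS) id).
- by apply: eq_card => A; rewrite !inE -row_free_unit.
- by move=> A; rewrite /row_free -leqn0 rank_leq_row.
- by move=> d u A; rewrite row_free_col_mx.
- by move=> d A /eqP; rewrite card_row_space => ->.
Qed.

(** Subspaces are represented by the canonical matrices [<<W>>]; each
    [c]-dimensional one has [#|GL_c|] bases. *)
Lemma card_subspaces n (c : nat) (P : forall k, pred 'M[F]_(k, n)) :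
  (forall k l (A : 'M_(k, n)) (B : 'M_(l, n)), (A == B)%MS -> P k A = P l B) ->
  (#|[pred W : 'M[F]_n | [&& <<W>>%MS == W, \rank W == c & P n W]]| *
   #|[pred g : 'M[F]_c | g \in unitmx]| =
   #|[pred A : 'M[F]_(c, n) | row_free A && P c A]|)%N.
Proof.
move=> PE; apply: (@has_card_uniq _ [set A : 'M[F]_(c, n) | row_free A && P c A]);
  last exact: has_card_fin.
apply: (has_card_fibre (f := fun A => <<A>>%MS) (has_card_fin _)).
  move=> A /= /andP[rA PA]; rewrite genmx_id eqxx /= mxrank_gen [_ == c]rA /=.
  by rewrite (PE _ _ _ A) ?PA //; apply/eqmxP/genmxE.
move=> W /= /and3P[/eqP WW /eqP rW PW].
have [B BW] : exists B : 'M_(c, n), (B == W)%MS.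
  by rewrite -rW; exists (row_base W); apply/eqmxP/eq_row_base.
have Bf : row_free B by rewrite /row_free (eqmxP BW) rW.
apply: (has_card_bij (g := fun g => g *m B) (has_card_fin _)).
  by move=> g h _ _ /(row_free_inj Bf).
have gBW (g : 'M_c) : g \in unitmx -> (g *m B == W)%MS.
  move=> gu; apply/eqmxP; apply: eqmx_trans (eqmxP BW).
  by apply: eqmxMfull; rewrite row_full_unit.
move=> A; split=> [/= [/andP[rA PA] AW]|[g /= gu <-]].
  have AB : (A <= B)%MS by rewrite (eqmxP BW) -AW genmxE.
  case/submxP: AB => g gE; exists g => //=.
  rewrite -row_free_unit /row_free eqn_leq rank_leq_row /=.
  by rewrite -{1}(eqP rA) gE mxrankM_maxl.
have fB : row_free (g *m B) by rewrite /row_free (eqmxP (gBW _ gu)) rW.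
rewrite fB (PE _ _ _ _ (gBW _ gu)) PW; split=> //=.
by rewrite -[RHS]WW; apply/genmxP/gBW.
Qed.

(** Dual form of a generation condition: if [V] is the annihilator of the row
    space of [A], then [V] and its image under the transpose of [E] together span
    the whole space exactly when this holds. *)
Definition moved_by n (E : 'M[F]_n) k (A : 'M[F]_(k, n)) :=
  [forall w : 'rV[F]_n, (w <= A)%MS && (w *m E <= A)%MS ==> (w == 0)].

Lemma moved_byP n (E : 'M[F]_n) k (A : 'M[F]_(k, n)) :
  reflect (forall w : 'rV[F]_n, (w <= A)%MS -> (w *m E <= A)%MS -> w = 0) (moved_by E A).
Proof.
apply: (iffP forallP) => H w; first by move=> wA wEA; have := H w; rewrite wA wEA => /eqP.
by apply/implyP => /andP[wA wEA]; rewrite (H w).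
Qed.

Lemma moved_by_eqmx n (E : 'M[F]_n) k l (A : 'M[F]_(k, n)) (B : 'M[F]_(l, n)) :
  (A == B)%MS -> moved_by E A = moved_by E B.
Proof. by move=> /eqmxP AB; apply: eq_forallb => w; rewrite !AB. Qed.

(** For square-zero [E], if [w] and [w E] both lie in the row space and [E] is
    injective there, then [w E] is killed by [E], so [w E = 0] and [w = 0]. *)
Lemma moved_by_nil n (E : 'M[F]_n) c (A : 'M[F]_(c, n)) : E *m E = 0 ->
  row_free A && moved_by E A = row_free (A *m E).
Proof.
move=> E0; apply/andP/idP => [[rA /moved_byP mA]|rAE].
  rewrite -kermx_eq0; apply/rowV0P => u /sub_kermxP; rewrite mulmxA => uAE.
  apply: (row_free_inj rA); rewrite mul0mx; apply: mA; first exact: submxMl.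
  by rewrite uAE sub0mx.
have rA : row_free A.
  by rewrite /row_free eqn_leq rank_leq_row /= -{1}(eqP rAE) mxrankM_maxl.
split=> //; apply/moved_byP => _ /submxP[u ->] /submxP[v uv].
have v0 : v = 0.
  by apply: (row_free_inj rAE); rewrite mul0mx !mulmxA -uv -mulmxA E0 mulmx0.
rewrite (_ : u = 0) ?mul0mx //.
by apply: (row_free_inj rAE); rewrite mul0mx !mulmxA uv v0 mul0mx.
Qed.

Lemma card_moved_by_nil n (c : nat) (E : 'M[F]_n) : E *m E = 0 ->
  (#|[pred W : 'M[F]_n | [&& <<W>>%MS == W, \rank W == c & moved_by E W]]| *
   (\prod_(i < c) (q ^ c - q ^ i)) =
   \prod_(i < c) (q ^ n - q ^ (n - \rank E + i)))%N.
Proof.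
move=> E0; rewrite -card_unitmx.
rewrite (card_subspaces c (P := fun k A => moved_by E A)); last first.
  by move=> *; exact: moved_by_eqmx.
rewrite -(@card_row_by_row n (fun d A => row_free (A *m E))
  (fun d A u => (u *m E <= A *m E)%MS) (fun i => n - \rank E + i)%N).
- by apply: eq_card => A; rewrite !inE moved_by_nil.
- by move=> A; rewrite /row_free -leqn0 rank_leq_row.
- by move=> d u A; rewrite mul_col_mx row_free_col_mx.
- move=> d A rA.
  transitivity #|[pred u : 'rV_n | (u <= A + kermx E)%MS]|.
    apply: eq_card => u; rewrite !inE; apply/idP/idP.
      move=> /submxP[v uv]; rewrite -[u](subrK (v *m A)) addrC.
      apply: addmx_sub_adds; first exact: submxMl.
      by apply/sub_kermxP; rewrite mulmxBl uv mulmxA subrr.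
    move=> /sub_addsmxP[[v w] /= ->]; rewrite unfold_in mulmxDl -[w *m _ *m _]mulmxA.
    by rewrite mulmx_ker mulmx0 addr0 -mulmxA submxMl.
  rewrite card_row_space; congr (q ^ _)%N.
  have := mxrank_sum_cap A (kermx E); have := mxrank_mul_ker A E.
  have : (\rank A <= d)%N by exact: rank_leq_row.
  by rewrite (eqP rA) mxrank_ker; lia.
Qed.

Section Inert.
Variables (n : nat) (E : 'M[F]_n) (alpha beta : F).
Hypothesis E2 : E *m E = alpha *: E + beta%:M.
Hypothesis Eunit : forall a b : F, (a != 0) || (b != 0) ->
  a%:M + b *: E \in unitmx.

(** A space stable under [E] is stable under the inverse of [a + b E], because
    that unit maps the space into itself, hence onto itself. *)
Lemma stable_eigen_sub m (S : 'M[F]_(m, n)) (u : 'rV[F]_n) (a b : F) :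
  (S *m E <= S)%MS -> (a != 0) || (b != 0) ->
  ((a *: u + b *: (u *m E))%R <= S)%MS -> (u <= S)%MS.
Proof.
move=> SE ab uS; have Gu := Eunit ab; set G := _ + _ in Gu.
have SG : (S *m G <= S)%MS.
  by rewrite mulmxDr mul_mx_scalar -scalemxAr addmx_sub ?scalemx_sub.
have SGE : (S <= S *m G)%MS.
  rewrite -(mxrank_leqif_sup SG).
  by rewrite [\rank (S *m G)]mxrankMfree // row_free_unit.
have -> : u = (a *: u + b *: (u *m E)) *m invmx G.
  rewrite -[LHS](mulmxK Gu) /G mulmxDr mul_mx_scalar -scalemxAr //.
apply: submx_trans (submxMr _ uS) _.
by rewrite -{2}[S](mulmxK Gu) submxMr.
Qed.

Lemma stable_adds m (A : 'M[F]_(m, n)) :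
  ((A + A *m E)%MS *m E <= A + A *m E)%MS.
Proof.
rewrite addsmxMr -mulmxA E2 addsmx_sub addsmxSr /= mulmxDr mul_mx_scalar.
rewrite -scalemxAr; apply: addmx_sub; apply: scalemx_sub.
  exact: addsmxSr.
exact: addsmxSl.
Qed.

(** A vector outside the [E]-stable space [S] adds two dimensions to it: some
    combination of [u] and [u E] lying in [S] would put [u] itself in [S]. *)
Lemma rank_adds_inert m (A : 'M[F]_(m, n)) (u : 'rV[F]_n) :
  let S := (A + A *m E)%MS in
  \rank (col_mx u A + col_mx u A *m E)%MS = (2 * ~~ (u <= S)%MS + \rank S)%N.
Proof.
move=> S; have SE : (S *m E <= S)%MS := stable_adds A.
have -> : \rank (col_mx u A + col_mx u A *m E)%MS = \rank (u + (u *m E + S))%MS.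
  rewrite mul_col_mx; apply: eqmx_rank; apply/eqmxP.
  have e : (col_mx u A + col_mx (u *m E) (A *m E) :=:
            u + A + (u *m E + A *m E))%MS.
    by apply: adds_eqmx; apply: eqmx_sym; exact: addsmxE.
  apply: (eqmx_trans e).
  by rewrite -addsmxA (addsmxA A) (addsmxC A) -addsmxA.
rewrite !rank_adds_row; have uE a b := @stable_eigen_sub _ S u a b SE.
have [uS|uS] := boolP (u <= S)%MS.
  rewrite (submx_trans uS (addsmxSr _ _)).
  by rewrite (submx_trans (submxMr _ uS) SE).
have -> : (u *m E <= S)%MS = false.
  apply/negP => uES; case/negP: uS; apply: (uE 0 1); rewrite ?oner_neq0 ?orbT //.
  by rewrite scale0r add0r scale1r.
case: (boolP (u <= _)%MS) => // /sub_addsmxP[[v w] /= ue].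
case/negP: uS; apply: (uE 1 (- v 0 0)); rewrite ?oner_neq0 //.
by rewrite scale1r scaleNr -mul_scalar_mx -mx11_scalar {1}ue addrC addKr submxMl.
Qed.

Lemma moved_by_inert c (A : 'M[F]_(c, n)) :
  row_free A && moved_by E A = (\rank (A + A *m E)%MS == c + c)%N.
Proof.
have Ef : row_free E.
  by have := @Eunit 0 1; rewrite oner_neq0 orbT scale1r raddf0 add0r row_free_unit; apply.
have rAE : \rank (A *m E) = \rank A by rewrite mxrankMfree.
have := mxrank_sum_cap A (A *m E); rewrite rAE => rs.
have rA := rank_leq_row A.
apply/andP/eqP => [[/eqP rcA /moved_byP mA]|rAA].
  suff : \rank (A :&: A *m E)%MS = 0%N by lia.
  apply/eqP; rewrite mxrank_eq0; apply/rowV0P => w; rewrite sub_capmx => /andP[wA].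
  case/submxP=> v wv; rewrite wv (mulmxA v) (mA (v *m A)) ?mul0mx ?submxMl //.
  by rewrite -mulmxA -wv.
have rcA : \rank A = c by lia.
split; first by rewrite /row_free rcA.
have /eqP : \rank (A :&: A *m E)%MS = 0%N by lia.
rewrite mxrank_eq0 => /eqP cap0.
apply/moved_byP => w wA wEA; apply: (row_free_inj Ef); rewrite mul0mx.
by apply/eqP; rewrite -submx0 -cap0 sub_capmx wEA submxMr.
Qed.

Lemma card_moved_by_inert (c : nat) :
  (#|[pred W : 'M[F]_n | [&& <<W>>%MS == W, \rank W == c & moved_by E W]]| *
   (\prod_(i < c) (q ^ c - q ^ i)) = \prod_(i < c) (q ^ n - q ^ (i + i)))%N.
Proof.
rewrite -card_unitmx.
rewrite (card_subspaces c (P := fun k A => moved_by E A)); last first.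
  by move=> *; exact: moved_by_eqmx.
rewrite -(@card_row_by_row n (fun d A => \rank (A + A *m E)%MS == d + d)%N
  (fun d A u => (u <= A + A *m E)%MS) (fun i => i + i)%N).
- by apply: eq_card => A; rewrite !inE moved_by_inert.
- by move=> A; rewrite !flatmx0 ?mul0mx addsmx0 mxrank0.
- move=> d u A; rewrite rank_adds_inert.
  have := rank_leq_row A; have [+ _] := mxrank_adds_leqif A (A *m E).
  have := mxrankM_maxl A E.
  move: (\rank (A + A *m E)) (\rank (A *m E)) (\rank A) => x y w h1 h2 h3.
  by case: (u <= _)%MS => /=; rewrite ?andbT ?andbF; [apply/negbTE|]; lia.
- by move=> d A /eqP; rewrite card_row_space => ->.
Qed.
End Inert.
End MatrixCounts.

(** * Codimension *)

Section Codim.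
Variables (F : finFieldType) (A : comNzRingType) (kappa : {rmorphism F -> A}).
Variable V : lmodType A.
Implicit Types (B C D : set V) (x y : V).

Definition subsp C :=
  [/\ C 0, forall x y, C x -> C y -> C (x + y) &
      forall a x, C x -> C (kappa a *: x)].

(** The map is constrained on [C] only, so that submodules can stay plain subsets
    of the ambient module. *)
Definition quotmap C D k (phi : V -> 'rV[F]_k) :=
  [/\ forall x y, C x -> C y -> phi (x + y) = phi x + phi y,
      forall a x, C x -> phi (kappa a *: x) = a *: phi x,
      forall w, exists2 x, C x & phi x = w &
      forall x, D x <-> C x /\ phi x = 0].

Definition codim C D k := exists phi : V -> 'rV[F]_k, quotmap C D phi.

Lemma subspN C x : subsp C -> C x -> C (- x).
Proof. by case=> _ _ CZ Cx; rewrite -scaleN1r -(rmorph1 kappa) -rmorphN; exact: CZ. Qed.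

Lemma subspB C x y : subsp C -> C x -> C y -> C (x - y).
Proof. by move=> sC Cx Cy; case: (sC) => _ CD _; apply: CD => //; exact: subspN. Qed.

Lemma codim_sub C D k : codim C D k -> D `<=` C.
Proof. by case=> phi [_ _ _ ker] x /ker[]. Qed.

Section Quotmap.
Variables (C D : set V) (k : nat) (phi : V -> 'rV[F]_k).
Hypotheses (sC : subsp C) (qphi : quotmap C D phi).

Lemma quotmapD x y : C x -> C y -> phi (x + y) = phi x + phi y.
Proof. by case: qphi => + _ _ _; apply. Qed.
Lemma quotmapZ a x : C x -> phi (kappa a *: x) = a *: phi x.
Proof. by case: qphi => _ + _ _; apply. Qed.
Lemma quotmap0 : phi 0 = 0.
Proof. by have := @quotmapZ 0 0; rewrite scaler0 scale0r; apply; case: sC. Qed.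
Lemma quotmapN x : C x -> phi (- x) = - phi x.
Proof.
by move=> Cx; rewrite -scaleN1r -(rmorph1 kappa) -rmorphN quotmapZ ?scaleN1r.
Qed.
Lemma quotmapB x y : C x -> C y -> phi (x - y) = phi x - phi y.
Proof. by move=> Cx Cy; rewrite quotmapD ?quotmapN //; exact: subspN. Qed.
Lemma quotmap_surj w : exists2 x, C x & phi x = w.
Proof. by case: qphi. Qed.
Lemma quotmap_ker x : D x <-> C x /\ phi x = 0.
Proof. by case: qphi. Qed.

Lemma quotmap_eq x y : C x -> C y -> phi x = phi y <-> D (x - y).
Proof.
move=> Cx Cy; rewrite quotmap_ker quotmapB //; split=> [->|[_ /eqP]].
  by rewrite subrr; split=> //; exact: subspB.
by rewrite subr_eq0 => /eqP.
Qed.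

Lemma subsp_cut l (W : 'M[F]_(k, l)) : subsp [set x | C x /\ phi x *m W = 0].
Proof.
have [C0 CD CZ] := sC; split=> /=.
- by rewrite quotmap0 mul0mx.
- move=> x y [Cx Wx] [Cy Wy]; split; first exact: CD.
  by rewrite quotmapD // mulmxDl Wx Wy addr0.
- move=> a x [Cx Wx]; split; first exact: CZ.
  by rewrite quotmapZ // -scalemxAl Wx scaler0.
Qed.

Lemma subsp_quotmap : subsp D.
Proof.
have [C0 CD CZ] := sC; split=> [|x y|a x]; rewrite !quotmap_ker.
- by rewrite quotmap0.
- by move=> [Cx x0] [Cy y0]; rewrite quotmapD // x0 y0 addr0; split=> //; exact: CD.
- by move=> [Cx x0]; rewrite quotmapZ // x0 scaler0; split=> //; exact: CZ.
Qed.

Lemma codim_cut l (W : 'M[F]_(k, l)) :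
  codim C [set x | C x /\ phi x *m W = 0] (\rank W).
Proof.
exists (fun x => phi x *m col_base W); split.
- by move=> x y Cx Cy; rewrite quotmapD // mulmxDl.
- by move=> a x Cx; rewrite quotmapZ // -scalemxAl.
- move=> w; have [x Cx xw] := quotmap_surj (w *m pinvmx (col_base W)).
  exists x => //; rewrite xw -mulmxA mulVpmx ?mulmx1 //.
  exact: col_base_full.
- move=> x; split=> [[Cx]|[Cx]].
    rewrite -{1}(mulmx_base W) mulmxA => x0; split=> //.
    by apply: (row_free_inj (row_base_free W)); rewrite mul0mx.
  by move=> x0; split=> //=; rewrite -(mulmx_base W) mulmxA x0 mul0mx.
Qed.

Lemma cut_codim l (W : 'M[F]_(k, l)) :
  codim [set x | C x /\ phi x *m W = 0] D (k - \rank W).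
Proof.
rewrite -mxrank_ker; set K := row_base (kermx W).
have Kf : row_free K := row_base_free _.
have KW : K *m W = 0 by apply/sub_kermxP; rewrite eq_row_base.
have sK (v : 'rV_k) : v *m W = 0 -> (v <= K)%MS.
  by move=> vW; rewrite eq_row_base; apply/sub_kermxP.
exists (fun x => phi x *m pinvmx K); split=> /=.
- by move=> x y [Cx _] [Cy _]; rewrite quotmapD // mulmxDl.
- by move=> a x [Cx _]; rewrite quotmapZ // -scalemxAl.
- move=> w; have [x Cx xw] := quotmap_surj (w *m K).
  by exists x; rewrite xw ?mulmxKp // -mulmxA KW mulmx0.
- move=> x; rewrite quotmap_ker; split=> [[Cx ->]|[[Cx xW] x0]].
    by rewrite !mul0mx.
  by split=> //; rewrite -(mulmxKpV (sK _ xW)) x0 mul0mx.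
Qed.

(** Every intermediate subspace is cut out by linear conditions on [phi]; the
    canonical matrix of these conditions is its annihilator in [F^k]. *)
Lemma cut_exists B : subsp B -> D `<=` B -> B `<=` C ->
  exists2 W : 'M[F]_k, <<W>>%MS = W &
    forall x, B x <-> C x /\ phi x *m W^T = 0.
Proof.
move=> sB DB BC; have [B0 BD BZ] := sB.
pose im (v : 'rV[F]_k) := `[< exists2 x, B x & phi x = v >].
pose U := (\sum_(v : 'rV[F]_k | im v) <<v>>)%MS.
have imU (v : 'rV_k) : (v <= U)%MS -> im v.
  move=> /sub_sumsmxP[u ->].
  elim/big_ind: _ => [|_ _ /asboolP[x Bx <-] /asboolP[y By <-]|w /asboolP[x Bx xw]].
  - by apply/asboolP; exists 0; rewrite ?quotmap0.
  - apply/asboolP; exists (x + y); first exact: BD.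
    by rewrite quotmapD //; exact: BC.
  - have : (u w *m <<w>>%MS <= w)%MS by rewrite -(genmxE w) submxMl.
    move=> /sub_rVP[a ->]; apply/asboolP; exists (kappa a *: x); first exact: BZ.
    by rewrite quotmapZ ?xw //; exact: BC.
exists <<(cokermx U)^T>>%MS; first exact: genmx_id.
have tr0 (v : 'rV_k) : (v *m (<<(cokermx U)^T>>%MS)^T == 0) = (v *m cokermx U == 0).
  have e (Y : 'M_k) : (v *m Y^T == 0) = (Y <= kermx v^T)%MS.
    by apply/eqP/sub_kermxP => h; apply: trmx_inj; rewrite trmx_mul ?trmxK trmx0.
  by rewrite e genmxE -e trmxK.
move=> x; split=> [Bx|[Cx /eqP]].
  split; first exact: BC.
  apply/eqP; rewrite tr0 -submxE; apply: (sumsmx_sup (phi x)); last by rewrite genmxE.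
  by apply/asboolP; exists x.
rewrite tr0 -submxE => /imU/asboolP[y By yx].
rewrite -(subrK y x); apply: BD => //; apply: DB.
by apply/quotmap_eq; [|exact: BC|].
Qed.

(** By duality, inclusion between the common zeros of two sets of linear forms on
    the quotient reverses the inclusion between their spans. *)
Lemma cut_sub m l (W : 'M[F]_(m, k)) (W' : 'M[F]_(l, k)) :
  (forall x, C x -> phi x *m W^T = 0 -> phi x *m W'^T = 0) -> (W' <= W)%MS.
Proof.
move=> XY; have kk : (kermx W^T <= kermx W'^T)%MS.
  apply/rV_subP => v /sub_kermxP vX; apply/sub_kermxP.
  by have [x Cx xv] := quotmap_surj v; rewrite -xv; apply: XY; rewrite ?xv.
rewrite submxE -(trmxK W') -(trmxK (cokermx W)) -trmx_mul -trmx0 (inj_eq trmx_inj).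
apply/eqP/sub_kermxP; apply: submx_trans kk; apply/sub_kermxP.
by apply: trmx_inj; rewrite trmx_mul !trmxK mulmx_coker trmx0.
Qed.

Lemma cut_inj (W W' : 'M[F]_k) : <<W>>%MS = W -> <<W'>>%MS = W' ->
  (forall x, C x -> phi x *m W^T = 0 <-> phi x *m W'^T = 0) -> W = W'.
Proof.
move=> WW WW' e; rewrite -WW -WW'; apply/genmxP.
by apply/andP; split; apply: cut_sub => x Cx h; apply/(e x Cx).
Qed.

Lemma quotmap_endo (f : V -> V) : (forall x, C x -> C (f x)) ->
  (forall x, D x -> D (f x)) -> {morph f : x y / x + y} ->
  (forall a x, f (kappa a *: x) = kappa a *: f x) ->
  exists E : 'M[F]_k, forall x, C x -> phi (f x) = phi x *m E.
Proof.
move=> Cf Df fD fZ; have [_ CD CZ] := sC.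
have /choice[s sP] w : exists x, C x /\ phi x = w.
  by have [x] := quotmap_surj w; exists x.
have Cs w : C (s w) by case: (sP w).
have ps w : phi (s w) = w by case: (sP w).
have fE x y : C x -> C y -> phi x = phi y -> phi (f x) = phi (f y).
  move=> Cx Cy /(quotmap_eq Cx Cy) /Df; rewrite fD -scaleN1r -(rmorph1 kappa).
  rewrite -rmorphN fZ rmorphN rmorph1 scaleN1r => Dxy.
  by apply/quotmap_eq => //; exact: Cf.
pose g w := phi (f (s w)).
have gD v w : g (v + w) = g v + g w.
  rewrite /g -quotmapD -?fD; try exact: Cf.
  by apply: fE; rewrite ?quotmapD ?ps //; exact: CD.
have gZ a w : g (a *: w) = a *: g w.
  rewrite /g -quotmapZ -?fZ; try exact: Cf.
  by apply: fE; rewrite ?quotmapZ ?ps //; exact: CZ.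
have g0 : g 0 = 0 by have := gZ 0 0; rewrite !scale0r.
exists (\matrix_(l, c) g (delta_mx 0 l) 0 c) => x Cx.
rewrite (fE x (s (phi x))) ?ps // -/(g (phi x)) {1}[phi x]row_sum_delta.
rewrite (big_morph g gD g0) mulmx_sum_row; apply: eq_bigr => l _.
by rewrite gZ; congr (_ *: _); apply/rowP => c; rewrite !mxE.
Qed.
End Quotmap.

Lemma subsp_codim C D k : subsp C -> codim C D k -> subsp D.
Proof. by move=> sC [phi qphi]; exact: (subsp_quotmap sC qphi). Qed.

(** Dimensions are compared through cardinalities, which is possible over a
    finite field. *)
Lemma codim_uniq C D k l : subsp C -> codim C D k -> codim C D l -> k = l.
Proof.
have cF : (1 < #|F|)%N by exact: finRing_gt1.
move=> sC; suff H i j : codim C D i -> codim C D j -> (i <= j)%N.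
  by move=> ck cl; apply/eqP; rewrite eqn_leq !H.
move=> [phi qphi] [psi qpsi].
have /choice[s sP] (v : 'rV[F]_i) : exists x, C x /\ phi x = v.
  by have [x] := quotmap_surj qphi v; exists x.
have inj : injective (psi \o s).
  move=> v w /= svw; have [[Cv pv] [Cw pw]] := (sP v, sP w).
  rewrite -pv -pw; apply/(quotmap_eq sC qphi) => //.
  exact/(quotmap_eq sC qpsi).
by have := leq_card _ inj; rewrite !card_mx !mul1n leq_exp2l.
Qed.

Lemma codim_split C B D k : subsp C -> subsp B -> D `<=` B -> B `<=` C ->
  codim C D k -> exists i j, [/\ codim C B i, codim B D j & (i + j = k)%N].
Proof.
move=> sC sB DB BC [phi qphi].
have [W _ BW] := cut_exists sC qphi sB DB BC.
have BE : B = [set x | C x /\ phi x *m W^T = 0].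
  by apply/seteqP; split=> x /BW.
exists (\rank W^T), (k - \rank W^T)%N; rewrite BE; split.
- exact: (codim_cut qphi).
- exact: (cut_codim qphi).
- by rewrite subnKC // rank_leq_row.
Qed.

Lemma codim_trans C B D i j : subsp C -> codim C B i -> codim B D j ->
  codim C D (i + j).
Proof.
move=> sC cB cD; have sB := subsp_codim sC cB; have BC := codim_sub cB.
move: cB cD => [phi qphi] [psi qpsi]; have [C0 CD CZ] := sC.
have /choice[e eP] (l : 'I_i) : exists x, C x /\ phi x = delta_mx 0 l.
  by have [x] := quotmap_surj qphi (delta_mx 0 l); exists x.
pose s (v : 'rV[F]_i) : V := \sum_l kappa (v 0 l) *: e l.
have sumC (f : 'I_i -> F) (r : seq 'I_i) :
    C (\sum_(l <- r) kappa (f l) *: e l) /\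
    phi (\sum_(l <- r) kappa (f l) *: e l) = \sum_(l <- r) f l *: delta_mx 0 l.
  elim: r => [|l r [IH1 IH2]]; first by rewrite !big_nil (quotmap0 sC qphi).
  have [Ce pe] := eP l; rewrite !big_cons (quotmapD qphi) ?(quotmapZ qphi) ?pe ?IH2 //;
    last exact: CZ.
  by split=> //; apply: CD => //; exact: CZ.
have Cs v : C (s v) by case: (sumC (fun l => v 0 l) (index_enum _)).
have ps v : phi (s v) = v.
  by rewrite [RHS]row_sum_delta; case: (sumC (fun l => v 0 l) (index_enum _)).
have sD v w : s (v + w) = s v + s w.
  by rewrite -big_split; apply: eq_bigr => l _; rewrite mxE rmorphD scalerDl.
have sZ a v : s (a *: v) = kappa a *: s v.
  by rewrite scaler_sumr; apply: eq_bigr => l _; rewrite mxE rmorphM scalerA.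
pose p x := x - s (phi x).
have Bp x : C x -> B (p x).
  by move=> Cx; apply/(quotmap_eq sC qphi); rewrite ?ps.
have p_id x : B x -> p x = x.
  move=> /(quotmap_ker qphi)[_ x0]; rewrite /p x0.
  by rewrite -[0](scale0r (0 : 'rV[F]_i)) sZ rmorph0 scale0r subr0.
exists (fun x => row_mx (phi x) (psi (p x))); split.
- move=> x y Cx Cy; rewrite add_row_mx -(quotmapD qphi) // -(quotmapD qpsi);
    try exact: Bp.
  congr (row_mx _ (psi _)); rewrite /p (quotmapD qphi) // sD.
  by rewrite opprD addrACA.
- move=> a x Cx; rewrite scale_row_mx -(quotmapZ qphi) // -(quotmapZ qpsi);
    last exact: Bp.
  by congr (row_mx _ (psi _)); rewrite /p (quotmapZ qphi) // sZ scalerBr.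
- move=> w; have [y By yw] := quotmap_surj qpsi (rsubmx w).
  exists (s (lsubmx w) + y); first by apply: CD => //; exact: BC.
  have pw : phi (s (lsubmx w) + y) = lsubmx w.
    have [_ y0] := (quotmap_ker qphi y).1 By.
    by rewrite (quotmapD qphi) ?ps ?y0 ?addr0 //; exact: BC.
  by rewrite /p pw addrAC subrr add0r yw hsubmxK.
- move=> x; split=> [Dx|[Cx]].
    have [Bx x0] := (quotmap_ker qpsi x).1 Dx.
    have [Cx px0] := (quotmap_ker qphi x).1 Bx.
    by rewrite p_id // x0 px0 row_mx0.
  rewrite -row_mx0 => /eq_row_mx[x0 px0].
  have Bx : B x by apply/(quotmap_ker qphi).
  by apply/(quotmap_ker qpsi); rewrite p_id in px0.
Qed.

(** Second isomorphism theorem. *)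
Lemma codim_iso2 C D C0 D0 k : subsp C -> subsp D -> D `<=` C -> C0 `<=` C ->
  subsp C0 -> (forall x, D0 x <-> C0 x /\ D x) ->
  (forall x, C x -> exists2 y, D y & C0 (x - y)) ->
  codim C D k <-> codim C0 D0 k.
Proof.
move=> sC sD DC C0C sC0 D0E CD0; split=> [[phi qphi]|[phi qphi]].
  exists phi; split.
  - by move=> x y /C0C Cx /C0C; exact: (quotmapD qphi).
  - by move=> a x /C0C; exact: (quotmapZ qphi).
  - move=> w; have [x Cx <-] := quotmap_surj qphi w.
    have [y Dy C0y] := CD0 x Cx; exists (x - y) => //.
    rewrite (quotmapB sC qphi) //; last exact: DC.
    by have [_ ->] := (quotmap_ker qphi y).1 Dy; rewrite subr0.
  - move=> x; rewrite D0E (quotmap_ker qphi); split=> [[C0x [_ x0]]//|[C0x x0]].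
    by split=> //; split=> //; exact: C0C.
have /choice[p pP] x : exists y, C x -> C0 y /\ D (x - y).
  case: (pselect (C x)) => [/CD0[y Dy C0y]|nC]; last by exists 0.
  by exists (x - y) => _; split=> //; rewrite opprB addrC subrK.
have [_ sD0 sDZ] := sD; have [_ C0D C0Z] := sC0.
have pE x y : C x -> C0 y -> D (x - y) -> phi (p x) = phi y.
  move=> Cx C0y Dxy; have [C0p Dp] := pP x Cx.
  apply/(quotmap_eq sC0 qphi) => //; rewrite D0E; split.
    exact: (subspB sC0).
  rewrite (_ : _ - _ = (x - y) - (x - p x)); first exact: (subspB sD).
  by rewrite opprB [RHS]addrC addrA subrK.
have C'0 x : C x -> C0 (p x) by move=> /pP[].
have D'p x : C x -> D (x - p x) by move=> /pP[].
have [_ CD CZ] := sC.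
exists (phi \o p); split=> /=.
- move=> x y Cx Cy; rewrite -(quotmapD qphi); try exact: C'0.
  apply: pE; [exact: CD|by apply: C0D; exact: C'0|].
  by rewrite opprD addrACA; apply: sD0; exact: D'p.
- move=> a x Cx; rewrite -(quotmapZ qphi); last exact: C'0.
  apply: pE; [exact: CZ|by apply: C0Z; exact: C'0|].
  by rewrite -scalerBr; apply: sDZ; exact: D'p.
- move=> w; have [x C0x <-] := quotmap_surj qphi w.
  exists x; first exact: C0C.
  by apply: pE; rewrite ?subrr //; [exact: C0C|case: sD].
- move=> x; split=> [Dx|[Cx px]].
    split; first exact: DC.
    rewrite (pE x 0) ?subr0 ?(quotmap0 sC0 qphi) //; first exact: DC.
    by case: sC0.
  have : D0 (p x) by apply/(quotmap_ker qphi); split; [exact: C'0|].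
  by rewrite D0E => -[_ Dp]; rewrite -(subrK (p x) x); apply: sD0 => //; exact: D'p.
Qed.
End Codim.

Lemma codim_pullback (F : finFieldType) (A : comNzRingType)
    (kappa : {rmorphism F -> A}) (V V' : lmodType A) (C D : set V) (C' D' : set V')
    (f : V -> V') k :
  (forall x y, C x -> C y -> f (x + y) = f x + f y) ->
  (forall a x, C x -> f (kappa a *: x) = kappa a *: f x) ->
  (forall x, C x -> C' (f x)) -> (forall y, C' y -> exists2 x, C x & f x = y) ->
  (forall x, D x <-> C x /\ D' (f x)) ->
  codim kappa C' D' k -> codim kappa C D k.
Proof.
move=> fD fZ CC' fC DE [phi qphi]; exists (phi \o f); split=> /=.
- by move=> x y Cx Cy; rewrite fD // (quotmapD qphi) //; exact: CC'.
- by move=> a x Cx; rewrite fZ // (quotmapZ qphi) //; exact: CC'.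
- move=> w; have [y Cy <-] := quotmap_surj qphi w.
  by have [x Cx <-] := fC y Cy; exists x.
- move=> x; rewrite DE (quotmap_ker qphi); split=> [[? []]|[? ?]] //.
  by split=> //; split=> //; exact: CC'.
Qed.

(** * The rings [R_j = k[[T]] + T^j l[[T]]] *)

Section FpsConst.
Variable R : comNzRingType.
Implicit Types (f g : fps R) (c : R).

Lemma fpsC_is_zmod_morphism : zmod_morphism (@fpsC R).
Proof. by move=> a b; apply/fpsP => k /=; case: eqP; rewrite ?subr0. Qed.

Lemma coefs_fpsCM c f k : coefs (fpsC c * f) k = c * coefs f k.
Proof.
rewrite coefsM big_ord_recl /= subn0 big1 ?addr0 // => i _.
by rewrite mul0r.
Qed.

Lemma fpsC_is_monoid_morphism : monoid_morphism (@fpsC R).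
Proof.
split=> // a b; apply/fpsP => k; rewrite coefs_fpsCM /=.
by case: eqP; rewrite ?mulr0.
Qed.

HB.instance Definition _ :=
  GRing.isZmodMorphism.Build R (fps R) (@fpsC R) fpsC_is_zmod_morphism.
HB.instance Definition _ :=
  GRing.isMonoidMorphism.Build R (fps R) (@fpsC R) fpsC_is_monoid_morphism.

Definition fps_shift f : fps R := FPS (fun k => coefs f k.+1).

Lemma coefs_XM f k : coefs (fpsX * f) k = if k is k'.+1 then coefs f k' else 0.
Proof.
rewrite -[fpsX]expr1 coefsXnM; case: k => //= k.
by rewrite subn1.
Qed.

Lemma fps_shiftXM f : fps_shift (fpsX * f) = f.
Proof. by apply/fpsP => k; rewrite [LHS]coefs_XM. Qed.

Lemma fpsXM_shift f : coefs f 0 = 0 -> fpsX * fps_shift f = f.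
Proof. by move=> f0; apply/fpsP => -[|k]; rewrite coefs_XM. Qed.

Lemma fps_shiftD f g : fps_shift (f + g) = fps_shift f + fps_shift g.
Proof. by apply/fpsP. Qed.

Lemma fps_shiftCM c f : fps_shift (fpsC c * f) = fpsC c * fps_shift f.
Proof. by apply/fpsP => k; rewrite [LHS]coefs_fpsCM coefs_fpsCM. Qed.
End FpsConst.

(** The basis [(1, om)] of a quadratic extension, with its coordinates. *)
Record quad_basis (F : fieldType) (L : fieldExtType F) := QuadBasis {
  om : L;
  cf0 : L -> F;
  cf1 : L -> F;
  quad_basisE : forall x, x = (cf0 x)%:A + cf1 x *: om;
  quad_basisK : forall a b,
    cf0 (a%:A + b *: om) = a /\ cf1 (a%:A + b *: om) = b }.

Lemma quad_basis_exists (F : fieldType) (L : fieldExtType F) :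
  \dim {:L} = 2%N -> inhabited (quad_basis L).
Proof.
move=> dimL; have [o oN] : exists o : L, o \notin 1%VS.
  apply/not_existsP => H; have : ({:L} <= 1)%VS.
    by apply/subvP => x _; have := H x; case: (x \in _).
  by move/dimvS; rewrite dimL dimv1.
have bas : basis_of {:L} [:: 1; o].
  rewrite basisEfree subvf dimL leqnn !andbT free_cons span_seq1 seq1_free.
  have o0 : o != 0 by apply: contraNneq oN => ->; rewrite mem0v.
  rewrite o0 andbT; apply: contra oN => /vlineP[k k1].
  apply/vlineP; exists k^-1; rewrite k1 scalerA mulVf ?scale1r //.
  by apply: contra_eq_neq k1 => ->; rewrite scale0r oner_neq0.
pose b := in_tuple [:: 1; o].
have bE x : x = coord b 0 x *: 1 + coord b 1 x *: o.
  rewrite [LHS](coord_basis (X := b) bas (memvf x)) big_ord_recl big_ord1.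
  by congr (_ + coord b _ x *: _); exact: val_inj.
constructor; exists o (coord b 0) (coord b 1) => // x y.
have fb : free b := basis_free bas.
have c0 i : coord b i 1 = (i == 0)%:R by have := coord_free 0 i fb; rewrite eq_sym.
have c1 i : coord b i o = (i == 1)%:R by have := coord_free 1 i fb; rewrite eq_sym.
by rewrite !linearD !linearZ /= !c0 !c1 !mulr0 !mulr1 addr0 add0r.
Qed.

Section QuadBasis.
Variables (F : finFieldType) (L : fieldExtType (F : fieldType)) (Q : quad_basis L).
Local Notation om := (om Q).
Local Notation cf0 := (cf0 Q).
Local Notation cf1 := (cf1 Q).
Local Notation RP := (Rprime_pred L).
Implicit Types (f g h : fps L) (x y : L) (a b : F).

Lemma cf0E a b : cf0 (a%:A + b *: om) = a. Proof. by case: (quad_basisK Q a b). Qed.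
Lemma cf1E a b : cf1 (a%:A + b *: om) = b. Proof. by case: (quad_basisK Q a b). Qed.

Lemma cf_add x y : cf0 (x + y) = cf0 x + cf0 y /\ cf1 (x + y) = cf1 x + cf1 y.
Proof.
have -> : x + y = (cf0 x + cf0 y)%:A + (cf1 x + cf1 y) *: om.
  by rewrite {1}(quad_basisE Q x) {1}(quad_basisE Q y) !scalerDl addrACA.
by rewrite cf0E cf1E.
Qed.

Lemma cf_scale a x : cf0 (a *: x) = a * cf0 x /\ cf1 (a *: x) = a * cf1 x.
Proof.
have -> : a *: x = (a * cf0 x)%:A + (a * cf1 x) *: om.
  by rewrite {1}(quad_basisE Q x) scalerDr !scalerA.
by rewrite cf0E cf1E.
Qed.

Lemma cf_scalar a : cf0 a%:A = a /\ cf1 a%:A = 0.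
Proof.
have -> : a%:A = a%:A + 0 *: om :> L by rewrite scale0r addr0.
by rewrite cf0E cf1E.
Qed.

Lemma cf_zero : cf0 0 = 0 /\ cf1 0 = 0.
Proof. by have := cf_scalar 0; rewrite scale0r. Qed.

Lemma cf_om : cf0 om = 0 /\ cf1 om = 1.
Proof.
have -> : om = 0%:A + 1 *: om by rewrite scale0r add0r scale1r.
by rewrite cf0E cf1E.
Qed.

Lemma cf1_eq0 x : cf1 x = 0 <-> exists c, x = c%:A.
Proof.
split=> [x0|[c ->]]; last by case: (cf_scalar c).
by exists (cf0 x); rewrite {1}(quad_basisE Q x) x0 scale0r addr0.
Qed.

Lemma RP_coefs j f : f \in RP j <-> forall i, (i < j)%N -> cf1 (coefs f i) = 0.
Proof.
by split=> [/Rprime_predP H i /H /cf1_eq0//|H]; apply/Rprime_predP => i /H /cf1_eq0.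
Qed.

Lemma RP_level0 f : f \in RP 0. Proof. by apply/RP_coefs. Qed.

Lemma RP_weaken j f : f \in RP j.+1 -> f \in RP j.
Proof. by move=> /RP_coefs H; apply/RP_coefs => i ij; apply: H; exact: ltnW. Qed.

Lemma RP_le i j f : (i <= j)%N -> f \in RP j -> f \in RP i.
Proof. by move=> ij /RP_coefs H; apply/RP_coefs => k ki; apply: H; exact: leq_trans ij. Qed.

Lemma RP_add j f g : f \in RP j -> g \in RP j -> f + g \in RP j.
Proof. exact: rpredD. Qed.
Lemma RP_mul j f g : f \in RP j -> g \in RP j -> f * g \in RP j.
Proof. exact: rpredM. Qed.
Lemma RP_zero j : (0 : fps L) \in RP j. Proof. exact: rpred0. Qed.
Lemma RP_one j : (1 : fps L) \in RP j. Proof. exact: rpred1. Qed.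

Definition kap : {rmorphism F -> fps L} := fpsC (R:=L) \o in_alg L.

Lemma coefs_kapM a f k : coefs (kap a * f) k = a *: coefs f k.
Proof. by rewrite coefs_fpsCM /= mulr_algl. Qed.

Lemma RP_kap j a : kap a \in RP j.
Proof.
apply/RP_coefs => i _ /=; case: (i == 0%N); first by case: (cf_scalar a).
by case: cf_zero.
Qed.

Lemma RP_X j : fpsX \in RP j. Proof. exact: fpsX_Rprime. Qed.

Lemma RP_Xn j i : fpsX ^+ i \in RP j.
Proof. by apply: rpredX; exact: RP_X. Qed.

Lemma RP_XM j f : fpsX * f \in RP j.+1 <-> f \in RP j.
Proof.
split=> /RP_coefs H; apply/RP_coefs => i ij.
  by have := H i.+1 ij; rewrite coefs_XM.
by case: i ij => [_|i ij]; rewrite coefs_XM; [case: cf_zero|exact: H].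
Qed.

(** The element [T^j om], which together with [R_(j+1)] generates [R_j]. *)
Definition eps j : fps L := fpsX ^+ j * fpsC om.

Lemma coefs_eps j k : coefs (eps j) k = if k == j then om else 0.
Proof.
rewrite coefsXnM /=; case: ltngtP => // [jk|->]; last by rewrite subnn.
by rewrite subn_eq0 leqNgt jk.
Qed.

Lemma RP_eps j : eps j \in RP j.
Proof. by apply/RP_coefs => i ij; rewrite coefs_eps ltn_eqF //; case: cf_zero. Qed.

Lemma fpsX_eps j : fpsX * eps j = eps j.+1.
Proof. by rewrite /eps mulrA -exprS. Qed.

(** [R_j = R_(j+1) + k eps_j]. *)
Lemma RP_split j f : f \in RP j ->
  exists2 g, g \in RP j.+1 & f = g + kap (cf1 (coefs f j)) * eps j.
Proof.
move=> /RP_coefs H; set b := cf1 _; exists (f - kap b * eps j); last by rewrite subrK.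
apply/RP_coefs => i; rewrite ltnS coefsB coefs_kapM coefs_eps -scaleN1r => ij.
have [_ ->] := cf_add (coefs f i) (-1 *: (b *: (if i == j then om else 0))).
have [_ ->] := cf_scale (-1) (b *: (if i == j then om else 0)).
have [_ ->] := cf_scale b (if i == j then om else 0).
move: ij; rewrite leq_eqVlt => /predU1P[->|ij].
  by rewrite eqxx; have [_ ->] := cf_om; rewrite mulr1 mulN1r subrr.
by rewrite ltn_eqF // H // ; have [_ ->] := cf_zero; rewrite !mulr0 addr0.
Qed.

(** [R_(j+1) = k + T R_j]: the ring [R_(j+1)] is local with maximal ideal
    [T R_j]. *)
Lemma RP_max j f : f \in RP j.+1 ->
  exists2 g, g \in RP j & f = kap (cf0 (coefs f 0)) + fpsX * g.
Proof.
move=> fj; exists (fps_shift (f - kap (cf0 (coefs f 0)))).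
  apply/RP_XM; rewrite fpsXM_shift; first by rewrite rpredB // RP_kap.
  rewrite coefsB /= {1}(quad_basisE Q (coefs f 0)).
  by move/RP_coefs: (fj) => -> //; rewrite scale0r addr0 subrr.
rewrite fpsXM_shift; first by rewrite addrC subrK.
rewrite coefsB /= {1}(quad_basisE Q (coefs f 0)).
by move/RP_coefs: (fj) => -> //; rewrite scale0r addr0 subrr.
Qed.

(** The coefficients of the inverse are obtained recursively from those of [f],
    so the first [j] of them stay in the base field. *)
Lemma RP_inv j f : f \in RP j -> coefs f 0 != 0 ->
  exists2 g, g \in RP j & g * f = 1.
Proof.
move=> fj f0; exists f^-1; last by rewrite mulVr // unfold_in /= /fps_unit unitfE.
have ff : f * f^-1 = 1 by rewrite mulrV // unfold_in /= /fps_unit unitfE.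
move/Rprime_predP: fj => fF; apply/Rprime_predP.
elim/ltn_ind => i IH ij.
have [c0 c0E] := fF 0%N (leq_ltn_trans (leq0n i) ij).
have /choice[u uE] : forall l : 'I_i, exists u : F,
    coefs f (lift ord0 l) * coefs f^-1 (i - lift ord0 l) = u%:A.
  move=> l; have lt := ltn_ord l.
  have [c cE] : exists c : F, coefs f (lift ord0 l) = c%:A.
    by apply: fF; rewrite /= /bump /=; lia.
  have [d dE] : exists d : F, coefs f^-1 (i - lift ord0 l) = d%:A.
    by apply: IH; rewrite /= /bump /=; lia.
  by exists (c * d); rewrite cE dE -scalerAl mul1r scalerA.
have := congr1 (fun h => coefs h i) ff; rewrite coefsM big_ord_recl /= subn0.
rewrite (eq_bigr _ (fun l _ => uE l)) -scaler_suml c0E => e.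
exists (c0^-1 * ((i == 0%N)%:R - \sum_l u l)).
have c00 : c0 != 0 by apply: contraNneq f0 => z; rewrite c0E z scale0r.
rewrite -scalerA scalerBl (_ : (i == 0%N)%:R%:A = coefs 1 i :> L); last first.
  by rewrite coefs1; case: (i == 0%N); rewrite ?scale1r ?scale0r.
rewrite -[coefs 1 i]e addrK mulr_algl scalerA mulVf // scale1r.
by [].
Qed.

Local Notation omt := (cf1 (om * om)).
Local Notation omn := (cf0 (om * om)).

(** The quadratic equation of [om], scaled by [T^(2j)]. *)
Lemma eps2 j : eps j * eps j =
  kap omt * fpsX ^+ j * eps j + kap omn * fpsX ^+ j * fpsX ^+ j.
Proof.
have e : fpsC (om * om) = kap omn + kap omt * fpsC om.
  rewrite {1}(quad_basisE Q (om * om)) rmorphD; congr (_ + _).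
  by rewrite -[_ *: om]mulr_algl rmorphM.
by rewrite /eps mulrACA -rmorphM /= e; ring.
Qed.

Lemma quad_inv a b : (a != 0) || (b != 0) -> exists a' b',
  [/\ a * a' + b * b' * omn = 1 & a * b' + b * a' + b * b' * omt = 0].
Proof.
move=> ab; pose x := a%:A + b *: om.
have x0 : x != 0.
  apply: contraTneq ab => x0; have := (cf0E a b, cf1E a b); rewrite -/x x0.
  by have [-> ->] := cf_zero; move=> [<- <-]; rewrite eqxx.
have := mulfV x0; rewrite (quad_basisE Q x^-1); set a' := cf0 _; set b' := cf1 _.
move=> e; exists a', b'.
have E : 1%:A = (a * a' + b * b' * omn)%:A + (a * b' + b * a' + b * b' * omt) *: om.
  have sc (k : F) (y : L) : k *: y = in_alg L k * y by rewrite mulr_algl.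
  have oo : om * om = in_alg L omn + in_alg L omt * om.
    by rewrite {1}(quad_basisE Q (om * om)) !sc mulr1.
  transitivity (in_alg L (a * a') + in_alg L (a * b' + b * a') * om
                + in_alg L (b * b') * (om * om)).
    by rewrite scale1r -[LHS]e /x !sc; ring.
  by rewrite [in LHS]oo !sc; ring.
have [z0 z1] := cf_scalar 1; move: z0 z1; rewrite E cf0E cf1E => -> ->.
by [].
Qed.
End QuadBasis.

(** * Lattices over a subring *)

Section Lattices.
Variables (F : finFieldType) (A : comNzRingType) (kappa : {rmorphism F -> A}).
Local Notation codim := (codim kappa).
Local Notation subsp := (subsp kappa).

Section Submod.
Variable V : lmodType A.
Implicit Types (R : {pred A}) (M N : set V) (x y : V) (f g : A).

Definition submod R M :=
  [/\ M 0, forall x y, M x -> M y -> M (x + y) &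
      forall f x, f \in R -> M x -> M (f *: x)].

Lemma submod_subsp R M : (forall a, kappa a \in R) -> submod R M -> subsp M.
Proof. by move=> kR [M0 MD MZ]; split=> // a x; exact: MZ. Qed.

Lemma submodB R M x y : (forall a, kappa a \in R) -> submod R M -> M x -> M y ->
  M (x - y).
Proof. by move=> kR /(submod_subsp kR) sM; exact: subspB sM. Qed.

Lemma submod_le R R' M : {subset R' <= R} -> submod R M -> submod R' M.
Proof. by move=> RR' [M0 MD MZ]; split=> // f x /RR'; exact: MZ. Qed.

Lemma codim_refl (C : set V) : C 0 -> codim C C 0.
Proof.
move=> C0; exists (fun _ => 0); split=> [? ? _ _|a ? _|w|x].
- by rewrite addr0.
- by rewrite scaler0.
- by exists 0 => //; apply/rowP => -[].
- by split=> [|[]].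
Qed.

End Submod.

Section Boxes.
Variable n : nat.
Local Notation V := 'rV[A]_n.
Implicit Types (X Y : 'I_n -> set A^o) (M C D : set V) (x y : V).

Definition box X : set V := [set x | forall i, X i (x 0 i)].

Lemma submod_box R X : (forall i, submod R (X i)) -> submod R (box X).
Proof.
move=> sX; split=> [i|x y Xx Xy i|f x fj Xx i]; have [X0 XD XZ] := sX i; rewrite !mxE //.
  exact: XD.
exact: XZ.
Qed.

Lemma codim_box1 i X Y d : (forall k, X k 0) -> (forall k, k != i -> Y k = X k) ->
  codim (X i) (Y i) d -> codim (box X) (box Y) d.
Proof.
move=> X0 YX cXY; have YXi := codim_sub cXY; move: cXY.
apply: (codim_pullback (V := V) (V' := A^o) (f := fun x : V => x 0 i)).
- by move=> x y _ _; rewrite mxE.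
- by move=> a x _; rewrite mxE.
- by move=> x /(_ i).
- move=> f Xf; exists (\row_k if k == i then f else 0) => [k|]; rewrite !mxE ?eqxx //.
  by case: eqP => [->|].
- move=> x; split=> [Yx|[Xx Yx] k]; last by case: (eqVneq k i) => [->//|/YX->].
  split; last exact: Yx.
  move=> k; case: (eqVneq k i) => [->|ki]; first exact/YXi.
  by rewrite -YX.
Qed.

Lemma codim_box X Y (d : 'I_n -> nat) : (forall k, subsp (X k)) ->
  (forall k, codim (X k) (Y k) (d k)) -> codim (box X) (box Y) (\sum_k d k).
Proof.
move=> sX cXY.
have sY k : subsp (Y k) := subsp_codim (sX k) (cXY k).
have sub (Z : 'I_n -> set A^o) : (forall k, subsp (Z k)) -> subsp (box Z).
  move=> sZ; split=> [i|x y Zx Zy i|a x Zx i]; have [Z0 ZD ZZ] := sZ i; rewrite !mxE //.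
    exact: ZD.
  exact: ZZ.
have H (r : seq 'I_n) : uniq r ->
    codim (box X) (box (fun k => if k \in r then Y k else X k)) (\sum_(k <- r) d k).
  elim: r => [_|i r IH /= /andP[ir /IH {}IH]].
    by rewrite big_nil; apply: codim_refl; case: (sub _ sX).
  rewrite big_cons addnC; apply: (codim_trans (sub _ sX) IH).
  apply: (@codim_box1 i).
  - by move=> k; case: ifP => _; [case: (sY k)|case: (sX k)].
  - by move=> k ki; rewrite in_cons (negPf ki).
  - by rewrite (negPf ir) mem_head.
have := H (index_enum _) (index_enum_uniq _).
by congr (codim _ (box _) _); apply/funext => k; rewrite mem_index_enum.
Qed.

End Boxes.
End Lattices.

(** * Peeling off one coordinate *)

Section Peel.
Variables (F : finFieldType) (A : comNzRingType) (kappa : {rmorphism F -> A}).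
Variables (R : {pred A}) (sR : subring_closed R) (kR : forall a, kappa a \in R).
Variable n : nat.
Local Notation V := 'rV[A]_n.
Local Notation codim := (codim kappa).

Let R0 : 0 \in R. Proof. by rewrite -(rmorph0 kappa). Qed.
Let R1 : 1 \in R. Proof. by case: sR. Qed.
Let RM f g : f \in R -> g \in R -> f * g \in R. Proof. by case: sR => _ _; apply. Qed.
Let RD f g : f \in R -> g \in R -> f + g \in R.
Proof.
case: sR => _ RB _ fR gR; rewrite -[g]opprK; apply: (RB) => //.
by rewrite -[- g]sub0r; exact: RB.
Qed.

Definition zset : set A^o := [set f | f = 0].

Lemma submod_zset : submod R zset.
Proof. by split=> [//|x y -> ->|f x _ ->]; rewrite /zset /= ?addr0 // scaler0. Qed.

Definition upd (X : 'I_n -> set A^o) i Y k := if k == i then Y else X k.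

Definition lattices (X : 'I_n -> set A^o) (P : set V -> Prop) k :
    set (set V) :=
  [set M | [/\ submod R M, codim (box X) M k & P M]].

(** A lattice [M] whose [i]-th coordinates reach the generator [e] is
    [R v + M1] with [v_i = e] and [M1] the part of [M] with zero [i]-th
    coordinate. *)
Definition extend (X : 'I_n -> set A^o) i e (M1 : set V) v : set V :=
  [set x : V | exists f, [/\ f \in R, x 0 i = f * e, M1 (x - f *: v) & box X x]].

Section OneCoordinate.
Variables (X : 'I_n -> set A^o) (i : 'I_n).
Variables (Y' : set A^o) (e : A) (d : nat).
Variables (P P0 : set V -> Prop) (k : nat).
Hypotheses (sX : forall l, submod R (X l)) (sY' : submod R Y').
Hypothesis cY' : codim (X i) Y' d.
Hypotheses (Xe : X i e) (Y'e : ~ Y' e).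
Hypothesis e_gen : forall y, X i y -> exists2 f, f \in R & y = f * e.
Hypothesis e_unit : forall y, X i y -> ~ Y' y -> exists2 u, u \in R & u * y = e.
Hypothesis e_reg : forall f : A, f * e = 0 -> f = 0.
Let X' := upd X i Y'.
Let X0 := upd X i zset.
Hypothesis PP0 : forall M1 v, submod R M1 -> M1 `<=` box X0 -> box X v ->
  v 0 i = e -> P (extend X i e M1 v) <-> P0 M1.

Let sbX : submod R (box X) := submod_box sX.
Let sbX0 : submod R (box X0).
Proof.
by apply: submod_box => l; rewrite /X0 /upd; case: ifP => _ //; exact: submod_zset.
Qed.
Let sbX' : submod R (box X').
Proof. by apply: submod_box => l; rewrite /X' /upd; case: ifP. Qed.

Let X0X : box X0 `<=` box X.
Proof.
move=> x X0x l; have := X0x l; rewrite /X0 /upd; case: eqP => // -> ->.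
by case: (sX i).
Qed.

Let X0i x : box X0 x -> x 0 i = 0.
Proof. by move=> /(_ i); rewrite /X0 /upd eqxx. Qed.

Let box0 x : box X x -> x 0 i = 0 -> box X0 x.
Proof. by move=> Xx xi l; rewrite /X0 /upd; case: eqP => // ->. Qed.

Let sub_box0 v x f : box X v -> v 0 i = e -> box X x -> f \in R ->
  x 0 i = f * e -> box X0 (x - f *: v).
Proof.
move=> Xv ve Xx fj xf; apply: box0; last by rewrite !mxE ve xf subrr.
by apply: (submodB kR sbX) => //; case: sbX => _ _; exact.
Qed.

Lemma submod_extend M1 v : submod R M1 -> box X v -> v 0 i = e ->
  submod R (extend X i e M1 v).
Proof.
move=> [M0 MD MZ] Xv ve; have [_ XD XZ] := sbX; split.
- exists 0; split; rewrite ?R0 ?mxE ?mul0r ?scale0r ?subr0 //.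
  by case: sbX.
- move=> x y [f [fj xf Mx Xx]] [g [gj yg My Xy]]; exists (f + g); split.
  + exact: RD.
  + by rewrite mxE xf yg mulrDl.
  + by rewrite scalerDl opprD addrACA; exact: MD.
  + exact: XD.
- move=> h x hj [f [fj xf Mx Xx]]; exists (h * f); split.
  + exact: RM.
  + by rewrite mxE xf mulrA.
  + by rewrite -scalerA -scalerBr; exact: MZ.
  + exact: XZ.
Qed.

Lemma extend0 M1 v x : submod R M1 -> M1 `<=` box X0 -> box X v -> v 0 i = e ->
  extend X i e M1 v x /\ x 0 i = 0 <-> M1 x.
Proof.
move=> sM MX0 Xv ve; split=> [[[f [fj xf Mx Xx]] x0]|Mx].
  have f0 : f = 0 by apply: e_reg; rewrite -xf.
  by move: Mx; rewrite f0 scale0r subr0.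
split; last exact: X0i (MX0 _ Mx).
exists 0; rewrite R0 mul0r scale0r subr0; split=> //.
  exact: X0i (MX0 _ Mx).
exact/X0X/MX0.
Qed.

Lemma extend_v M1 v : M1 0 -> box X v -> v 0 i = e -> extend X i e M1 v v.
Proof.
by move=> M0 Xv ve; exists 1; rewrite R1 mul1r scale1r subrr.
Qed.

Let extend_codim M1 M v l : submod R M1 -> M1 `<=` box X0 -> box X v ->
  v 0 i = e -> M = extend X i e M1 v ->
  codim (box X) M l <-> codim (box X0) M1 l.
Proof.
move=> sM MX0 Xv ve ->.
apply: codim_iso2 => //.
- exact: (submod_subsp kR sbX).
- exact: (submod_subsp kR (submod_extend sM Xv ve)).
- by move=> x [f []].
- exact: (submod_subsp kR sbX0).
- move=> x; rewrite -(extend0 x sM MX0 Xv ve); split=> [[[f [? ? ? ?]] x0]|[/X0i]//].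
  by split; [exact: box0|exists f].
- move=> x Xx; have [f fj xf] := e_gen (Xx i).
  exists (f *: v); last exact: sub_box0.
  have [_ _ +] := submod_extend sM Xv ve; apply=> //.
  by apply: extend_v => //; case: sM.
Qed.

Let extendE M v : submod R M -> M `<=` box X -> M v -> v 0 i = e ->
  M = extend X i e [set x : V | M x /\ x 0 i = 0] v.
Proof.
move=> sM MX Mv ve; have [M0 MD MZ] := sM.
apply/seteqP; split=> [x Mx|x [f [fj xf [Mfx _] Xx]]].
  have [f fj xf] := e_gen (MX _ Mx i).
  exists f; split=> //; last exact: MX.
  split; first by apply: (submodB kR sM) => //; exact: MZ.
  by apply: X0i; apply: sub_box0 => //; exact: MX.
by rewrite -(subrK (f *: v) x); apply: MD => //; exact: MZ.
Qed.

Let submod0i M : submod R M -> submod R [set x : V | M x /\ x 0 i = 0].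
Proof.
move=> [M0 MD MZ]; split=> [|x y [Mx x0] [My y0]|f x fj [Mx x0]] /=; rewrite !mxE.
- by [].
- by rewrite x0 y0 addr0; split=> //; exact: MD.
- by rewrite x0 mulr0; split=> //; exact: MZ.
Qed.

(** The vector [v] of [extend] matters only modulo [M1] and has a prescribed [i]-th
    coordinate, so over each [M1] of codimension [k] there are [q ^ k] lattices. *)
Let has_card_reach N0 : has_card (lattices X0 P0 k) N0 ->
  has_card [set M | lattices X P k M /\ exists2 v, M v & v 0 i = e]
           (N0 * #|F| ^ k).
Proof.
move=> cN0; apply: (has_card_fibre (f := fun M => [set x : V | M x /\ x 0 i = 0]) cN0).
  move=> M [[sM cM PM] [v Mv ve]]; have MX := codim_sub cM.
  have sub0 : [set x : V | M x /\ x 0 i = 0] `<=` box X0.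
    by move=> x [Mx x0]; apply: box0 => //; exact: MX.
  have ME := extendE sM MX Mv ve; have s0 := submod0i sM.
  split; [exact: s0| |].
    by apply/(extend_codim _ s0 sub0 (MX _ Mv) ve ME).
  by apply/(PP0 s0 sub0 (MX _ Mv) ve); rewrite -ME.
move=> M1 [sM1 cM1 PM1]; have M1X := codim_sub cM1.
have [phi qphi] := cM1; have sX0 := submod_subsp kR sbX0.
have /choice[s sP] (w : 'rV[F]_k) : exists x, box X0 x /\ phi x = w.
  by have [x] := quotmap_surj qphi w; exists x.
pose v0 : V := \row_l (if l == i then e else 0).
have Xv0 : box X v0.
  by move=> l; rewrite mxE; case: eqP => [->//|_]; case: (sX l).
have v0e : v0 0 i = e by rewrite mxE eqxx.
have [_ XD _] := sbX; have [M10 M1D M1Z] := sM1.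
have XS w : box X (v0 + s w) by apply: XD => //; apply: X0X; case: (sP w).
have Se w : (v0 + s w) 0 i = e.
  by rewrite mxE v0e (X0i (proj1 (sP w))) addr0.
have card_rV : #|[pred w : 'rV[F]_k | true]| = (#|F| ^ k)%N.
  by rewrite -[in RHS](mul1n k) -card_mx; apply: eq_card.
rewrite -card_rV.
apply: (has_card_bij (g := fun w => extend X i e M1 (v0 + s w)) (has_card_fin _)).
  move=> w w' _ _ eqE.
  have := extend_v M10 (XS w) (Se w); rewrite eqE => -[f [fj ef Mf _]].
  have f1 : f = 1.
    apply/eqP; rewrite -subr_eq0; apply/eqP/e_reg.
    by rewrite mulrBl -ef Se mul1r subrr.
  move: Mf; rewrite f1 scale1r opprD addrACA subrr add0r => Mf.
  have [X0w <-] := sP w; have [X0w' <-] := sP w'.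
  exact/(quotmap_eq sX0 qphi).
move=> M; split=> [[[[sM cM PM] [v Mv ve]] M0]|[w _ <-]]; last first.
  have sE := submod_extend sM1 (XS w) (Se w).
  split; last by apply/seteqP; split=> x /(extend0 x sM1 M1X (XS w) (Se w)).
  split; last by exists (v0 + s w) => //; exact: extend_v.
  split=> //; first exact/(extend_codim _ sM1 M1X (XS w) (Se w)).
  exact/(PP0 sM1 M1X).
have MX := codim_sub cM.
have X0v : box X0 (v - v0).
  apply: box0; last by rewrite !mxE eqxx ve subrr.
  by apply: (submodB kR sbX) => //; exact: MX.
exists (phi (v - v0)) => //.
rewrite (extendE sM MX Mv ve) M0.
have Mdiff : M1 (v - (v0 + s (phi (v - v0)))).
  have [X0s e0] := sP (phi (v - v0)).
  by rewrite opprD addrA; apply/(quotmap_eq sX0 qphi).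
set u := v0 + _ in Mdiff *.
apply/seteqP; split=> x [f [fj xf Mx Xx]]; exists f; split=> //.
  rewrite (_ : x - f *: v = x - f *: u - f *: (v - u)); last first.
    by rewrite scalerBr opprB addrA subrK.
  by apply: (submodB kR sM1) => //; exact: M1Z.
rewrite (_ : x - f *: u = x - f *: v + f *: (v - u)); last first.
  by rewrite scalerBr addrA subrK.
by apply: M1D => //; exact: M1Z.
Qed.

(** The factor [#|F| ^ k] counts the vectors with the generator as [i]-th
    coordinate modulo [M1], which is all that [M] remembers beyond [M1]. *)
Lemma has_card_peel N' N0 :
  has_card [set M | lattices X P k M /\ M `<=` box X'] N' ->
  has_card (lattices X0 P0 k) N0 ->
  has_card (lattices X P k) (N' + N0 * #|F| ^ k).
Proof.
move=> cN' /has_card_reach; apply: (has_cardU _ _ cN') => M; last first.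
  move=> [_ MX'] [_ [v /MX'/(_ i) Y'v ve]].
  by apply: Y'e; rewrite -ve; move: Y'v; rewrite /X' /upd eqxx.
split=> [lM|[[]|[]]//]; have [sM cM PM] := lM.
case: (pselect (M `<=` box X')) => [MX'|nMX']; [by left|right; split=> //].
have [x [Mx nX'x]] : exists x, M x /\ ~ box X' x.
  apply: contrapT => H; apply: nMX' => x Mx; apply: contrapT => nX'x.
  by apply: H; exists x.
have Xx := codim_sub cM Mx.
have nYx : ~ Y' (x 0 i).
  move=> Yx; apply: nX'x => l; rewrite /X' /upd.
  by case: eqP => [->|_] //; exact: Xx.
have [u uj ue] := e_unit (Xx i) nYx; exists (u *: x); last by rewrite mxE.
by case: sM => _ _; exact.
Qed.

Lemma codim_upd : codim (box X) (box X') d.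
Proof.
apply: (@codim_box1 _ _ _ _ i).
- by move=> l; case: (sX l).
- by move=> l /negPf; rewrite /X' /upd => ->.
- by rewrite /X' /upd eqxx.
Qed.

Lemma lattices_upd M l : k = (d + l)%N ->
  lattices X P k M /\ M `<=` box X' <-> lattices X' P l M.
Proof.
move=> ->; have sX1 := submod_subsp kR sbX; have sX2 := submod_subsp kR sbX'.
split=> [[[sM cM PM] MX']|[sM cM PM]].
  split=> //.
  have [a [b [ca cb ab]]] := codim_split sX1 sX2 MX' (codim_sub codim_upd) cM.
  have := codim_uniq sX1 ca codim_upd; move: cb ab => /[swap] + cb ad.
  by rewrite ad => /addnI <-.
by split; [split=> //; exact: (codim_trans sX1 codim_upd cM)|exact: codim_sub cM].
Qed.

Lemma lattices_upd0 M : (k < d)%N -> lattices X P k M -> ~ M `<=` box X'.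
Proof.
have sX1 := submod_subsp kR sbX; have sX2 := submod_subsp kR sbX'.
move=> kd [sM cM PM] MX'.
have [a [b [ca cb ab]]] := codim_split sX1 sX2 MX' (codim_sub codim_upd) cM.
by have := codim_uniq sX1 ca codim_upd; lia.
Qed.

Lemma has_card_split N' N0 :
  (if (d <= k)%N then has_card (lattices X' P (k - d)) N' else N' = 0%N) ->
  has_card (lattices X0 P0 k) N0 ->
  has_card (lattices X P k) (N' + N0 * #|F| ^ k).
Proof.
move=> cN'; apply: has_card_peel; move: cN'; case: leqP => [dk|kd -> ].
  by apply: has_card_eq => M; symmetry; apply: lattices_upd; rewrite subnKC.
by apply: has_card0 => M [lM]; exact: lattices_upd0 lM.
Qed.
End OneCoordinate.
End Peel.

(** * Lattices over the rings [R_j] *)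

Section RLattices.
Variables (F : finFieldType) (L : fieldExtType (F : fieldType)) (Q : quad_basis L).
Local Notation RP := (Rprime_pred L).
Local Notation kap := (kap L).
Local Notation eps := (eps Q).
Local Notation cf0 := (cf0 Q).
Local Notation cf1 := (cf1 Q).
Local Notation codim := (codim kap).
Local Notation subsp := (subsp kap).

Section Ext.
Variable V : lmodType (fps L).
Implicit Types (M : set V) (x y : V) (f g : fps L).

Lemma submod_kap j M : submod (RP j) M -> subsp M.
Proof. by apply: submod_subsp => a; exact: RP_kap. Qed.

Lemma submodR_le i j M : (i <= j)%N -> submod (RP i) M -> submod (RP j) M.
Proof. by move=> ij; apply: submod_le => f; exact: (RP_le Q ij). Qed.

(** For an [R_(j+1)]-module [M] this is [R_j M], as [R_j = R_(j+1) + k eps_j]. *)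
Definition ext j M := [set z | exists x y, [/\ M x, M y & z = x + eps j *: y]].

Lemma sub_ext j M : M 0 -> M `<=` ext j M.
Proof. by move=> M0 x Mx; exists x, 0; rewrite scaler0 addr0. Qed.

(** Multiplication by [eps_j] preserves [M + eps_j M] because [eps_j^2] is a
    combination of [eps_j] and [1] with coefficients in [R_(j+1)]. *)
Lemma ext_submod j M : submod (RP j.+1) M -> submod (RP j) (ext j M).
Proof.
move=> sM; have [M0 MD MZ] := sM; split.
- exact: sub_ext.
- move=> _ _ [x [y [Mx My ->]]] [x' [y' [Mx' My' ->]]].
  exists (x + x'), (y + y'); rewrite scalerDr addrACA.
  by split=> //; exact: MD.
- move=> f _ fj [x [y [Mx My ->]]]; have [g gj ->] := RP_split Q fj.
  set b := cf1 _; have e2 := eps2 Q j; set c1 := cf1 _ in e2; set c0 := cf0 _ in e2.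
  have mX i : fpsX ^+ i \in RP j.+1 by apply: rpredX; exact: RP_X.
  exists (g *: x + (kap b * (kap c0 * fpsX ^+ j * fpsX ^+ j)) *: y),
    (kap b *: x + g *: y + (kap b * (kap c1 * fpsX ^+ j)) *: y); split.
  + apply: (MD); apply: (MZ) => //; rewrite !rpredM //; exact: RP_kap.
  + apply: (MD); [apply: (MD)|]; apply: (MZ) => //; rewrite ?rpredM //; exact: RP_kap.
  + rewrite !scalerDr !scalerDl !scalerA.
    have -> : kap b * eps j * eps j = eps j * (kap b * (kap c1 * fpsX ^+ j)) +
        kap b * (kap c0 * fpsX ^+ j * fpsX ^+ j) by rewrite -mulrA e2; ring.
    rewrite (mulrC g) scalerDl (mulrC (kap b) (eps j)).
    set A1 := _ *: x; set A2 := _ *: x; set A3 := _ *: y; set A4 := _ *: y.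
    set A5 := _ *: y.
    rewrite -!addrA; congr (_ + _); rewrite [RHS]addrC -!addrA; congr (_ + _).
Qed.

Lemma ext_min j M N : submod (RP j) N -> M `<=` N -> ext j M `<=` N.
Proof.
move=> [_ ND NZ] MN _ [x [y [Mx My ->]]]; apply: ND; first exact: MN.
by apply: NZ; [exact: RP_eps|exact: MN].
Qed.

(** [T R_j] is an ideal of [R_(j+1)], so [T R_j M] is contained in [M]. *)
Lemma ext_fpsX j M x : submod (RP j.+1) M -> ext j M x -> M (fpsX *: x).
Proof.
move=> [_ MD MZ] [y [z [My Mz ->]]]; rewrite scalerDr scalerA fpsX_eps.
by apply: MD; apply: MZ => //; [exact: RP_X|exact: RP_eps].
Qed.
Lemma eps_sq0 x : eps 0 *: (eps 0 *: x) =
  kap (cf1 (om Q * om Q)) *: (eps 0 *: x) + kap (cf0 (om Q * om Q)) *: x.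
Proof. by rewrite scalerA (eps2 Q 0) expr0 !mulr1 scalerDl scalerA. Qed.

(** For positive [j] the square of [eps_j] lies in [T R_j]; this is what makes
    [eps_j] nilpotent on [M / T M]. *)
Lemma eps_sqS i x : eps i.+1 *: (eps i.+1 *: x) =
  fpsX *: ((kap (cf1 (om Q * om Q)) * fpsX ^+ i) *: (eps i.+1 *: x) +
           (kap (cf0 (om Q * om Q)) * fpsX ^+ i * fpsX ^+ i.+1) *: x).
Proof.
rewrite scalerA (eps2 Q i.+1) scalerDl scalerDr !scalerA.
by congr (_ *: _ + _ *: _); rewrite exprS; ring.
Qed.
End Ext.

Section Scalars.
Local Notation V := (fps L)^o.

Definition RPset j : set V := [set f | f \in RP j].
Definition XRPset j : set V := [set f | exists2 g, g \in RP j & f = fpsX * g].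
Definition powset i : set V := [set f | forall k, (k < i)%N -> coefs f k = 0].

Lemma submod_RPset i j : (j <= i)%N -> submod (RP i) (RPset j).
Proof.
move=> ji; apply: (submodR_le ji); split; first exact: rpred0.
  by move=> x y; exact: rpredD.
by move=> f x fj xj; exact: rpredM.
Qed.

Lemma submod_XRPset i j : (j <= i)%N -> submod (RP i) (XRPset j).
Proof.
move=> ji; apply: (submodR_le ji); split; first by exists 0; rewrite ?rpred0 ?mulr0.
  by move=> _ _ [x xj ->] [y yj ->]; exists (x + y); rewrite ?rpredD // mulrDr.
by move=> f _ fj [x xj ->]; exists (f * x); rewrite ?rpredM //= mulrCA.
Qed.

Lemma submod_powset i j : submod (RP j) (powset i).
Proof.
split=> [k _ //|f g fi gi k ki|f g _ gi k ki].
  by rewrite coefsD fi ?gi ?addr0.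
rewrite coefsM big1 // => l _; rewrite gi ?mulr0 //.
by apply: leq_ltn_trans ki; exact: leq_subr.
Qed.

Lemma codim_RPset j : codim (RPset j) (RPset j.+1) 1.
Proof.
exists (fun f => const_mx (cf1 (coefs f j))); split.
- move=> f g _ _; apply/matrixP => a b; rewrite !mxE coefsD.
  by case: (cf_add Q (coefs f j) (coefs g j)).
- move=> a f _; apply/matrixP => b c; rewrite !mxE [_ *: f]/(kap a * f) coefs_kapM.
  by case: (cf_scale Q a (coefs f j)).
- move=> w; exists (kap (w 0 0) * eps j).
    by apply: rpredM; [exact: RP_kap|exact: RP_eps].
  apply/matrixP => a b; rewrite !mxE coefs_kapM coefs_eps eqxx !ord1.
  by have [_ ->] := cf_scale Q (w 0 0) (om Q); have [_ ->] := cf_om Q; rewrite mulr1.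
- move=> f; split=> [fj|[/(RP_coefs Q) fj /matrixP/(_ 0 0)]].
    split; first exact: (RP_weaken Q).
    by apply/matrixP => a b; rewrite !mxE; move/(RP_coefs Q): fj => ->.
  rewrite !mxE => f0; apply/(RP_coefs Q) => i; rewrite ltnS leq_eqVlt => /predU1P[->//|].
  exact: fj.
Qed.

Lemma XRPset_max j f : XRPset j f <-> RPset j.+1 f /\ cf0 (coefs f 0) = 0.
Proof.
split=> [[g gj ->]|[fj f0]].
  split; first exact/RP_XM.
  by rewrite coefs_XM; case: (cf_zero Q).
have [g gj ->] := RP_max Q fj; exists g => //.
by rewrite f0 rmorph0 add0r.
Qed.

Lemma codim_XRPset j : codim (RPset j.+1) (XRPset j) 1.
Proof.
exists (fun f => const_mx (cf0 (coefs f 0))); split.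
- move=> f g _ _; apply/matrixP => a b; rewrite !mxE coefsD.
  by case: (cf_add Q (coefs f 0) (coefs g 0)).
- move=> a f _; apply/matrixP => b c; rewrite !mxE [_ *: f]/(kap a * f) coefs_kapM.
  by case: (cf_scale Q a (coefs f 0)).
- move=> w; exists (kap (w 0 0)); first exact: RP_kap.
  apply/matrixP => a b; rewrite !mxE !ord1 /=.
  by case: (cf_scalar Q (w 0 0)).
- move=> f; rewrite XRPset_max; split=> -[fj f0]; split=> //.
    by apply/matrixP => a b; rewrite !mxE.
  by move/matrixP: f0 => /(_ 0 0); rewrite !mxE.
Qed.

Lemma codim_RP_XRP j : codim (RPset j) (XRPset j) 2.
Proof.
apply: (codim_trans _ (codim_RPset j) (codim_XRPset j)).
exact: (submod_kap (submod_RPset (leqnn j))).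
Qed.

Lemma codim_powset i : codim (powset i) (powset i.+1) 2.
Proof.
pose sh (f : V) : V := FPS (fun k => coefs f (k + i)).
apply: (codim_pullback (f := sh) _ _ _ _ _ (codim_RP_XRP 0)).
- by move=> f g _ _; apply/fpsP.
- move=> a f _; apply/fpsP => k.
  rewrite [_ *: f]/(kap a * f) [_ *: sh f]/(kap a * sh f) /sh.
  by rewrite coefs_kapM /= -[LHS]/(coefs (kap a * f) (k + i)) coefs_kapM.
- by move=> f _; exact: (RP_level0 Q).
- move=> f _; exists (FPS (fun k => if (k < i)%N then 0 else coefs f (k - i))).
    by move=> k ki /=; rewrite ki.
  by apply/fpsP => k /=; rewrite ltnNge leq_addl addnK.
- move=> f; split=> [fi|[fi [g _ fg]] k].
    split; first by move=> k ki; apply: fi; exact: ltnW.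
    exists (fps_shift (sh f)); first exact: (RP_level0 Q).
    by rewrite fpsXM_shift //= fi.
  rewrite ltnS leq_eqVlt => /predU1P[->|]; last exact: fi.
  have := congr1 (fun h => coefs h 0%N) fg.
  by rewrite coefs_XM /=.
Qed.
End Scalars.

Section XMul.
Variable n : nat.
Local Notation V := 'rV[fps L]_n.
Implicit Types (M C D : set V) (x y : V).

Definition Xmul M : set V := [set x | exists2 y, M y & x = fpsX *: y].

Lemma fpsX_inj : injective (fun x : V => fpsX *: x).
Proof.
move=> x y /rowP e; apply/rowP => i; have := e i.
by rewrite !mxE => /(congr1 (@fps_shift L)); rewrite !fps_shiftXM.
Qed.

Lemma Xmul_fpsX M x : Xmul M (fpsX *: x) <-> M x.
Proof. by split=> [[y My /fpsX_inj->]//|Mx]; exists x. Qed.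

Lemma Xmul_inj M N : Xmul M = Xmul N -> M = N.
Proof.
move=> e; apply/seteqP; split=> x Mx; apply/Xmul_fpsX; [rewrite -e|rewrite e];
  exact/Xmul_fpsX.
Qed.

Lemma submod_Xmul j M : submod (RP j) M <-> submod (RP j) (Xmul M).
Proof.
split=> [[M0 MD MZ]|[M0 MD MZ]]; split.
- by exists 0; rewrite ?scaler0.
- by move=> _ _ [x Mx ->] [y My ->]; rewrite -scalerDr; apply/Xmul_fpsX; exact: MD.
- move=> f _ fj [x Mx ->]; rewrite scalerA mulrC -scalerA; apply/Xmul_fpsX.
  exact: MZ.
- by apply/Xmul_fpsX; rewrite scaler0.
- move=> x y /Xmul_fpsX Mx /Xmul_fpsX My; apply/Xmul_fpsX.
  by rewrite scalerDr; exact: MD.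
- move=> f x fj /Xmul_fpsX Mx; apply/Xmul_fpsX.
  by rewrite scalerA mulrC -scalerA; exact: MZ.
Qed.

Lemma ext_Xmul j M : ext j (Xmul M) = Xmul (ext j M).
Proof.
apply/seteqP; split=> [_ [_ [_ [[x Mx ->] [y My ->] ->]]]|_ [_ [x [y [Mx My ->]]] ->]].
  exists (x + eps j *: y); first by exists x, y.
  by rewrite scalerDr !scalerA (mulrC _ (eps j)).
exists (fpsX *: x), (fpsX *: y); split; try exact/Xmul_fpsX.
by rewrite scalerDr !scalerA (mulrC _ (eps j)).
Qed.

Lemma codim_Xmul C D k : D `<=` C -> codim C D k <-> codim (Xmul C) (Xmul D) k.
Proof.
move=> DC; split.
  pose sh (x : V) : V := map_mx (@fps_shift L) x.
  have shX x : sh (fpsX *: x) = x by apply/rowP => i; rewrite !mxE fps_shiftXM.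
  apply: (codim_pullback (f := sh)).
  - by move=> x y _ _; apply/rowP => i; rewrite !mxE fps_shiftD.
  - by move=> a x _; apply/rowP => i; rewrite !mxE fps_shiftCM.
  - by move=> _ [x Cx ->]; rewrite shX.
  - by move=> y Cy; exists (fpsX *: y); [exact/Xmul_fpsX|rewrite shX].
  - move=> x; split=> [[y Dy ->]|[[y Cy ->]]]; rewrite shX.
      by split=> //; apply/Xmul_fpsX; exact: DC.
    by move=> Dy; apply/Xmul_fpsX.
apply: (codim_pullback (f := fun x => fpsX *: x)).
- by move=> x y _ _; rewrite scalerDr.
- by move=> a x _; rewrite !scalerA mulrC.
- by move=> x Cx; apply/Xmul_fpsX.
- by move=> _ [x Cx ->]; exists x.
- move=> x; rewrite Xmul_fpsX; split=> [Dx|[]//].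
  by split=> //; exact: DC.
Qed.

End XMul.
End RLattices.

(** * Modules over [R_(j+1)] generating a given module over [R_j] *)

Section Fibre.
Variables (F : finFieldType) (L : fieldExtType (F : fieldType)) (Q : quad_basis L).
Variables (n : nat) (S : {set 'I_n}).
Local Notation V := 'rV[fps L]_n.
Local Notation RP := (Rprime_pred L).
Local Notation kap := (kap L).
Local Notation codim := (codim kap).
Local Notation eps := (eps Q).
Local Notation q := #|F|.

(** [R_j^S], as a lattice supported on the coordinates in [S]. *)
Definition Rbox j : set V :=
  box (fun k => if k \in S then RPset (L:=L) j else @zset (fps L)).

Definition XRbox j : set V :=
  box (fun k => if k \in S then XRPset (L:=L) j else @zset (fps L)).

Lemma submod_Rbox i j : (j <= i)%N -> submod (RP i) (Rbox j).
Proof.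
move=> ji; apply: submod_box => k; case: ifP => _; first exact: submod_RPset.
exact: submod_zset.
Qed.

Lemma XRboxE j : XRbox j = Xmul (Rbox j).
Proof.
apply/seteqP; split=> [x Xx|_ [x Rx ->] k]; last first.
  have := Rx k; rewrite mxE; case: ifP => _ => [xj|->]; first by exists (x 0 k).
  by rewrite /zset /= mulr0.
have /choice[g gP] k : exists g,
    (if k \in S then g \in RP j else g == 0) /\ x 0 k = fpsX * g.
  have := Xx k; case: ifP => _ => [[g gj xg]|xk]; first by exists g.
  by exists 0; rewrite eqxx mulr0.
exists (\row_k g k); last by apply/rowP => k; rewrite !mxE; case: (gP k).
by move=> k; rewrite mxE; have [] := gP k; case: ifP => // _ /eqP.
Qed.

Lemma sum_nat_S d : (\sum_(k : 'I_n) (if k \in S then d else 0) = d * #|S|)%N.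
Proof. by rewrite -big_mkcond sum_nat_const mulnC. Qed.

Lemma subsp_zset : subsp kap (@zset (fps L)).
Proof. exact: (submod_kap Q (submod_zset (RP 0))). Qed.

Lemma codim_Rbox_X j : codim (Rbox j) (Xmul (Rbox j)) (2 * #|S|).
Proof.
rewrite -XRboxE -sum_nat_S; apply: codim_box => k; case: ifP => _.
- exact: (submod_kap Q (submod_RPset Q (leqnn j))).
- exact: subsp_zset.
- exact: codim_RP_XRP.
- exact: codim_refl.
Qed.

Lemma codim_RboxS j : codim (Rbox j) (Rbox j.+1) #|S|.
Proof.
rewrite -[#|S|]mul1n -sum_nat_S; apply: codim_box => k; case: ifP => _.
- exact: (submod_kap Q (submod_RPset Q (leqnn j))).
- exact: subsp_zset.
- exact: codim_RPset.
- exact: codim_refl.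
Qed.

Lemma Xmul_sub j (M : set V) : submod (RP j) M -> Xmul M `<=` M.
Proof. by move=> [_ _ MZ] _ [x Mx ->]; apply: MZ => //; exact: RP_X. Qed.

(** Comparing the two chains from [R_j^S] down to [T M]: the colength of [T M] in
    [T R_j^S] equals that of [M] in [R_j^S]. *)
Lemma codim_XM j k (M : set V) : submod (RP j) M -> codim (Rbox j) M k ->
  codim M (Xmul M) (2 * #|S|).
Proof.
move=> sM cM; have sR := submod_Rbox (leqnn j).
have kR := submod_kap Q sR; have kM := submod_kap Q sM.
have MR := codim_sub cM.
have cX : codim (Xmul (Rbox j)) (Xmul M) k by apply/(codim_Xmul _ MR).
have cRM := codim_trans kR (codim_Rbox_X j) cX.
have [a [b [ca cb ab]]] := codim_split kR kM (Xmul_sub sM) MR cRM.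
have e := codim_uniq kR ca cM; move: cb.
by have -> : b = (2 * #|S|)%N by lia.
Qed.

Section OneFibre.
Variables (j k c : nat) (M' : set V).
Hypotheses (sM' : submod (RP j) M') (cM' : codim (Rbox j) M' k).
Local Notation N := (2 * #|S|)%N.
Let kM' := submod_kap Q sM'.

Definition fibre : set (set V) :=
  [set M | [/\ submod (RP j.+1) M, ext Q j M = M' & codim M' M c]].

Section WithMap.
Variables (phi : V -> 'rV[F]_N) (E : 'M[F]_N).
Hypothesis qphi : quotmap kap M' (Xmul M') phi.
Hypothesis phiE : forall x, M' x -> phi (eps j *: x) = phi x *m E.

Let phiX x : M' x -> phi (fpsX *: x) = 0.
Proof.
by move=> M'x; have [] := (quotmap_ker qphi (fpsX *: x)).1 _; first by exists x.
Qed.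

Let M'Z f x : f \in RP j -> M' x -> M' (f *: x).
Proof. by case: sM' => _ _; apply. Qed.

(** An [R_(j+1)]-module [M] with [R_j M = M'] contains [T M'], hence is the inverse
    image of a subspace of [M' / T M']. That quotient carries the endomorphism [E]
    given by [eps_j], and [M] generates [M'] exactly when the subspace and its
    image under [E] span the quotient; [W] is the annihilator of the subspace. *)
Lemma has_card_fibre_moved : has_card fibre
  #|[pred W : 'M[F]_N | [&& <<W>>%MS == W, \rank W == c & moved_by E^T W]]|.
Proof.
pose cut (W : 'M[F]_N) : set V := [set x | M' x /\ phi x *m W^T = 0].
apply: (has_card_bij (g := cut) (has_card_fin _)).
  move=> W W' /= /and3P[/eqP WW _ _] /and3P[/eqP WW' _ _] /seteqP[e1 e2].
  apply: (cut_inj qphi) => // x M'x; split=> h.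
    by have [] := e1 x (conj M'x h).
  by have [] := e2 x (conj M'x h).
move=> M; split=> [[sM extM cM]|[W /= /and3P[/eqP WW /eqP rW /moved_byP mW] <-]].
  have MM' : M `<=` M' := codim_sub cM.
  have XM : Xmul M' `<=` M by rewrite -extM => _ [x ex ->]; exact: ext_fpsX ex.
  have [W WW MW] := cut_exists kM' qphi (submod_kap Q sM) XM MM'.
  have ME : M = cut W by apply/seteqP; split=> x /MW.
  exists W => //=; rewrite WW eqxx /=; apply/andP; split.
    have := codim_cut qphi W^T; rewrite -/(cut W) -ME => cM2.
    by rewrite -mxrank_tr (codim_uniq kM' cM2 cM).
  apply/moved_byP => w wW wEW; apply: trmx_inj; rewrite trmx0.
  have w0 (x : V) (v : 'rV_N) : M x -> (v <= W)%MS -> phi x *m v^T = 0.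
    move=> /MW[_ xW] /submxP[u ->].
    by rewrite trmx_mul mulmxA xW mul0mx.
  have {}w0 x : M' x -> phi x *m w^T = 0.
    rewrite -{1}extM => -[y [z [My Mz ->]]]; have [M'y M'z] := (MM' _ My, MM' _ Mz).
    rewrite (quotmapD qphi) ?phiE //; last by apply: M'Z => //; exact: RP_eps.
    rewrite mulmxDl (w0 y w) // add0r -mulmxA.
    by rewrite -[E *m _]trmxK trmx_mul trmxK (w0 z).
  apply/row_matrixP => l; rewrite row0 rowE.
  by have [x M'x <-] := quotmap_surj qphi (delta_mx 0 l); exact: w0.
have kc := subsp_cut kM' qphi W^T; have [c0 cD cZ] := kc.
have sc : submod (RP j.+1) (cut W).
  split=> // f x fj [M'x xW].
  have [g gj ->] := RP_max Q fj; rewrite scalerDl; apply: cD; first exact: cZ.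
  rewrite -scalerA; have M'gx := M'Z gj M'x; split; last by rewrite phiX ?mul0mx.
  by apply: M'Z => //; exact: RP_X.
split=> //; last by have := codim_cut qphi W^T; rewrite mxrank_tr rW.
apply/seteqP; split=> [|x M'x]; first by apply: ext_min => // x [].
have sB := ext_submod Q sc; have BM' : ext Q j (cut W) `<=` M'.
  by apply: ext_min => // y [].
have XB : Xmul M' `<=` ext Q j (cut W).
  move=> _ [y M'y ->]; apply: sub_ext => //; rewrite /cut /=.
  by rewrite phiX // mul0mx; split=> //; apply: M'Z => //; exact: RP_X.
have [W2 _ BW] := cut_exists kM' qphi (submod_kap Q sB) XB BM'.
have W2W : (W2 <= W)%MS.
  apply: (cut_sub qphi) => y M'y yW.
  by have [] := (BW y).1; first exact: sub_ext.
have W2E : (W2 *m E^T <= W)%MS.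
  apply: (cut_sub qphi) => y M'y yW; rewrite trmx_mul trmxK mulmxA -phiE //.
  have [] // := (BW (eps j *: y)).1.
  by exists 0, y; rewrite add0r.
have W20 : W2 = 0.
  apply/eqP; rewrite -submx0; apply/rV_subP => w wW2; rewrite submx0; apply/eqP.
  apply: mW; first exact: submx_trans W2W.
  exact: submx_trans (submxMr _ wW2) W2E.
by apply/BW; rewrite W20 trmx0 mulmx0.
Qed.

Let mx_ext (A B : 'M[F]_N) : (forall x, M' x -> phi x *m A = phi x *m B) -> A = B.
Proof.
move=> AB; apply/row_matrixP => l; rewrite !rowE.
by have [x M'x <-] := quotmap_surj qphi (delta_mx 0 l); exact: AB.
Qed.

Lemma endo_nilp : (0 < j)%N -> E *m E = 0.
Proof.
move=> j0; apply: mx_ext => x M'x; rewrite mulmx0 mulmxA.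
have M'e : M' (eps j *: x) := M'Z (RP_eps Q j) M'x.
rewrite -(phiE M'x) -(phiE M'e); move: j0 M'e M'Z; case: (j) => // i _ M'e M'Z'.
rewrite eps_sqS; apply: phiX; case: sM' => _ M'D _; apply: M'D; apply: M'Z' => //.
  exact (RP_mul (RP_kap Q _ _) (RP_Xn _ _ _)).
exact (RP_mul (RP_mul (RP_kap Q _ _) (RP_Xn _ _ _)) (RP_Xn _ _ _)).
Qed.

Lemma endo_quad : j = 0%N ->
  E *m E = cf1 Q (om Q * om Q) *: E + (cf0 Q (om Q * om Q))%:M.
Proof.
move=> j0; apply: mx_ext => x M'x.
have M'e : M' (eps j *: x) := M'Z (RP_eps Q j) M'x.
rewrite mulmxDr mul_mx_scalar -scalemxAr mulmxA -(phiE M'x) -(phiE M'e).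
move: M'e; rewrite j0 => M'e; rewrite eps_sq0.
have Z a y : M' y -> M' (kap a *: y) by move=> My; exact: (M'Z (RP_kap Q j a) My).
rewrite (quotmapD qphi (Z _ _ M'e) (Z _ _ M'x)).
by rewrite (quotmapZ qphi _ M'e) (quotmapZ qphi _ M'x).
Qed.

(** Multiplied by [T], the pair [M' <= R_i M'] becomes
    [T M' <= T M' + eps_j M'] with [j = i + 1], whose quotient is the image of
    [E]. *)
Lemma rank_endo i a : j = i.+1 -> codim (ext Q i M') M' a -> \rank E = a.
Proof.
move=> ji ca; pose B := Xmul (ext Q i M').
have M'X : M' `<=` ext Q i M' by apply: sub_ext; case: sM'.
have cB : codim B (Xmul M') a by apply/(codim_Xmul _ M'X).
have BE : B = [set x | M' x /\ phi x *m cokermx E = 0].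
  apply/seteqP; split=> [_ [_ [x [y [M'x M'y ->]]] ->]|x [M'x]].
    have M'Xx : M' (fpsX *: x) by apply: M'Z => //; exact: RP_X.
    have M'ey : M' (eps j *: y) by apply: M'Z => //; exact: RP_eps.
    rewrite scalerDr scalerA fpsX_eps -ji; split; first by case: sM' => _ + _; apply.
    by rewrite (quotmapD qphi) // phiX // add0r phiE // -mulmxA mulmx_coker mulmx0.
  move/eqP; rewrite -submxE => /submxP[w xw].
  have [y M'y yw] := quotmap_surj qphi w.
  have M'ey : M' (eps j *: y) by apply: M'Z => //; exact: RP_eps.
  have [x' M'x' xx'] : Xmul M' (x - eps j *: y).
    by apply/(quotmap_eq kM' qphi) => //; rewrite phiE // yw.
  exists (x' + eps i *: y); first by exists x', y.
  by rewrite scalerDr scalerA fpsX_eps -ji -xx' subrK.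
have := cut_codim qphi (cokermx E).
rewrite -BE mxrank_coker subKn ?rank_leq_row // => cB'.
have kB : subsp kap B.
  by rewrite BE; exact: (subsp_cut kM' qphi (cokermx E)).
exact: codim_uniq kB cB' cB.
Qed.

End WithMap.

Lemma endo_exists : exists (phi : V -> 'rV[F]_N) (E : 'M[F]_N),
  quotmap kap M' (Xmul M') phi /\ forall x, M' x -> phi (eps j *: x) = phi x *m E.
Proof.
have [phi qphi] := codim_XM sM' cM'; exists phi.
have [E phiE] : exists E : 'M[F]_N, forall x, M' x -> phi (eps j *: x) = phi x *m E.
  apply: (quotmap_endo kM' qphi).
  - by move=> x M'x; case: sM' => _ _; apply=> //; exact: RP_eps.
  - move=> _ [x M'x ->]; exists (eps j *: x); last by rewrite !scalerA mulrC.
    by case: sM' => _ _; apply=> //; exact: RP_eps.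
  - by move=> x y; rewrite scalerDr.
  - by move=> a x; rewrite !scalerA mulrC.
by exists E.
Qed.
End OneFibre.

(** For [j > 0] multiplication by [eps_j] is nilpotent on [M' / T M']. *)
Lemma has_card_fibre_nilp i k c a (M' : set V) :
  submod (RP i.+1) M' -> codim (Rbox i.+1) M' k -> codim (ext Q i M') M' a ->
  (a <= 2 * #|S|)%N /\
  exists2 N, has_card (fibre i.+1 c M') N &
    (N * \prod_(l < c) (q ^ c - q ^ l) =
     \prod_(l < c) (q ^ (2 * #|S|) - q ^ (2 * #|S| - a + l)))%N.
Proof.
move=> sM' cM' ca; have [phi [E [qphi phiE]]] := endo_exists sM' cM'.
have rE : \rank E = a := rank_endo sM' qphi phiE erefl ca.
split; first by rewrite -rE rank_leq_row.
exists #|[pred W : 'M[F]_(2 * #|S|) | [&& <<W>>%MS == W, \rank W == c & moved_by E^T W]]|.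
  exact: (has_card_fibre_moved c sM' qphi phiE).
rewrite card_moved_by_nil ?mxrank_tr ?rE //.
by rewrite -trmx_mul (endo_nilp sM' qphi phiE) ?trmx0.
Qed.

(** For [j = 0] it is multiplication by a generator of the quadratic extension. *)
Lemma has_card_fibre_inert k c (M' : set V) :
  submod (RP 0) M' -> codim (Rbox 0) M' k ->
  exists2 N, has_card (fibre 0 c M') N &
    (N * \prod_(l < c) (q ^ c - q ^ l) =
     \prod_(l < c) (q ^ (2 * #|S|) - q ^ (l + l)))%N.
Proof.
move=> sM' cM'; have [phi [E [qphi phiE]]] := endo_exists sM' cM'.
exists #|[pred W : 'M[F]_(2 * #|S|) | [&& <<W>>%MS == W, \rank W == c & moved_by E^T W]]|.
  exact: (has_card_fibre_moved c sM' qphi phiE).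
have E2 := endo_quad sM' qphi phiE erefl.
apply: card_moved_by_inert.
  by rewrite -trmx_mul E2 linearD linearZ /= tr_scalar_mx.
move=> a b ab; have [a' [b' [e1 e2]]] := quad_inv Q ab.
rewrite -(unitmx_tr) linearD linearZ /= trmxK tr_scalar_mx.
suff /mulmx1_unit[] : (a%:M + b *: E) *m (a'%:M + b' *: E) = 1%:M by [].
transitivity ((a * a' + b * b' * cf0 Q (om Q * om Q))%:M +
              (a * b' + b * a' + b * b' * cf1 Q (om Q * om Q)) *: E); last first.
  by rewrite e1 e2 scale0r addr0.
rewrite mulmxDl !mulmxDr -scalar_mxM mul_scalar_mx mul_mx_scalar.
rewrite -scalemxAl -scalemxAr E2 !scalerDr !scalerA !scale_scalar_mx.
rewrite !scalerDl raddfD /= (mulrC a' b) -!addrA; congr (_ + _).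
by rewrite [RHS]addrC -!addrA.
Qed.
End Fibre.

(** * Generating functions of lattices *)

(** With [w = q ^- r] this is the passage from the zeta series of a rank [r]
    lattice to its normalized version: the recursions below then need no
    substitution in the variable. *)
Definition genfun (T : choiceType) (w : rat) (A : nat -> set T) (f : fps rat) :=
  forall k, exists2 N, has_card (A k) N & coefs f k = w ^+ k * N%:R.

Section GenFun.
Variables (F : finFieldType) (L : fieldExtType (F : fieldType)) (Q : quad_basis L).
Variable n : nat.
Local Notation V := 'rV[fps L]_n.
Local Notation RP := (Rprime_pred L).
Local Notation kap := (kap L).
Local Notation codim := (codim kap).
Local Notation q := #|F|.
Local Notation z := ((q%:R : rat)^-1).
Local Notation lattices j := (@lattices F (fps L) kap (RP j) n).
Local Notation zset := (@zset (fps L)).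

Lemma q_neq0 : (q%:R : rat) != 0.
Proof. by rewrite pnatr_eq0 -lt0n; exact: ltnW (finRing_gt1 F). Qed.

Lemma RP_subring j : subring_closed (RP j). Proof. exact: Rprime_subring. Qed.

Definition powbox (S : {set 'I_n}) (e : 'I_n -> nat) l : set (fps L)^o :=
  if l \in S then powset (L:=L) (e l) else zset.

Lemma powset_gen i (y : fps L) : powset (L:=L) i y ->
  exists2 f, f \in RP 0 & y = f * fpsX ^+ i.
Proof.
move=> yi; exists (FPS (fun k => coefs y (k + i))); first exact: RP_level0.
rewrite mulrC; apply/fpsP => k; rewrite coefsXnM.
by case: ltnP => [/yi->//|ik]; rewrite /= subnK.
Qed.

Lemma powset_unit i (y : fps L) : powset (L:=L) i y -> ~ powset (L:=L) i.+1 y ->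
  exists2 u, u \in RP 0 & u * y = fpsX ^+ i.
Proof.
move=> yi ny; have [f _ yf] := powset_gen yi.
have f0 : coefs f 0 != 0.
  apply: contra_not_neq ny => f0 k; rewrite ltnS leq_eqVlt => /predU1P[->|/yi//].
  by rewrite yf mulrC coefsXnM ltnn subnn.
have [u u0 uf] := RP_inv (RP_level0 Q f) f0; exists u => //.
by rewrite yf mulrA uf mul1r.
Qed.

Lemma fpsXn_reg i (f : fps L) : f * fpsX ^+ i = 0 -> f = 0.
Proof.
move=> f0; apply/fpsP => k; have := congr1 (fun g => coefs g (k + i)) f0.
by rewrite mulrC coefsXnM ltnNge leq_addl addnK.
Qed.

Lemma submod_powbox S e l : submod (RP 0) (powbox S e l).
Proof.
rewrite /powbox; case: ifP => _; first exact: submod_powset.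
exact: submod_zset.
Qed.

Lemma genfun_zero w (X : 'I_n -> set (fps L)^o) : (forall l, X l = zset) ->
  genfun w (fun k => lattices 0 X (fun _ => True) k) 1.
Proof.
move=> Xz k; have sX : submod (RP 0) (box X).
  by apply: submod_box => l; rewrite Xz; exact: submod_zset.
have kX := submod_kap Q sX.
have cX : codim (box X) (box X) 0 by apply: codim_refl; case: kX.
have X0 x : box X x -> x = 0.
  by move=> Xx; apply/rowP => l; have := Xx l; rewrite Xz mxE.
have uX M : submod (RP 0) M -> codim (box X) M k -> M = box X.
  move=> [M0 _ _] cM; apply/seteqP; split; first exact: codim_sub cM.
  by move=> x /X0->.
exists (k == 0%N) => [|]; last first.
  by rewrite coefs1; case: k {uX} => [|k] /=; rewrite ?mul1r ?mulr0.
case: k uX => [|k] uX /=.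
  exists [:: box X] => //; split=> // M; rewrite inE; split=> [[sM cM _]|/eqP->//].
  by apply/eqP/uX.
apply: has_card0 => M [sM cM _]; have := uX M sM cM => ME.
by rewrite ME in cM; have := codim_uniq kX cM cX.
Qed.

Local Notation Z := (fpsC z : fps rat).
Local Notation T := (fpsX : fps rat).

(** The zeta series of [O^s], with [t] rescaled. *)
Definition zetaO s : fps rat := (qpoch (T ^+ 2 * Z ^+ 2) (Z ^+ 2) s)^-1.

Lemma fps_unitE (f : fps rat) : (f \is a GRing.unit) = (coefs f 0 != 0).
Proof. by rewrite -unitfE. Qed.

Lemma qpoch_TZ_unit s : qpoch (T ^+ 2 * Z ^+ 2) (Z ^+ 2) s \is a GRing.unit.
Proof.
by rewrite rpred_prod // => i _; rewrite fps_unitE coefsB coefs1 -mulrA coefsXnM /=.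
Qed.

Lemma zetaOS s : zetaO s.+1 = zetaO s + T ^+ 2 * (Z ^+ (2 * s.+1) * zetaO s.+1).
Proof.
pose a := T ^+ 2 * Z ^+ (2 * s.+1); pose P := qpoch (T ^+ 2 * Z ^+ 2) (Z ^+ 2) s.
have PE : qpoch (T ^+ 2 * Z ^+ 2) (Z ^+ 2) s.+1 = P * (1 - a).
  rewrite /qpoch big_ord_recr; congr (P * (1 - _)); rewrite /a -[LHS]mulrA.
  by congr (_ * _); rewrite -exprS -exprM.
have Pu : P \is a GRing.unit := qpoch_TZ_unit s.
have au : 1 - a \is a GRing.unit.
  by have := qpoch_TZ_unit s.+1; rewrite PE => h; rewrite -(unitrMr _ Pu).
rewrite /zetaO PE mulrA -/a; have -> : P^-1 = (1 - a) * (P * (1 - a))^-1.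
  by rewrite (invrM Pu au) (mulVKr au).
by rewrite mulrBl mul1r subrK.
Qed.

(** Induction on the rank and, for fixed rank, on the colength: peeling a
    coordinate with lattice [T^e O] relates it to [T^(e+1) O] with colength
    smaller by two. The exponents are arbitrary since they change on the way. *)
Lemma genfun_powbox s (S : {set 'I_n}) e : #|S| = s ->
  genfun (z ^+ s) (fun k => lattices 0 (powbox S e) (fun _ => True) k) (zetaO s).
Proof.
elim: s S e => [|s IH] S e cS.
  rewrite /zetaO /qpoch big_ord0 invr1; apply: genfun_zero => l.
  by move/eqP: cS; rewrite cards_eq0 /powbox => /eqP->; rewrite inE.
have [i iS] : exists i, i \in S by apply/set0Pn; rewrite -card_gt0 cS.
have cS' : #|S :\ i| = s by have := cardsD1 i S; rewrite iS cS => -[].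
move=> k; elim/ltn_ind: k e => k IHk e.
pose e' l := if l == i then (e i).+1 else e l.
have Xi : powbox S e i = powset (L:=L) (e i) by rewrite /powbox iS.
have X'E : upd (powbox S e) i (powset (L:=L) (e i).+1) = powbox S e'.
  apply/funext => l; rewrite /upd /powbox /e'; case: eqP => // ->.
  by rewrite iS.
have X0E : upd (powbox S e) i zset = powbox (S :\ i) e.
  apply/funext => l; rewrite /upd /powbox !inE.
  by case: eqP.
have [N0 cN0 fN0] := IH (S :\ i) e cS' k.
have cY : codim (powbox S e i) (powset (L:=L) (e i).+1) 2.
  by rewrite Xi; exact: codim_powset.
have sX := submod_powbox S e.
have Xe : powbox S e i (fpsX ^+ e i).
  rewrite Xi => l le; rewrite -[fpsX ^+ _]mulr1 coefsXnM le //.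
have Y'e : ~ powset (L:=L) (e i).+1 (fpsX ^+ e i).
  move=> /(_ _ (leqnn _)); rewrite -[fpsX ^+ _]mulr1 coefsXnM ltnn subnn.
  by move=> /eqP; rewrite oner_eq0.
have egen y : powbox S e i y -> exists2 f, f \in RP 0 & y = f * fpsX ^+ e i.
  by rewrite Xi; exact: powset_gen.
have eunit y : powbox S e i y -> ~ powset (L:=L) (e i).+1 y ->
    exists2 u, u \in RP 0 & u * y = fpsX ^+ e i.
  by rewrite Xi; exact: powset_unit.
have ereg := @fpsXn_reg (e i).
have [N' cN' fN'] : exists2 N', if (2 <= k)%N
    then has_card (lattices 0 (powbox S e') (fun _ => True) (k - 2)) N' else N' = 0%N &
    coefs (T ^+ 2 * (Z ^+ (2 * s.+1) * zetaO s.+1)) k = z ^+ s.+1 ^+ k * N'%:R.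
  rewrite coefsXnM; case: (leqP 2 k) => k2; last by exists 0%N; rewrite ?mulr0.
  have [|N' cN' fN'] := IHk (k - 2)%N _ e'; first by lia.
  exists N' => //; rewrite -rmorphXn coefs_fpsCM fN' mulrA -!exprM -exprD.
  by congr (_ ^+ _ * _); rewrite mulnC -mulnDr subnKC.
exists (N' + N0 * q ^ k)%N; last first.
  rewrite zetaOS coefsD fN' fN0 addrC natrD natrM natrX mulrDr; congr (_ + _).
  by rewrite mulrCA -exprMn exprSr mulfVK ?q_neq0 // mulrC.
rewrite -X'E in cN'; rewrite -X0E in cN0.
exact: (has_card_split (RP_subring 0) (RP_kap Q 0) sX (submod_powset L (e i).+1 0)
  cY Xe Y'e egen eunit ereg (fun _ _ _ _ _ _ => iff_refl True) cN' cN0).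
Qed.
End GenFun.

(** * Peeling coordinates over [R_(j+1)] *)

Section Mixed.
Variables (F : finFieldType) (L : fieldExtType (F : fieldType)) (Q : quad_basis L).
Variables (n j : nat).
Local Notation V := 'rV[fps L]_n.
Local Notation RP := (Rprime_pred L).
Local Notation kap := (kap L).
Local Notation codim := (codim kap).
Local Notation eps := (eps Q).
Local Notation q := #|F|.
Local Notation z := ((q%:R : rat)^-1).
Local Notation Z := (fpsC z : fps rat).
Local Notation T := (fpsX : fps rat).
Local Notation lattices X P := (@lattices F (fps L) kap (RP j.+1) n X P).
Local Notation zset := (@zset (fps L)).

(** The states of the peeling: a coordinate moves from [A] to [B] when all its
    values lie in the maximal ideal [T R_j], and leaves both sets otherwise. *)
Definition mixbox (A B : {set 'I_n}) l : set (fps L)^o :=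
  if l \in A then RPset (L:=L) j.+1 else if l \in B then XRPset (L:=L) j else zset.

Definition ext_codim c (M : set V) := codim (ext Q j M) M c.

Lemma submod_mixbox A B l : submod (RP j.+1) (mixbox A B l).
Proof.
rewrite /mixbox; case: ifP => _; first exact: (submod_RPset Q (leqnn _)).
case: ifP => _; first exact: (submod_XRPset Q (leqnSn _)).
exact: submod_zset.
Qed.

Section Compat.
Variables (A B : {set 'I_n}) (i : 'I_n).
Variables (M1 : set V) (v : V).
Hypotheses (sM1 : submod (RP j.+1) M1) (M1X : M1 `<=` box (upd (mixbox A B) i zset)).
Hypotheses (Xv : box (mixbox A B) v) (v1 : v 0 i = 1).
Let M := extend (RP j.+1) (mixbox A B) i 1 M1 v.

Let sM : submod (RP j.+1) M.
Proof. exact: (submod_extend (RP_subring L j.+1) (RP_kap Q j.+1) (submod_mixbox A B)). Qed.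

Let M_0 x : M x /\ x 0 i = 0 <-> M1 x.
Proof.
apply: (extend0 (e := 1) (RP_kap Q j.+1) (submod_mixbox A B)) => //.
by move=> f; rewrite mulr1.
Qed.

Let MvM1 : M v.
Proof. by apply: (extend_v (RP_subring L j.+1)) => //; case: sM1. Qed.

Let M1_0 x : M1 x -> x 0 i = 0.
Proof. by move=> /M_0[]. Qed.

Let ext1_0 x : ext Q j M1 x -> x 0 i = 0.
Proof. by move=> [y [w [/M1_0 y0 /M1_0 w0 ->]]]; rewrite !mxE y0 w0 mulr0 addr0. Qed.

Let ext_decomp x : ext Q j M x -> x 0 i \in RP j /\ ext Q j M1 (x - x 0 i *: v).
Proof.
move=> [y [w [[f [fj yf My _]] [g [gj wg Mw _]] ->]]].
have fR := RP_weaken Q fj; have gR := RP_weaken Q gj.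
rewrite !mxE yf wg !mulr1; split.
  exact (RP_add fR (RP_mul (RP_eps Q j) gR)).
exists (y - f *: v), (w - g *: v); split; [exact: My|exact: Mw|].
by rewrite scalerBr scalerA scalerDl opprD addrACA.
Qed.

Let sub1 : ext Q j M1 `<=` ext Q j M.
Proof.
by move=> _ [x [y [/M_0[Mx _] /M_0[My _] ->]]]; exists x, y.
Qed.

Let RPv u : u \in RP j -> ext Q j M (u *: v).
Proof.
move=> uj; have [_ _ sE] := ext_submod Q sM; apply: sE => //.
by apply: sub_ext => //; case: sM.
Qed.

(** [R_j M] differs from [R_j M1 + M] by [R_j v] modulo [R_(j+1) v], which is one
    dimension; the rest of the quotient comes from [M1]. *)
Lemma ext_codim_extend c :
  ext_codim c M <-> exists2 c', c = c'.+1 & ext_codim c' M1.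
Proof.
pose B0 : set V := [set x | ext Q j M x /\ x 0 i \in RP j.+1].
have sE := ext_submod Q sM; have kE := submod_kap Q sE.
have sE1 := ext_submod Q sM1; have kE1 := submod_kap Q sE1.
have kM := submod_kap Q sM.
have cB : codim (ext Q j M) B0 1.
  apply: (codim_pullback (V := V) (V' := (fps L)^o) (f := fun x : V => x 0 i)
           _ _ _ _ _ (codim_RPset Q j)).
  - by move=> x y _ _; rewrite mxE.
  - by move=> a x _; rewrite mxE.
  - by move=> x /ext_decomp[].
  - move=> u uj; exists (u *: v); first exact: RPv.
    by rewrite mxE v1 mulr1.
  - by [].
have kB := subsp_codim kE cB.
have MB : M `<=` B0.
  move=> x Mx; split; first by apply: sub_ext => //; case: sM.
  by have [f [fj xf _ _]] := Mx; rewrite xf mulr1.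
have iso c' : codim B0 M c' <-> ext_codim c' M1.
  apply: codim_iso2 => //.
  - move=> x E1x; split; first exact: sub1.
    by rewrite ext1_0 // RP_zero.
  - move=> x; split=> [M1x|[/ext1_0 x0 Mx]]; last exact/M_0.
    split; first by apply: sub_ext => //; case: sM1.
    by have /M_0[] := M1x.
  - move=> x [/ext_decomp[_ E1x] xj]; exists (x 0 i *: v) => //.
    by case: sM => _ _; apply.
split=> [cM|[c' -> cM1]]; last by rewrite -add1n; apply: (codim_trans kE cB); exact/iso.
have BE : B0 `<=` ext Q j M by move=> x [].
have [a [b [ca cb ab]]] := codim_split kE kB MB BE cM.
have a1 := codim_uniq kE ca cB.
by exists b; [rewrite -ab a1|exact/iso].
Qed.
End Compat.

(** The recursion satisfied by the generating functions of lattices in a box with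
    [a] coordinates of type [R_(j+1)] and [b] of type [T R_j], where [h] is the
    answer once no coordinate of the first type is left. *)
Fixpoint mixgf (h : nat -> nat -> fps rat) a b c : fps rat :=
  if a is a'.+1 then
    T * (Z ^+ (a + b) * mixgf h a' b.+1 c) +
    (if c is c'.+1 then mixgf h a' b c' else 0)
  else h b c.

Lemma genfun_mixbox (h : nat -> nat -> fps rat) :
  (forall (B : {set 'I_n}) c, genfun (z ^+ #|B|)
     (fun k => lattices (mixbox finset.set0 B) (ext_codim c) k) (h #|B| c)) ->
  forall a (A B : {set 'I_n}) c, #|A| = a -> (forall l, l \in A -> l \notin B) ->
  genfun (z ^+ (a + #|B|)) (fun k => lattices (mixbox A B) (ext_codim c) k)
    (mixgf h a #|B| c).
Proof.
move=> hh; elim=> [|a IH] A B c cA AB.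
  by move/eqP: cA; rewrite cards_eq0 => /eqP->; exact: hh.
have [i iA] : exists i, i \in A by apply/set0Pn; rewrite -card_gt0 cA.
have cA' : #|A :\ i| = a by have := cardsD1 i A; rewrite iA cA => -[].
have iB : i \notin B := AB i iA.
have cB' : #|i |: B| = #|B|.+1 by rewrite cardsU1 iB.
have Xi : mixbox A B i = RPset (L:=L) j.+1 by rewrite /mixbox iA.
have X'E : upd (mixbox A B) i (XRPset (L:=L) j) = mixbox (A :\ i) (i |: B).
  apply/funext => l; rewrite /upd /mixbox !inE.
  by case: eqP.
have X0E : upd (mixbox A B) i zset = mixbox (A :\ i) B.
  apply/funext => l; rewrite /upd /mixbox !inE.
  by case: eqP => // ->; rewrite (negPf iB).
have cY : codim (mixbox A B i) (XRPset (L:=L) j) 1.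
  by rewrite Xi; exact: codim_XRPset.
have Xe : mixbox A B i 1 by rewrite Xi; exact: RP_one.
have Y'e : ~ XRPset (L:=L) j 1.
  move=> /(XRPset_max Q)[_]; have [e _] := cf_scalar Q 1.
  by rewrite coefs1 /= -(scale1r (1 : L)) e => /eqP; rewrite oner_eq0.
have egen y : mixbox A B i y -> exists2 f, f \in RP j.+1 & y = f * 1.
  by rewrite Xi => yj; exists y; rewrite ?mulr1.
have eunit y : mixbox A B i y -> ~ XRPset (L:=L) j y ->
    exists2 u, u \in RP j.+1 & u * y = 1.
  rewrite Xi => yj ny; apply: RP_inv => //; apply: contra_not_neq ny => y0.
  by apply/(XRPset_max Q); split=> //; rewrite y0; case: (cf_zero Q).
have ereg (f : fps L) : f * 1 = 0 -> f = 0 by rewrite mulr1.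
have AB' l : l \in A :\ i -> l \notin B by rewrite !inE => /andP[_ /AB].
have AB'' l : l \in A :\ i -> l \notin i |: B.
  by rewrite !inE => /andP[/negPf-> /AB].
move=> k; pose P0 (M1 : set V) := exists2 c', c = c'.+1 & ext_codim c' M1.
have [N0 cN0 fN0] : exists2 N0, has_card (lattices (mixbox (A :\ i) B) P0 k) N0 &
    coefs (if c is c'.+1 then mixgf h a #|B| c' else 0) k = z ^+ (a + #|B|) ^+ k * N0%:R.
  rewrite /P0; case: (c) => [|c'].
    by exists 0%N; rewrite ?mulr0 //; apply: has_card0 => M [_ _ []].
  have [N0 cN0 fN0] := IH _ _ c' cA' AB' k; exists N0 => //.
  apply: has_card_eq cN0 => M; split=> [[sM cM eM]|[sM cM [_ [<-] eM]]] //.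
  by split=> //; exists c'.
have [N' cN' fN'] : exists2 N', if (1 <= k)%N
    then has_card (lattices (mixbox (A :\ i) (i |: B)) (ext_codim c) (k - 1)) N'
    else N' = 0%N &
    coefs (T * (Z ^+ (a.+1 + #|B|) * mixgf h a #|B|.+1 c)) k =
      z ^+ (a.+1 + #|B|) ^+ k * N'%:R.
  rewrite coefs_XM; case: k {N0 cN0 fN0} => [|k]; first by exists 0%N; rewrite ?mulr0.
  have [N' cN' fN'] := IH _ _ c cA' AB'' k.
  exists N'; first by rewrite subn1.
  rewrite -(rmorphXn (@fpsC rat)) coefs_fpsCM -cB' fN' mulrA cB' addnS addSn.
  by rewrite -exprS.
exists (N' + N0 * q ^ k)%N; last first.
  rewrite coefsD fN' fN0 natrD natrM natrX mulrDr; congr (_ + _).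
  by rewrite mulrCA -exprMn addSn exprSr mulfVK ?q_neq0 // mulrC.
rewrite -X'E in cN'; rewrite -X0E in cN0.
exact: (has_card_split (P := ext_codim c) (P0 := P0) (RP_subring L j.+1)
  (RP_kap Q j.+1) (submod_mixbox A B)
  (submod_XRPset Q (leqnSn j)) cY Xe Y'e egen eunit ereg
  (fun M1 v sM1 M1X Xv v1 => ext_codim_extend sM1 M1X Xv v1 c) cN' cN0).
Qed.
End Mixed.

(** * From [R_(j+1)] to [R_j] *)

Section FibreCounts.
Variable F : finFieldType.
Local Notation q := #|F|.

Definition order_GL c := (\prod_(l < c) (q ^ c - q ^ l))%N.

(** The number of [M] over a given [M'] when multiplication by [eps_j] is
    nilpotent of rank [a]. *)
Definition fibre_nilp r a c : rat :=
  (\prod_(l < c) (q ^ (2 * r) - q ^ (2 * r - a + l)))%N%:R / (order_GL c)%:R.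

Definition fibre_inert r c : rat :=
  (\prod_(l < c) (q ^ (2 * r) - q ^ (l + l)))%N%:R / (order_GL c)%:R.

End FibreCounts.

Section Descent.
Variables (F : finFieldType) (L : fieldExtType (F : fieldType)) (Q : quad_basis L).
Variables (n : nat) (S : {set 'I_n}).
Local Notation V := 'rV[fps L]_n.
Local Notation RP := (Rprime_pred L).
Local Notation kap := (kap L).
Local Notation codim := (codim kap).
Local Notation q := #|F|.
Local Notation z := ((q%:R : rat)^-1).
Local Notation Z := (fpsC z : fps rat).
Local Notation T := (fpsX : fps rat).
Local Notation zset := (@zset (fps L)).
Local Notation Rbox := (@Rbox F L n S).

Definition sublattices i j (P : set V -> Prop) k : set (set V) :=
  [set M | [/\ submod (RP i) M, codim (Rbox j) M k & P M]].

(** Dividing by [T] turns lattices in [T R_j^S] into lattices in [R_j^S]. *)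
Lemma genfun_Xmul w j c f :
  genfun w (fun k => sublattices j.+1 j (ext_codim Q j c) k) f ->
  genfun w (fun k => @lattices F (fps L) kap (RP j.+1) n
                       (@mixbox F L n j finset.set0 S) (ext_codim Q j c) k) f.
Proof.
move=> H k; have [N cN fN] := H k; exists N => //.
have XE : box (@mixbox F L n j finset.set0 S) = Xmul (Rbox j).
  rewrite -XRboxE; congr box; apply/funext => l.
  by rewrite /mixbox inE.
have s0 (D : set V) : submod (RP j.+1) D -> D `<=` ext Q j D.
  by move=> [D0 _ _]; exact: sub_ext.
apply: (has_card_bij (g := fun M : set V => Xmul M) cN).
  by move=> M M' _ _; exact: Xmul_inj.
move=> M; split=> [[sM cM eM]|[M2 [sM2 cM2 eM2] <-]]; last first.
  split.
  - exact: (proj1 (submod_Xmul _ _) sM2).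
  - by rewrite XE; exact: (proj1 (codim_Xmul k (codim_sub cM2)) cM2).
  - have M2E := s0 _ sM2; have [+ _] := codim_Xmul c M2E.
    by rewrite /ext_codim ext_Xmul; apply.
pose M2 : set V := [set x : V | M (fpsX *: x)].
have ME : Xmul M2 = M.
  apply/seteqP; split=> [_ [x Mx ->] //|x Mx].
  have := codim_sub cM Mx; rewrite XE => -[y _ xy].
  by exists y; rewrite /M2 /= -?xy.
have sM2 : submod (RP j.+1) M2 by apply: (proj2 (submod_Xmul _ _)); rewrite ME.
have M2R : M2 `<=` Rbox j.
  move=> x Mx; apply: (proj1 (Xmul_fpsX _ _)).
  by rewrite -XE; exact: (codim_sub cM Mx).
exists M2; last exact: ME.
split; first exact: sM2.
  by have [_] := codim_Xmul k M2R; rewrite ME -XE; apply.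
by have [_] := codim_Xmul c (s0 _ sM2); rewrite -ext_Xmul ME; apply.
Qed.

Lemma ext_sub_Rbox j M k : submod (RP j.+1) M -> codim (Rbox j) M k ->
  ext Q j M `<=` Rbox j.
Proof.
move=> sM cM; apply: ext_min; last exact: codim_sub cM.
exact: (submod_Rbox Q S (leqnn j)).
Qed.

Lemma codim_ext_split j M k c : submod (RP j.+1) M -> codim (Rbox j) M k ->
  ext_codim Q j c M -> (c <= k)%N /\ codim (Rbox j) (ext Q j M) (k - c).
Proof.
move=> sM cM eM; have kR := submod_kap Q (submod_Rbox Q S (leqnn j)).
have kE := submod_kap Q (ext_submod Q sM).
have ME : M `<=` ext Q j M by apply: sub_ext; case: sM.
have [a [b [ca cb <-]]] := codim_split kR kE ME (ext_sub_Rbox sM cM) cM.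
by rewrite -(codim_uniq kE cb eM) leq_addl addnK.
Qed.

Lemma ext_codim_exists j M k : submod (RP j.+1) M -> codim (Rbox j.+1) M k ->
  exists2 a, ext_codim Q j a M & (a <= 2 * #|S|)%N.
Proof.
move=> sM cM; have kR := submod_kap Q (submod_Rbox Q S (leqnn j)).
have cM' := codim_trans kR (codim_RboxS Q S j) cM.
have kE := submod_kap Q (ext_submod Q sM).
have ME : M `<=` ext Q j M by apply: sub_ext; case: sM.
have [a [b [ca cb ab]]] := codim_split kR kE ME (ext_sub_Rbox sM cM') cM'.
exists b => //.
by have [] := has_card_fibre_nilp 0 sM cM cb.
Qed.

(** Sorting the modules [M] by [M' = R_j M]. *)
Lemma has_card_sublattices_ext j c k (G : set (set V)) N w : (c <= k)%N ->
  (forall M', G M' -> submod (RP j) M' /\ codim (Rbox j) M' (k - c)) ->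
  has_card G N -> (forall M', G M' -> has_card (fibre Q j c M') w) ->
  has_card [set M | sublattices j.+1 j (ext_codim Q j c) k M /\ G (ext Q j M)] (N * w).
Proof.
move=> ck GR cG cf; apply: (has_card_fibre (f := ext Q j) cG) => [M []//|M' GM'].
apply: has_card_eq (cf M' GM') => M; split=> [[sM EM cM]|[[[sM cM eM] _] EM]].
  split=> //; split; last by rewrite EM.
  split=> //; last by rewrite /ext_codim EM.
  have [sM' cM'] := GR M' GM'.
  rewrite -(subnK ck); apply: (codim_trans _ cM' cM).
  exact: (submod_kap Q (submod_Rbox Q S (leqnn j))).
by split=> //; rewrite -EM.
Qed.

Local Notation D := (order_GL F).

Lemma order_GL_gt0 c : (0 < D c)%N.
Proof.
rewrite prodn_gt0 // => l; rewrite subn_gt0 ltn_exp2l //.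
exact: finRing_gt1.
Qed.

Let card_div N c P : (N * D c = P)%N ->
  N = (P %/ D c)%N /\ (N%:R : rat) = P%:R / (D c)%:R.
Proof.
move=> <-; have D0 := order_GL_gt0 c; rewrite mulnK //; split=> //.
by rewrite natrM mulfK // pnatr_eq0 -lt0n.
Qed.

Let csum k (f : nat -> fps rat) m :
  coefs (\sum_(a < m) f a) k = \sum_(a < m) coefs (f a) k.
Proof.
elim: m => [|m IH]; first by rewrite !big_ord0.
by rewrite !big_ord_recr coefsD IH.
Qed.

(** The dimension of [R_j M / M] is defined for every lattice and is at most twice
    the rank, so the sum over it is finite. *)
Lemma genfun_total j (g : nat -> fps rat) :
  (forall a, genfun (z ^+ #|S|)
     (fun k => sublattices j.+1 j.+1 (ext_codim Q j a) k) (g a)) ->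
  genfun (z ^+ #|S|) (fun k => sublattices j.+1 j.+1 (fun _ => True) k)
    (\sum_(a < (2 * #|S|).+1) g a).
Proof.
move=> H k.
have /choice[N NP] a : exists N, has_card (sublattices j.+1 j.+1 (ext_codim Q j a) k) N /\
    coefs (g a) k = z ^+ #|S| ^+ k * N%:R.
  by have [N] := H a k; exists N.
exists (\sum_(a <- index_iota 0 (2 * #|S|).+1) N a)%N; last first.
  rewrite csum natr_sum mulr_sumr big_mkord; apply: eq_bigr => a _.
  by case: (NP a).
apply: (has_card_sum (B := fun a => sublattices j.+1 j.+1 (ext_codim Q j a) k)).
- exact: iota_uniq.
- move=> a b M [sM cM eM] [_ _ eM'].
  exact: (codim_uniq (submod_kap Q (ext_submod Q sM)) eM eM').
- move=> M; split=> [[sM cM _]|[a _ [sM cM _]]]; last by split.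
  have [a eM a2] := ext_codim_exists sM cM; exists a; first by rewrite mem_index_iota.
  by split.
- by move=> a _; case: (NP a).
Qed.

Lemma genfun_inert c :
  genfun (z ^+ #|S|) (fun k => sublattices 1 0 (ext_codim Q 0 c) k)
    (T ^+ c * (fpsC ((z ^+ #|S|) ^+ c * fibre_inert F #|S| c) * zetaO F #|S|)).
Proof.
move=> k; rewrite coefsXnM; case: (leqP c k) => ck; last first.
  exists 0%N; last by rewrite mulr0.
  apply: has_card0 => M [sM cM eM]; have [] := codim_ext_split sM cM eM.
  by rewrite leqNgt ck.
have bE : box (powbox (L:=L) S (fun _ => 0%N)) = Rbox 0.
  congr box; apply/funext => l; rewrite /powbox; case: ifP => // _.
  by apply/seteqP; split=> f //= _; exact: (RP_level0 Q).
have [N cN fN] := genfun_powbox Q (fun _ => 0%N) (erefl #|S|) (k - c)%N.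
pose w := ((\prod_(l < c) (q ^ (2 * #|S|) - q ^ (l + l))) %/ D c)%N.
pose G := sublattices 0 0 (fun _ => True) (k - c).
have cG : has_card G N.
  by apply: has_card_eq cN => M; rewrite /G /sublattices /lattices /= bE.
have cf M' : G M' -> has_card (fibre Q 0 c M') w.
  move=> [sM' cM' _]; have [N' cN' eN'] := has_card_fibre_inert Q c sM' cM'.
  by rewrite /w -(proj1 (card_div eN')).
exists (N * w)%N.
  apply: has_card_eq (has_card_sublattices_ext ck _ cG cf) => [M|M' [sM' cM' _]] //.
  split=> [[]//|[sM cM eM]]; have [_ cE] := codim_ext_split sM cM eM.
  by split=> //; split=> //; exact: ext_submod.
have wE : N%:R * w%:R = N%:R * fibre_inert F #|S| c :> rat.
  have [->|[M' GM']] := has_card_inh cG; first by rewrite !mul0r.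
  have [sM' cM' _] := GM'; have [N' cN' eN'] := has_card_fibre_inert Q c sM' cM'.
  by rewrite /w -(proj1 (card_div eN')) (proj2 (card_div eN')).
rewrite coefs_fpsCM fN natrM wE -{2}(subnK ck) exprD; ring.
Qed.

(** Sort by [M' = R_(i+1) M] and then by the rank [a] of [eps_(i+1)] on
    [M' / T M'], which is the invariant [dim (R_i M' / M')] of the previous
    level. *)
Lemma genfun_nilp i c (g : nat -> fps rat) :
  (forall a, genfun (z ^+ #|S|)
     (fun k => sublattices i.+1 i.+1 (ext_codim Q i a) k) (g a)) ->
  genfun (z ^+ #|S|) (fun k => sublattices i.+2 i.+1 (ext_codim Q i.+1 c) k)
    (\sum_(a < (2 * #|S|).+1)
       T ^+ c * (fpsC ((z ^+ #|S|) ^+ c * fibre_nilp F #|S| a c) * g a)).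
Proof.
move=> H k; case: (leqP c k) => ck; last first.
  exists 0%N; last first.
    rewrite mulr0 (csum k
      (fun a => T ^+ c * (fpsC (z ^+ #|S| ^+ c * fibre_nilp F #|S| a c) * g a))).
    by rewrite big1 // => a _; rewrite coefsXnM ck.
  apply: has_card0 => M [sM cM eM]; have [] := codim_ext_split sM cM eM.
  by rewrite leqNgt ck.
have /choice[N NP] a : exists N,
    has_card (sublattices i.+1 i.+1 (ext_codim Q i a) (k - c)) N /\
    coefs (g a) (k - c) = z ^+ #|S| ^+ (k - c) * N%:R.
  by have [N] := H a (k - c)%N; exists N.
pose w a := ((\prod_(l < c) (q ^ (2 * #|S|) - q ^ (2 * #|S| - a + l))) %/ D c)%N.
pose Gs a := sublattices i.+1 i.+1 (ext_codim Q i a) (k - c).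
exists (\sum_(a <- index_iota 0 (2 * #|S|).+1) N a * w a)%N.
  apply: (has_card_sum (B := fun a => [set M |
    sublattices i.+2 i.+1 (ext_codim Q i.+1 c) k M /\ Gs a (ext Q i.+1 M)])).
  - exact: iota_uniq.
  - move=> a b M [_ [sM cM eM]] [_ [_ _ eM']].
    exact: (codim_uniq (submod_kap Q (ext_submod Q sM)) eM eM').
  - move=> M; split=> [lM|[a _ []]] //; have [sM cM eM] := lM.
    have [_ cE] := codim_ext_split sM cM eM.
    have sE := ext_submod Q sM.
    have [a eE a2] := ext_codim_exists sE cE; exists a; first by rewrite mem_index_iota.
    by split.
  - move=> a _; apply: has_card_sublattices_ext => //.
    + by move=> M' [].
    + by case: (NP a).
    + move=> M' [sM' cM' eM']; have [_ [N' cN' eN']] := has_card_fibre_nilp c sM' cM' eM'.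
      by rewrite /w -(proj1 (card_div eN')).
rewrite (csum k
  (fun a => T ^+ c * (fpsC (z ^+ #|S| ^+ c * fibre_nilp F #|S| a c) * g a))).
rewrite natr_sum mulr_sumr big_mkord; apply: eq_bigr => a _.
have [cG fN] := NP a.
have wE : (N a)%:R * (w a)%:R = (N a)%:R * fibre_nilp F #|S| a c :> rat.
  have [->|[M' GM']] := has_card_inh cG; first by rewrite !mul0r.
  have [sM' cM' eM'] := GM'; have [_ [N' cN' eN']] := has_card_fibre_nilp c sM' cM' eM'.
  by rewrite /w -(proj1 (card_div eN')) (proj2 (card_div eN')).
rewrite coefsXnM ltnNge ck coefs_fpsCM fN natrM wE -{2}(subnK ck) exprD; ring.
Qed.
End Descent.

Section Recursion.
Variables (F : finFieldType) (L : fieldExtType (F : fieldType)) (Q : quad_basis L).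
Variable n : nat.
Local Notation q := #|F|.
Local Notation z := ((q%:R : rat)^-1).
Local Notation T := (fpsX : fps rat).

(** The generating function of the [R_(j+1)]-submodules [M] of [R_j^r] with
    [dim (R_j M / M) = c]. *)
Fixpoint subgf j r c : fps rat :=
  if j is i.+1 then
    \sum_(a < (2 * r).+1)
      T ^+ c * (fpsC ((z ^+ r) ^+ c * fibre_nilp F r a c) * mixgf F (subgf i) r 0 a)
  else T ^+ c * (fpsC ((z ^+ r) ^+ c * fibre_inert F r c) * zetaO F r).

Lemma genfun_Rbox j (S : {set 'I_n}) :
  (forall (B : {set 'I_n}) c,
     genfun (z ^+ #|B|) (fun k => sublattices B j.+1 j (ext_codim Q j c) k)
       (subgf j #|B| c)) ->
  forall a, genfun (z ^+ #|S|) (fun k => sublattices S j.+1 j.+1 (ext_codim Q j a) k)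
    (mixgf F (subgf j) #|S| 0 a).
Proof.
move=> H a.
have := genfun_mixbox (fun B c => genfun_Xmul (H B c)) (A := S) (B := finset.set0)
  a erefl.
rewrite cards0 addn0 => G k; have [|N cN fN] := G _ k; first by move=> l; rewrite inE.
exists N => //; apply: has_card_eq cN => M.
have bE : box (@mixbox F L n j S finset.set0) = Rbox S j.+1.
  by congr box; apply/funext => l; rewrite /mixbox inE.
by rewrite /lattices /sublattices /= bE.
Qed.

Lemma genfun_subgf j (S : {set 'I_n}) c :
  genfun (z ^+ #|S|) (fun k => sublattices S j.+1 j (ext_codim Q j c) k) (subgf j #|S| c).
Proof.
elim: j S c => [|j IH] S c; first exact: genfun_inert.
by apply: genfun_nilp; exact: genfun_Rbox.
Qed.

Lemma genfun_sublattices j (S : {set 'I_n}) :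
  genfun (z ^+ #|S|)
    (fun k => sublattices S j.+1 j.+1 (fun _ : set 'rV[fps L]_n => True) k)
    (\sum_(a < (2 * #|S|).+1) mixgf F (subgf j) #|S| 0 a).
Proof.
apply: genfun_total; apply: genfun_Rbox => B c; exact: genfun_subgf.
Qed.
End Recursion.

(** * The zeta series counts sublattices *)

Section Link.
Variables (F : finFieldType) (L : fieldExtType (F : fieldType)) (Q : quad_basis L).
Variables (n j : nat).
Local Notation q := #|F|.
Local Notation z := ((q%:R : rat)^-1).
Local Notation RP := (Rprime_pred L).
Local Notation kap := (kap L).
Local Notation codim := (codim kap).
Local Notation R := (Rprime L j).
Local Notation V := 'rV[fps L]_n.
Local Notation W := 'rV[R]_n.
Local Notation S := [set: 'I_n]%SET.
Local Notation Rbox := (@Rbox F L n S).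

Definition emb (x : W) : V := map_mx (@Rprime_val _ L j) x.

Lemma embD x y : emb (x + y) = emb x + emb y.
Proof. by apply/rowP => i; rewrite !mxE Rprime_valD. Qed.

Lemma embB x y : emb (x - y) = emb x - emb y.
Proof. by apply/rowP => i; rewrite !mxE Rprime_valB. Qed.

Lemma embZ (f : R) x : emb (f *: x) = Rprime_val f *: emb x.
Proof. by apply/rowP => i; rewrite !mxE Rprime_valM. Qed.

Lemma emb0 : emb 0 = 0.
Proof. by apply/rowP => i; rewrite !mxE. Qed.

Lemma emb_inj : injective emb.
Proof.
move=> x y /rowP e; apply/rowP => i; have := e i; rewrite !mxE.
exact: Rprime_val_inj.
Qed.

Lemma emb_Rbox x : Rbox j (emb x).
Proof. by move=> i; rewrite inE mxE /RPset /=; case: (x 0 i). Qed.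

Lemma Rbox_emb y : Rbox j y -> exists x, emb x = y.
Proof.
move=> Ry; have yP i : y 0 i \in RP j by have := Ry i; rewrite inE.
exists (\row_i MkRprime (yP i)).
by apply/rowP => i; rewrite !mxE.
Qed.

Definition restr (M : set V) : set W := [set x | M (emb x)].

Lemma submod_restr M : submod (RP j) M -> submod_closed [in restr M].
Proof.
move=> [M0 MD MZ].
have memE (x : W) : (x \in [in restr M]) <-> M (emb x).
  by split=> [/set_mem|Mx]; [|exact: mem_set].
split; first by apply/memE; rewrite emb0.
move=> f x y /memE Mx /memE My; apply/memE; rewrite embD embZ.
by apply: MD => //; apply: MZ => //; case: (f).
Qed.

(** The cosets are the fibres of a linear surjection onto [F^k]. *)
Lemma has_card_cosets M k : submod (RP j) M -> codim (Rbox j) M k ->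
  has_card (cosets (restr M)) (q ^ k).
Proof.
move=> sM [phi qphi]; have kR := submod_kap Q (submod_Rbox Q S (leqnn j)).
have /choice[s sP] (w : 'rV[F]_k) : exists x, phi (emb x) = w.
  have [y Ry <-] := quotmap_surj qphi w.
  by have [x <-] := Rbox_emb Ry; exists x.
have Ms x y : restr M (x - y) <-> phi (emb x) = phi (emb y).
  rewrite /restr /= embB; symmetry.
  by apply: (quotmap_eq kR qphi); exact: emb_Rbox.
have card_rV : #|[pred w : 'rV[F]_k | true]| = (q ^ k)%N.
  by rewrite -[in RHS](mul1n k) -card_mx; apply: eq_card.
rewrite -card_rV.
apply: (has_card_bij (g := fun w => [set y | restr M (y - s w)]) (has_card_fin _)).
  move=> w w' _ _ /seteqP[e _].
  have : [set y | restr M (y - s w)] (s w) by apply/Ms.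
  by move/e/Ms; rewrite !sP.
move=> C; split=> [[x _ <-]|[w _ <-]]; last by exists (s w).
exists (phi (emb x)) => //.
by apply/seteqP; split=> y /Ms e; apply/Ms; rewrite e sP.
Qed.

Fixpoint Xpow N : set V := if N is N'.+1 then Xmul (Xpow N') else Rbox j.

Lemma codim_Xpow N : Xpow N `<=` Rbox j /\ codim (Rbox j) (Xpow N) (2 * #|S| * N).
Proof.
have sR := submod_Rbox Q S (leqnn j); have kR := submod_kap Q sR.
elim: N => [|N [IH1 IH2]].
  by rewrite muln0; split=> //; apply: codim_refl; case: sR.
have XR : Xmul (Rbox j) `<=` Rbox j by exact: (Xmul_sub sR).
split; first by move=> _ [x /IH1 Rx ->]; apply: XR; exists x.
rewrite mulnS; apply: (codim_trans kR (codim_Rbox_X Q S j)).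
by have [+ _] := codim_Xmul (2 * #|S| * N) IH1; apply.
Qed.

Lemma Xpow_fpsX N y : Xpow N y <-> exists2 x, Rbox j x & y = fpsX ^+ N *: x.
Proof.
elim: N y => [|N IH] y /=.
  by split=> [Ry|[x Rx ->]]; [exists y|]; rewrite ?expr0 ?scale1r.
split=> [[x /IH[w Rw ->] ->]|[x Rx ->]]; first by exists w; rewrite // scalerA -exprS.
by exists (fpsX ^+ N *: x); [apply/IH; exists x|rewrite scalerA -exprS].
Qed.

Lemma one_sub_fpsXn d : (0 < d)%N ->
  exists u : R, u * (1 - MkRprime (RP_X L j) ^+ d) = 1.
Proof.
move=> d0; set f := 1 - _.
have f0 : coefs (Rprime_val f) 0 != 0.
  rewrite Rprime_valB Rprime_valX Rprime_val1 coefsB coefs1 -[_ ^+ d]mulr1 coefsXnM d0.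
  by rewrite subr0 oner_eq0.
have fj : Rprime_val f \in RP j by case: (f).
have [g gj gf] := RP_inv fj f0.
by exists (MkRprime gj); apply/Rprime_val_inj; rewrite Rprime_valM.
Qed.

(** A submodule [M'] of finite index contains a power of [T] times the whole
    lattice, so it has some codimension over the base field; the number of cosets
    then determines it. *)
Lemma codim_of_index (M' : set W) k : submodules_of_index R n (q ^ k) M' ->
  exists2 M, submod (RP j) M /\ codim (Rbox j) M k & restr M = M'.
Proof.
move=> [sM' finM' cM']; pose M : set V := [set y | exists2 x, M' x & y = emb x].
have rM : restr M = M'.
  apply/seteqP; split=> [x [y My /emb_inj->]//|x Mx].
  by exists x.
have sM : submod (RP j) M.
  split.
  - by exists 0; [exact: submod0|rewrite emb0].
  - move=> _ _ [x Mx ->] [y My ->]; exists (x + y); first exact: submodD.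
    by rewrite embD.
  - move=> f _ fj [x Mx ->]; exists (MkRprime fj *: x); first exact: submodZ.
    by rewrite embZ.
exists M => //; split=> //.
have sR := submod_Rbox Q S (leqnn j); have kR := submod_kap Q sR.
have MR : M `<=` Rbox j by move=> _ [x _ ->]; exact: emb_Rbox.
have XM : Xpow (quot_card M') `<=` M.
  move=> y /Xpow_fpsX[x /Rbox_emb[w <-] ->].
  exists (MkRprime (RP_X L j) ^+ quot_card M' *: w).
    by apply: exprM_submod => // d d0; exact: one_sub_fpsXn.
  by rewrite embZ Rprime_valX.
have [_ cX] := codim_Xpow (quot_card M').
have [k' [b [ck' _ _]]] := codim_split kR (submod_kap Q sM) XM MR cX.
have [_ e] := has_card_fset (has_card_cosets sM ck').
rewrite rM -/(quot_card M') cM' in e.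
suff -> : k = k' by [].
by apply/eqP; rewrite -(eqn_exp2l _ _ (finRing_gt1 F)) e.
Qed.

Lemma coh_zeta_genfun (f : fps rat) :
  genfun (z ^+ n) (fun k => sublattices S j j (fun _ : set V => True) k) f ->
  coh_zeta R n q = f.
Proof.
move=> H; apply/fpsP => k; have [N cN ->] := H k.
rewrite /coh_zeta /= exprVn; congr (_ * _%:R).
suff /has_card_fset[] : has_card (submodules_of_index R n (q ^ k)) N by [].
apply: (has_card_bij (g := restr) cN) => [M M' [_ cM _] [_ cM' _] e|M'].
  have H2 (A B : set V) : A `<=` Rbox j -> restr A = restr B -> A `<=` B.
    move=> AR eAB y Ay; have [x xy] := Rbox_emb (AR y Ay).
    have : restr A x by rewrite /restr /= xy.
    by rewrite eAB /restr /= xy.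
  by apply/seteqP; split; apply: H2 => //; [exact: codim_sub cM|exact: codim_sub cM'].
split=> [/codim_of_index[M [sM cM] <-]|[M [sM cM _] <-]]; first by exists M.
have [fin card] := has_card_fset (has_card_cosets sM cM).
by split=> //; exact: submod_restr.
Qed.
End Link.

(** * Solving the recursion *)

Section QSeriesRat.
Variable F : finFieldType.
Local Notation q := #|F|.
Local Notation qr := (q%:R : rat).
Local Notation z := (qr^-1).
Local Notation Z := (fpsC z : fps rat).
Local Notation T := (fpsX : fps rat).

Lemma card_gt1 : (1 < q)%N. Proof. exact: finRing_gt1. Qed.

Lemma z_lt1 : 0 < z < 1.
Proof.
have q0 : 0 < qr by rewrite ltr0n; exact: ltnW card_gt1.
by rewrite invr_gt0 q0 invf_lt1 // ltr1n card_gt1.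
Qed.

Lemma subr1_zX_neq0 k : 1 - z ^+ k.+1 != 0.
Proof.
have /andP[z0 z1] := z_lt1.
rewrite subr_eq0 eq_sym Order.POrderTheory.lt_eqF //.
by rewrite exprn_ilt1 // Order.POrderTheory.ltW.
Qed.

Lemma qpoch_z_neq0 d k : qpoch (z ^+ d.+1) (z ^+ d.+1) k != 0.
Proof.
by apply/prodf_neq0 => i _; rewrite -exprS -exprM mulnS addSn subr1_zX_neq0.
Qed.

Lemma qpoch_split (x : rat) a c : (c <= a)%N ->
  qpoch x x a = qpoch x x (a - c) * \prod_(l < c) (1 - x ^+ (a - l)).
Proof.
elim: c => [|c IH] ca; first by rewrite subn0 big_ord0 mulr1.
rewrite IH ?(ltnW ca) // (_ : a - c = (a - c.+1).+1)%N; last by lia.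
rewrite {1}/qpoch !big_ord_recr /= -/(qpoch _ _ _) -exprS -!mulrA.
congr (_ * _); rewrite mulrC; congr (_ * (1 - _ ^+ _)); lia.
Qed.

Lemma exprM_prod (x : rat) c (f : 'I_c -> rat) :
  x ^+ c * \prod_(l < c) f l = \prod_(l < c) (x * f l).
Proof. by rewrite big_split /= prodr_const card_ord. Qed.

Lemma q_expB a l : (l <= a)%N -> qr ^+ a * z ^+ (a - l) = qr ^+ l.
Proof.
by move=> la; rewrite -{1}(subnKC la) exprD exprVn mulfK // expf_neq0 ?q_neq0.
Qed.

Lemma order_GL_rat c :
  (order_GL F c)%:R = qr ^+ (c * c) * qpoch z z c :> rat.
Proof.
rewrite (qpoch_split z (leqnn c)) subnn {1}/qpoch big_ord0 mul1r natr_prod.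
rewrite exprM exprM_prod.
apply: eq_bigr => l _; rewrite natrB ?leq_exp2l ?card_gt1 ?(ltnW (ltn_ord l)) //.
by rewrite !natrX mulrBr mulr1 q_expB // ltnW.
Qed.

Lemma fibre_nilp_rat r a c : (c <= r)%N -> (c <= a)%N -> (a <= 2 * r)%N ->
  z ^+ r ^+ c * fibre_nilp F r a c =
  qr ^+ (c * (r - c)) * (qpoch z z a / (qpoch z z c * qpoch z z (a - c))).
Proof.
move=> cr ca ar; rewrite /fibre_nilp order_GL_rat natr_prod.
have -> : \prod_(l < c) ((q ^ (2 * r) - q ^ (2 * r - a + l))%N%:R : rat) =
    qr ^+ (2 * r * c) * \prod_(l < c) (1 - z ^+ (a - l)).
  rewrite exprM exprM_prod; apply: eq_bigr => l _.
  have la : (l < a)%N by apply: leq_trans ca.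
  rewrite natrB ?leq_exp2l ?card_gt1 //; last by lia.
  rewrite !natrX mulrBr mulr1 (_ : a - l = 2 * r - (2 * r - a + l))%N; last by lia.
  by rewrite q_expB //; lia.
have n1 := qpoch_z_neq0 0 c; have n2 := qpoch_z_neq0 0 (a - c).
rewrite !expr1 in n1 n2; have qn := q_neq0 F.
rewrite (qpoch_split z ca).
rewrite -exprM exprVn (_ : 2 * r * c = r * c + c * (r - c) + c * c)%N; last by nia.
rewrite !exprD.
have e1 : qr ^+ (r * c) != 0 by rewrite expf_neq0.
have e2 : qr ^+ (c * c) != 0 by rewrite expf_neq0.
by field; rewrite n1 n2 e1 e2.
Qed.

Lemma fibre_nilp0 r a c : (a < c)%N -> (a <= 2 * r)%N -> fibre_nilp F r a c = 0.
Proof.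
move=> ac ar; rewrite /fibre_nilp (bigD1 (Ordinal ac)) //=.
by rewrite subnK // subnn mul0n mul0r.
Qed.

Lemma fibre_inert_rat r c : (c <= r)%N ->
  z ^+ r ^+ c * fibre_inert F r c =
  qr ^+ (c * (r - c)) *
  (qpoch (z ^+ 2) (z ^+ 2) r / (qpoch z z c * qpoch (z ^+ 2) (z ^+ 2) (r - c))).
Proof.
move=> cr; rewrite /fibre_inert order_GL_rat natr_prod.
have -> : \prod_(l < c) ((q ^ (2 * r) - q ^ (l + l))%N%:R : rat) =
    qr ^+ (2 * r * c) * \prod_(l < c) (1 - (z ^+ 2) ^+ (r - l)).
  rewrite exprM exprM_prod; apply: eq_bigr => l _.
  have lr : (l < r)%N by apply: leq_trans cr.
  rewrite natrB ?leq_exp2l ?card_gt1 //; last by lia.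
  rewrite !natrX mulrBr mulr1 -exprM (_ : 2 * (r - l) = 2 * r - (l + l))%N; last by lia.
  by rewrite q_expB //; lia.
have n1 := qpoch_z_neq0 0 c; have n2 := qpoch_z_neq0 1 (r - c).
rewrite !expr1 in n1; have qn := q_neq0 F.
rewrite (qpoch_split (z ^+ 2) cr).
rewrite -exprM exprVn (_ : 2 * r * c = r * c + c * (r - c) + c * c)%N; last by nia.
rewrite !exprD.
have e1 : qr ^+ (r * c) != 0 by rewrite expf_neq0.
have e2 : qr ^+ (c * c) != 0 by rewrite expf_neq0.
move: (qpoch (z ^+ 2) _ _) n2 => P2 n2.
by field; rewrite n1 n2 e1 e2.
Qed.

Lemma fibre_inert0 r c : (r < c)%N -> fibre_inert F r c = 0.
Proof.
move=> rc; rewrite /fibre_inert (bigD1 (Ordinal rc)) //=.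
by rewrite mul2n -addnn subnn mul0n mul0r.
Qed.

Lemma qpoch_sqr k : qpoch (z ^+ 2) (z ^+ 2) k = qpoch z z k * qpoch (- z) z k.
Proof.
rewrite -big_split; apply: eq_bigr => i _ /=.
by rewrite exprAC mulNr opprK expr2 [z ^+ i ^+ 2]expr2; ring.
Qed.

Lemma qpoch_fpsC a x k : fpsC (qpoch a x k) = qpoch (fpsC a) (fpsC x) k :> fps rat.
Proof.
rewrite rmorph_prod; apply: eq_bigr => i _.
by rewrite rmorphB rmorphM rmorphXn rmorph1.
Qed.

Lemma fpsCM (x y : rat) : fpsC (x * y) = fpsC x * fpsC y :> fps rat.
Proof. exact: rmorphM. Qed.

Lemma fpsCX (x : rat) k : fpsC (x ^+ k) = fpsC x ^+ k :> fps rat.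
Proof. exact: rmorphXn. Qed.

Lemma fpsCV (x : rat) : fpsC x^-1 = (fpsC x)^-1 :> fps rat.
Proof.
have [->|x0] := eqVneq x 0; first by rewrite invr0 !raddf0 invr0.
rewrite -[RHS]div1r; apply: (canRL (mulrK _)); first by rewrite fps_unitE.
by rewrite -rmorphM mulVf ?rmorph1.
Qed.
End QSeriesRat.

Section Solve.
Variable F : finFieldType.
Local Notation q := #|F|.
Local Notation qr := (q%:R : rat).
Local Notation z := (qr^-1).
Local Notation Z := (fpsC z : fps rat).
Local Notation T := (fpsX : fps rat).
Local Notation p := (qpoch z z).

Lemma qpoch_z_self_neq0 k : p k != 0.
Proof. by have := qpoch_z_neq0 F 0 k; rewrite expr1. Qed.

Lemma qpoch_z_recr k : p k.+1 = p k * (1 - z ^+ k.+1).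
Proof. by rewrite /qpoch big_ord_recr /= -exprS. Qed.

Definition gauss a r : rat := if (r <= a)%N then p a / (p r * p (a - r)) else 0.

(** One of the two Pascal rules for Gaussian binomials. *)
Lemma gaussS a r : (r <= a.+1)%N ->
  gauss a.+1 r = gauss a r + (if r is r'.+1 then z ^+ (a - r') * gauss a r' else 0).
Proof.
have p0 : p 0 = 1 by rewrite /qpoch big_ord0.
rewrite /gauss; case: r => [|r] ra.
  by rewrite !subn0 p0 !mul1r !mulfV ?qpoch_z_self_neq0 ?addr0.
rewrite ra subSS; rewrite ltnS leq_eqVlt in ra; case/predU1P: ra => [->|ra].
  by rewrite ltnn leqnn subnn p0 !mulr1 !mulfV ?qpoch_z_self_neq0 ?mul1r ?add0r.
rewrite ra (ltnW ra) (_ : a - r = (a - r.+1).+1)%N; last by lia.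
rewrite !qpoch_z_recr (_ : z ^+ a.+1 = z ^+ (a - r.+1).+1 * z ^+ r.+1); last first.
  by rewrite -exprD; congr (_ ^+ _); lia.
have := qpoch_z_self_neq0 a; have := qpoch_z_self_neq0 r.
have := qpoch_z_self_neq0 (a - r.+1).
have := subr1_zX_neq0 F r; have := subr1_zX_neq0 F (a - r.+1).
move: (p a) (p r) (p _) (z ^+ r.+1) (z ^+ _) => x1 x2 x3 x4 x5 h1 h2 h3 h4 h5.
by field; rewrite h1 h2 h3 h4.
Qed.

Definition shifted (h : nat -> nat -> fps rat) r c d : fps rat :=
  if (d <= c)%N then h r (c - d)%N else 0.

(** The two branches of the recursion commute up to a power of [z], so iterating
    it gives a noncommutative binomial expansion; [r] counts the coordinates that
    end up of type [T R_j]. *)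
Lemma mixgf_gauss h a b c : mixgf F h a b c =
  \sum_(r < a.+1) fpsC (gauss a r) *
     (T ^+ r * Z ^+ (r * (b + r)) * shifted h (b + r) c (a - r)).
Proof.
elim: a b c => [|a IH] b c.
  have g0 : gauss 0 0 = 1 by rewrite /gauss /qpoch subnn !big_ord0.
  rewrite big_ord1 g0 rmorph1 mul0n !expr0 !mul1r.
  by rewrite /shifted addn0 leq0n [(c - 0)%N]subn0.
have -> : mixgf F h a.+1 b c =
    T * (Z ^+ (a.+1 + b) * mixgf F h a b.+1 c) +
    (if c is c'.+1 then mixgf F h a b c' else 0) by [].
have -> : (if c is c'.+1 then mixgf F h a b c' else 0) =
    \sum_(r < a.+1) fpsC (gauss a r) *
      (T ^+ r * Z ^+ (r * (b + r)) * shifted h (b + r) c (a.+1 - r)).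
  case: c => [|c].
    rewrite big1 => [//|r _]; have ra : (r <= a)%N by rewrite -ltnS.
    by rewrite /shifted (subSn ra) ltn0 !mulr0.
  rewrite IH; apply: eq_bigr => r _; have ra : (r <= a)%N by rewrite -ltnS.
  by rewrite (subSn ra) /shifted ltnS subSS.
transitivity (\sum_(r < a.+2) (fpsC (gauss a r) + (if (r : nat) is r'.+1
       then Z ^+ (a - r') * fpsC (gauss a r') else 0)) *
    (T ^+ r * Z ^+ (r * (b + r)) * shifted h (b + r) c (a.+1 - r))); last first.
  apply: eq_bigr => r _; rewrite gaussS -1?ltnS // rmorphD; congr ((_ + _) * _).
  by case: (r : nat) => [|r']; rewrite ?raddf0 // rmorphM rmorphXn.
rewrite (eq_bigr _ (fun r _ => mulrDl _ _ _)) big_split /= addrC.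
congr (_ + _); last first.
  have ga : gauss a a.+1 = 0 by rewrite /gauss ltnn.
  by rewrite [RHS]big_ord_recr /= ga raddf0 mul0r addr0.
rewrite [RHS]big_ord_recl mul0r add0r IH !mulr_sumr; apply: eq_bigr => r _.
have ra : (r <= a)%N by rewrite -ltnS.
rewrite lift0 /= (addSnnS b) subSS.
have -> : Z ^+ (r.+1 * (b + r.+1)) = Z ^+ (r * (b + r.+1)) * Z ^+ (b + r.+1).
  by rewrite -exprD; congr (_ ^+ _); rewrite mulSn addnC.
have -> : Z ^+ (a.+1 + b) = Z ^+ (a - r) * Z ^+ (b + r.+1).
  by rewrite -exprD; congr (_ ^+ _); lia.
rewrite exprS; ring.
Qed.

(** Each rank [a] that contributes is at most [r], and [c] is at most [a]. *)
Lemma subgf_gt i r c : (r < c)%N -> subgf F i r c = 0.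
Proof.
have mix0 k : (forall r c, (r < c)%N -> subgf F k r c = 0) ->
    forall r a, (r < a)%N -> mixgf F (subgf F k) r 0 a = 0.
  move=> IH r' a ra; rewrite mixgf_gauss big1 // => l _.
  rewrite /shifted; case: ifP => _; last by rewrite !mulr0.
  by rewrite IH ?mulr0 //; have := ltn_ord l; lia.
elim: i r c => [|i IH] r c rc.
  by rewrite /= fibre_inert0 // mulr0 raddf0 mul0r mulr0.
rewrite /= big1 // => a _; case: (ltnP r a) => ra; first by rewrite (mix0 _ IH) // !mulr0.
rewrite fibre_nilp0 ?mulr0 ?raddf0 ?mul0r ?mulr0 //; first exact: leq_ltn_trans rc.
by rewrite -ltnS.
Qed.

Lemma mixgf_subgf_gt i r a : (r < a)%N -> mixgf F (subgf F i) r 0 a = 0.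
Proof.
move=> ra; rewrite mixgf_gauss big1 // => l _; rewrite /shifted.
case: ifP => _; last by rewrite !mulr0.
by rewrite subgf_gt ?mulr0 //; have := ltn_ord l; lia.
Qed.

(** Will be the part of the multiple sum in which the last entries of the two
    tuples are [r] and [s]; the power of [T], the power of [Z] and [1 / (z; z)_r]
    come with the Gaussian binomial of the next summation. *)
Definition partial_sum i r s : fps rat :=
  if (s <= r)%N then T ^+ r * Z ^+ (r * r) * subgf F i r (r - s) * fpsC (p r)^-1 else 0.

Lemma mixgf_partial i r s : (s <= r)%N -> mixgf F (subgf F i) r 0 (r - s) =
  \sum_(r' < r.+1) fpsC (p r / p (r - r')) * partial_sum i r' s.
Proof.
move=> sr; rewrite mixgf_gauss; apply: eq_bigr => r' _.
have r'r : (r' <= r)%N by rewrite -ltnS.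
rewrite /gauss r'r /partial_sum /shifted !add0n.
have -> : (r - r' <= r - s)%N = (s <= r')%N by lia.
case: ifP => // sr'; last by rewrite !mulr0.
have -> : (r - s - (r - r') = r' - s)%N by lia.
have -> : p r / (p r' * p (r - r')) = p r / p (r - r') * (p r')^-1.
  by rewrite invfM; ring.
by rewrite [fpsC (_ * (p r')^-1)]rmorphM; ring.
Qed.

Lemma sum_trunc (f : nat -> fps rat) r N : (r <= N)%N ->
  (forall a, (r < a)%N -> f a = 0) -> \sum_(a < N.+1) f a = \sum_(a < r.+1) f a.
Proof.
move=> rN f0; rewrite -!(big_mkord xpredT) (big_cat_nat (n := r.+1)) //=.
rewrite [X in _ + X](_ : _ = 0) ?addr0 //.
by rewrite big_nat_cond big1 // => a /andP[/andP[/f0]].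
Qed.

Lemma sum_rev (f : nat -> fps rat) r :
  \sum_(a < r.+1) f a = \sum_(s < r.+1) f (r - s)%N.
Proof.
rewrite (reindex_inj rev_ord_inj); apply: eq_bigr => s _.
by rewrite /= subSS.
Qed.

Lemma total_partial i n : \sum_(a < (2 * n).+1) mixgf F (subgf F i) n 0 a =
  \sum_(s < n.+1) \sum_(r < n.+1) fpsC (p n / p (n - r)) * partial_sum i r s.
Proof.
rewrite (sum_trunc (f := fun a => mixgf F (subgf F i) n 0 a) (r := n)); last first.
- by move=> a; exact: mixgf_subgf_gt.
- by lia.
rewrite (sum_rev (fun a => mixgf F (subgf F i) n 0 a)); apply: eq_bigr => s _.
by rewrite mixgf_partial // -ltnS.
Qed.

(** Here [a = r - s'] and [c = r - s]; the Gaussian binomial in [a] and [c] counts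
    the fibres and the one in [r] and [r'] comes from [mixgf_partial]. *)
Lemma subgf_rec i r s : (s <= r)%N -> subgf F i.+1 r (r - s) =
  \sum_(s' < r.+1) \sum_(r' < r.+1) T ^+ (r - s) *
    fpsC (qr ^+ ((r - s) * s) * gauss (r - s') (r - s) * (p r / p (r - r'))) *
    partial_sum i r' s'.
Proof.
move=> sr; rewrite /= (sum_trunc (f := fun a => T ^+ (r - s) *
  (fpsC (z ^+ r ^+ (r - s) * fibre_nilp F r a (r - s)) * mixgf F (subgf F i) r 0 a))
  (r := r)).
- rewrite (sum_rev (fun a => T ^+ (r - s) *
    (fpsC (z ^+ r ^+ (r - s) * fibre_nilp F r a (r - s)) * mixgf F (subgf F i) r 0 a))).
  apply: eq_bigr => s' _; have s'r : (s' <= r)%N by rewrite -ltnS.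
  have -> : z ^+ r ^+ (r - s) * fibre_nilp F r (r - s') (r - s) =
      qr ^+ ((r - s) * s) * gauss (r - s') (r - s).
    rewrite /gauss; case: leqP => le; last by rewrite fibre_nilp0 ?mulr0 //; lia.
    by rewrite fibre_nilp_rat ?leq_subr // ?subKn //; lia.
  rewrite mixgf_partial // !mulr_sumr; apply: eq_bigr => r' _.
  by rewrite [fpsC (_ * (p r / _))]rmorphM; ring.
- by lia.
- by move=> a ra; rewrite mixgf_subgf_gt ?mulr0.
Qed.

End Solve.

(** * The multiple sum *)

Section MultiSum.
Variable F : finFieldType.
Local Notation q := #|F|.
Local Notation qr := (q%:R : rat).
Local Notation z := (qr^-1).
Local Notation Z := (fpsC z : fps rat).
Local Notation T := (fpsX : fps rat).
Local Notation p := (qpoch z z).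

(** The factor that the [i]-th entries [r], [s] contribute, given the previous
    entries [r'], [s']. The exponents are natural numbers: the truncation in
    [2 * r - s] is harmless as the binomial vanishes when [s > r]. *)
Definition step r' s' r s : fps rat :=
  T ^+ (2 * r - s) * Z ^+ (r * r + s * s - r * s) *
  inv_qpoch Z (r%:Z - r'%:Z) * qbinom Z (r%:Z - s'%:Z) (r%:Z - s%:Z).

Definition first_factor r s : fps rat :=
  (qpoch (T ^+ 2 * Z ^+ 2) (Z ^+ 2) r)^-1 * (qpoch (- Z) Z r / qpoch (- Z) Z s).

Lemma inv_qpochE k : inv_qpoch Z k%:Z = fpsC (p k)^-1.
Proof. by rewrite /= (fpsCV (p k)) qpoch_fpsC. Qed.

Lemma inv_qpoch_neg k : k < 0 -> inv_qpoch Z k = 0.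
Proof. by case: k. Qed.

Lemma qbinomE N M : qbinom Z N%:Z M%:Z = fpsC (gauss F N M).
Proof.
rewrite /qbinom /gauss /= lez_nat; case: leqP => MN; last by rewrite raddf0.
by rewrite subzn // fpsCM (fpsCV (_ * _)) fpsCM !qpoch_fpsC.
Qed.

Lemma step_gt_r r' s' r s : (r < r')%N -> step r' s' r s = 0.
Proof.
by move=> rr; rewrite /step inv_qpoch_neg ?mulr0 ?mul0r // subr_lt0 ltz_nat.
Qed.

Lemma step_gt_s r' s' r s : (r < s)%N -> step r' s' r s = 0.
Proof.
move=> rs; rewrite /step /qbinom subr_ge0 lez_nat leqNgt rs /=.
by rewrite mulr0.
Qed.

Lemma stepE r' s' r s : (r' <= r)%N -> (s' <= r)%N -> (s <= r)%N ->
  step r' s' r s = T ^+ (2 * r - s) *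
    fpsC (z ^+ (r * r + s * s - r * s) * (p (r - r'))^-1 * gauss F (r - s') (r - s)).
Proof.
move=> h1 h2 h3; rewrite /step !subzn // inv_qpochE qbinomE -!mulrA; congr (_ * _).
by rewrite -fpsCX -!fpsCM.
Qed.

Lemma z_exp_shift r s : (s <= r)%N ->
  z ^+ (r * r) * qr ^+ ((r - s) * s) = z ^+ (r * r + s * s - r * s).
Proof.
move=> sr; rewrite (_ : r * r + s * s - r * s = r * r - (r - s) * s)%N; last by nia.
have le : ((r - s) * s <= r * r)%N by nia.
by rewrite -{1}(subnK le) exprD -mulrA -exprMn mulVf ?q_neq0 // expr1n mulr1.
Qed.

Lemma partial_sum_rec i r s N : (r <= N)%N -> partial_sum F i.+1 r s =
  \sum_(r' < N.+1) \sum_(s' < N.+1) partial_sum F i r' s' * step r' s' r s.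
Proof.
move=> rN; have [sr|rs] := leqP s r; last first.
  rewrite {1}/partial_sum leqNgt rs big1 // => r' _; rewrite big1 // => s' _.
  by rewrite step_gt_s ?mulr0.
rewrite exchange_big /= (sum_trunc (f := fun s' => \sum_(r' < N.+1)
   partial_sum F i r' s' * step r' s' r s) rN); last first.
  move=> s' rs'; rewrite big1 // => r' _; case: (leqP r' r) => r'r.
    by rewrite /partial_sum leqNgt (leq_ltn_trans r'r rs') mul0r.
  by rewrite step_gt_r ?mulr0.
rewrite {1}/partial_sum sr subgf_rec // mulr_sumr mulr_suml; apply: eq_bigr => s' _.
rewrite (sum_trunc (f := fun r' => partial_sum F i r' s' * step r' s' r s) rN);
  last first.
  by move=> r' rr'; rewrite step_gt_r ?mulr0.
rewrite mulr_sumr mulr_suml; apply: eq_bigr => r' _.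
rewrite stepE // -1?ltnS // -z_exp_shift //.
rewrite (_ : 2 * r - s = r + (r - s))%N; last by lia.
have -> : z ^+ (r * r) * qr ^+ ((r - s) * s) * (p (r - r'))^-1 *
      gauss F (r - s') (r - s) =
    z ^+ (r * r) * (qr ^+ ((r - s) * s) * gauss F (r - s') (r - s) *
      (p r / p (r - r'))) * (p r)^-1.
  have := qpoch_z_self_neq0 F r; have := qpoch_z_self_neq0 F (r - r').
  move: (p r) (p _) (gauss _ _ _) => x1 x2 x3 h1 h2.
  by field; rewrite h1 h2.
rewrite exprD [fpsC (_ * (p r)^-1)]fpsCM [fpsC (z ^+ _ * _)]fpsCM fpsCX /=.
ring.
Qed.

Lemma partial_sum0 r s : partial_sum F 0 r s = step 0 0 r s * first_factor r s.
Proof.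
have [sr|rs] := leqP s r; last by rewrite step_gt_s // /partial_sum leqNgt rs mul0r.
rewrite /partial_sum sr stepE // /= fibre_inert_rat ?leq_subr // subKn // !subn0.
pose mz := qpoch (- z) z.
have m0 k : mz k != 0.
  have := qpoch_z_neq0 F 1 k; rewrite qpoch_sqr mulf_eq0 negb_or => /andP[_].
  by [].
have -> : first_factor r s = zetaO F r * fpsC (mz r / mz s).
  by rewrite fpsCM (fpsCV (mz s)) !qpoch_fpsC raddfN.
rewrite !qpoch_sqr -/(mz r) -/(mz s) -z_exp_shift // /gauss leq_subr subKn //.
rewrite (_ : 2 * r - s = r + (r - s))%N; last by lia.
rewrite exprD -fpsCX.
transitivity (T ^+ r * T ^+ (r - s) * zetaO F r *
  fpsC (z ^+ (r * r) * (qr ^+ ((r - s) * s) *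
    (p r * mz r / (p (r - s) * (p s * mz s)))) * (p r)^-1)).
  by rewrite !fpsCM; ring.
have -> : z ^+ (r * r) * (qr ^+ ((r - s) * s) *
      (p r * mz r / (p (r - s) * (p s * mz s)))) * (p r)^-1 =
    z ^+ (r * r) * qr ^+ ((r - s) * s) * (p r)^-1 *
      (p r / (p (r - s) * p s)) * (mz r / mz s).
  have := qpoch_z_self_neq0 F r; have := qpoch_z_self_neq0 F (r - s).
  have := qpoch_z_self_neq0 F s; have := m0 s.
  move: (p r) (p _) (p _) (mz s) => x1 x2 x3 x4 h1 h2 h3 h4.
  by field; rewrite h1 h2 h3 h4.
by rewrite [fpsC (_ * (mz r / mz s))]fpsCM; ring.
Qed.

Definition core m (u v : m.-tuple nat) : fps rat :=
  \prod_(1 <= i < m.+1) step (entry u i.-1) (entry v i.-1) (entry u i) (entry v i) *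
  first_factor (entry u 1) (entry v 1).

(** When some [s_i] exceeds [r_i] both sides vanish; otherwise all exponents are
    nonnegative and the powers split into products. *)
Lemma summand_core m n (u v : m.-tuple nat) :
  summand Z T n u v = inv_qpoch Z (n%:Z - (entry u m)%:Z) * core u v.
Proof.
case: (pselect (forall i, (0 < i <= m)%N -> (entry v i <= entry u i)%N)) => [vu|nvu];
  last first.
  have -> : summand Z T n u v = 0.
    apply/eqP; apply: contraPT isT => /summand_neq0 H _; apply: nvu => i im.
    by have /andP[] := H i im.
  have [i [im uv]] : exists i, (0 < i <= m)%N /\ (entry u i < entry v i)%N.
    apply: contrapT => H; apply: nvu => i im; rewrite leqNgt; apply/negP => uv.
    by apply: H; exists i.
  rewrite /core (bigD1_seq i) ?iota_uniq //=; last by rewrite mem_index_iota ltnS.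
  by rewrite step_gt_s // !mul0r mulr0.
rewrite /summand /core.
have vui i : (1 <= i < m.+1)%N -> (entry v i <= entry u i)%N by rewrite ltnS; exact: vu.
have -> : T ^ (\sum_(1 <= i < m.+1) (2 * (entry u i)%:Z - (entry v i)%:Z)) =
    \prod_(1 <= i < m.+1) T ^+ (2 * entry u i - entry v i).
  have -> : \sum_(1 <= i < m.+1) (2 * (entry u i)%:Z - (entry v i)%:Z) =
      (\sum_(1 <= i < m.+1) (2 * entry u i - entry v i))%N%:Z.
    rewrite (big_morph Posz PoszD (erefl _)); apply: eq_big_nat => i im.
    by have := vui i im; lia.
  by rewrite -exprnP (big_morph (fun k => T ^+ k) (exprD T) (expr0 T)).
have -> : Z ^ (\sum_(1 <= i < m.+1) ((entry u i)%:Z ^+ 2 - (entry u i)%:Z * (entry v i)%:Z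
        + (entry v i)%:Z ^+ 2)) =
    \prod_(1 <= i < m.+1)
      Z ^+ (entry u i * entry u i + entry v i * entry v i - entry u i * entry v i).
  have -> : \sum_(1 <= i < m.+1) ((entry u i)%:Z ^+ 2 - (entry u i)%:Z * (entry v i)%:Z
        + (entry v i)%:Z ^+ 2) =
      (\sum_(1 <= i < m.+1) (entry u i * entry u i + entry v i * entry v i
         - entry u i * entry v i))%N%:Z.
    rewrite (big_morph Posz PoszD (erefl _)); apply: eq_big_nat => i im.
    have := vui i im; move: (entry u i) (entry v i) => a b ba.
    by rewrite -subzn ?PoszD ?PoszM; [ring|nia].
  by rewrite -exprnP (big_morph (fun k => Z ^+ k) (exprD Z) (expr0 Z)).
rewrite /step /first_factor !big_split /=; ring.
Qed.
End MultiSum.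

Section TupleSum.
Variables (F : finFieldType) (n : nat).
Local Notation q := #|F|.
Local Notation z := ((q%:R : rat)^-1).
Local Notation Z := (fpsC z : fps rat).
Local Notation T := (fpsX : fps rat).
Local Notation p := (qpoch z z).
Local Notation I := 'I_n.+1.
Local Notation nats u := (map_tuple (@nat_of_ord n.+1) u).

Lemma entry_rcons m (u : m.-tuple I) (r : I) i :
  entry (nats (rcons_tuple u r)) i =
  if (i <= m)%N then entry (nats u) i else if i == m.+1 then (r : nat) else 0%N.
Proof.
rewrite /entry /= map_rcons -rcons_cons nth_rcons /= size_map size_tuple ltnS.
by [].
Qed.

(** The factors are arbitrary because only their indices matter. *)
Lemma prod_entry_rcons (R : comNzRingType) (st : nat -> nat -> nat -> nat -> R)
    (f0 : nat -> nat -> R) m (u v : m.-tuple I) (r s : I) : (0 < m)%N ->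
  let w1 := nats (rcons_tuple u r) in let w2 := nats (rcons_tuple v s) in
  \prod_(1 <= i < m.+2) st (entry w1 i.-1) (entry w2 i.-1) (entry w1 i) (entry w2 i) *
    f0 (entry w1 1) (entry w2 1) =
  \prod_(1 <= i < m.+1) st (entry (nats u) i.-1) (entry (nats v) i.-1)
                           (entry (nats u) i) (entry (nats v) i) *
    f0 (entry (nats u) 1) (entry (nats v) 1) *
    st (entry (nats u) m) (entry (nats v) m) r s.
Proof.
move=> m0 w1 w2.
have lo (w : m.-tuple I) x i : (i <= m)%N ->
    entry (nats (rcons_tuple w x)) i = entry (nats w) i.
  by move=> im; rewrite entry_rcons im.
have hi (w : m.-tuple I) (x : I) : entry (nats (rcons_tuple w x)) m.+1 = x.
  by rewrite entry_rcons ltnn eqxx.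
rewrite big_nat_recr //= !hi (lo u r _ m0) (lo v s _ m0) (lo u r m) // (lo v s m) //.
rewrite mulrAC; congr (_ * _ * _); apply: eq_big_nat => i /andP[i1 im].
have im' : (i.-1 <= m)%N by lia.
by rewrite (lo u r _ im') (lo v s _ im') (lo u r _ im) (lo v s _ im).
Qed.

Lemma core_rcons m (u v : m.-tuple I) (r s : I) : (0 < m)%N ->
  core F (nats (rcons_tuple u r)) (nats (rcons_tuple v s)) =
  core F (nats u) (nats v) * step F (entry (nats u) m) (entry (nats v) m) r s.
Proof. exact: (prod_entry_rcons (step F) (first_factor F)). Qed.

Lemma sum_rcons m (G : m.+1.-tuple I * m.+1.-tuple I -> fps rat) :
  \sum_uv G uv = \sum_(uv : m.-tuple I * m.-tuple I) \sum_(r : I) \sum_(s : I)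
    G (rcons_tuple uv.1 r, rcons_tuple uv.2 s).
Proof.
pose h (x : (m.-tuple I * m.-tuple I) * (I * I)) :=
  (rcons_tuple x.1.1 x.2.1, rcons_tuple x.1.2 x.2.2).
have h_inj : injective h.
  move=> [[u v] [r s]] [[u' v'] [r' s']] [/rcons_inj[eu ->] /rcons_inj[ev ->]].
  by congr ((_, _), (_, _)); exact: val_inj.
have h_bij : bijective h.
  apply: inj_card_bij h_inj _.
  by rewrite !card_prod !card_tuple !card_ord !expnS; lia.
rewrite (reindex h); last exact: onW_bij.
under [RHS]eq_bigr do rewrite pair_bigA.
by rewrite pair_bigA.
Qed.

(** Weighting by a function of the last entries lets the induction remove the last
    entries of both tuples. *)
Lemma sum_core j (f : nat -> nat -> fps rat) :
  \sum_(uv : j.+1.-tuple I * j.+1.-tuple I) core F (nats uv.1) (nats uv.2) *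
     f (entry (nats uv.1) j.+1) (entry (nats uv.2) j.+1) =
  \sum_(r < n.+1) \sum_(s < n.+1) partial_sum F j r s * f r s.
Proof.
elim: j f => [|j IH] f; rewrite sum_rcons.
  rewrite (big_pred1 ([tuple], [tuple])); last first.
    by move=> [u v]; apply/esym/eqP; congr (_, _); exact: tuple0.
  apply: eq_bigr => r _; apply: eq_bigr => s _.
  by rewrite /core big_nat1 partial_sum0 /entry.
under eq_bigr => uv _.
  under eq_bigr => r _.
    under eq_bigr => s _.
      rewrite core_rcons // !entry_rcons ltnn eqxx -mulrA.
      over.
    rewrite -mulr_sumr; over.
  rewrite -mulr_sumr; over.
rewrite (IH (fun r' s' => \sum_(r < n.+1) \sum_(s < n.+1) step F r' s' r s * f r s)).
under eq_bigr => r' _ do under eq_bigr => s' _ do rewrite mulr_sumr.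
under eq_bigr => r' _ do rewrite exchange_big /=.
rewrite exchange_big /=; apply: eq_bigr => r _.
under eq_bigr => r' _ do under eq_bigr => s' _ do rewrite mulr_sumr.
under eq_bigr => r' _ do rewrite exchange_big /=.
rewrite exchange_big /=; apply: eq_bigr => s _.
rewrite (@partial_sum_rec _ _ _ _ n) -1?ltnS // mulr_suml; apply: eq_bigr => r' _.
by rewrite mulr_suml; apply: eq_bigr => s' _; rewrite mulrA.
Qed.

(** The entries in the support are at most [n], so the sum runs over tuples of
    ordinals. *)
Lemma fsum_summand j :
  \sum_(rs \in [set: j.+1.-tuple nat * j.+1.-tuple nat]) summand Z T n rs.1 rs.2 =
  \sum_(r < n.+1) \sum_(s < n.+1) partial_sum F j r s * inv_qpoch Z (n%:Z - r%:Z).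
Proof.
rewrite -(sum_core j (fun r s => inv_qpoch Z (n%:Z - r%:Z))).
pose g (uv : j.+1.-tuple I * j.+1.-tuple I) := (nats uv.1, nats uv.2).
have g_inj : injective g.
  move=> [u v] [u' v'] [/(inj_map val_inj) eu /(inj_map val_inj) ev].
  by congr (_, _); exact: val_inj.
rewrite (fsbigE (map g (index_enum _))).
- rewrite big_map big_mkcond /=; apply: eq_bigr => uv _.
  by rewrite in_setT summand_core mulrC.
- by rewrite map_inj_uniq // index_enum_uniq.
- by [].
move=> [u v] _ nuv; apply/eqP; apply: contraNT nuv => /summand_neq0 H.
have bound (w : j.+1.-tuple nat) : (forall i, (0 < i <= j.+1)%N -> (entry w i <= n)%N) ->
    nats (map_tuple (@inord n) w) = w.
  move=> wn; apply: eq_from_tnth => i; rewrite !tnth_map /= inordK // ltnS.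
  by have := wn i.+1; rewrite /entry /= (tnth_nth 0%N); apply; rewrite /= ltn_ord.
apply/mapP; exists (map_tuple (@inord n) u, map_tuple (@inord n) v).
  exact: mem_index_enum.
rewrite /g /= !bound // => i /H /andP[] //.
exact: leq_trans.
Qed.

Lemma qpoch_fsum_summand j :
  qpoch Z Z n * \sum_(rs \in [set: j.+1.-tuple nat * j.+1.-tuple nat])
                   summand Z T n rs.1 rs.2 =
  \sum_(a < (2 * n).+1) mixgf F (subgf F j) n 0 a.
Proof.
rewrite total_partial fsum_summand mulr_sumr exchange_big /=; apply: eq_bigr => r _.
rewrite mulr_sumr; apply: eq_bigr => s _.
have rn : (r <= n)%N by rewrite -ltnS.
by rewrite subzn // inv_qpochE fpsCM qpoch_fpsC; ring.
Qed.
End TupleSum.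

Theorem corollary3p16 (F : finFieldType) (L : fieldExtType F) (m n : nat)
    (dimL : \dim {:L} = 2%N) (m_gt0 : (0 < m)%N) (n_gt0 : (0 < n)%N) :
  let q := #|F| in
  let z : fps rat := fpsC (q%:R^-1) in
  let t : fps rat := fpsX in
  coh_zeta (Rprime L m) n q =
    qpoch z z n *
    \sum_(rs \in [set: m.-tuple nat * m.-tuple nat])
       summand z t n rs.1 rs.2.
Proof.
move=> q z t; case: m m_gt0 => // j _.
have [Q] := quad_basis_exists dimL.
have H := genfun_sublattices Q j [set: 'I_n]%SET.
rewrite cardsT card_ord in H.
by rewrite /z /t /q qpoch_fsum_summand; exact: (coh_zeta_genfun Q H).
Qed.
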